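(* Let $\Sigma$ be an ordered alphabet of size $\sigma$ and let $w \in \Sigma^n$ be an arbitrary word (not necessarily a Lyndon word). Then $\mathrm{Lynd}(w)$, the number of Lyndon words $x\in\Sigma^n$ with $x \le w$ in lexicographic order, can be computed in $O(n^2\log\sigma)$ time in the word-RAM model, and in $O(n^2)$ time in the unit-cost RAM model.
   Context: Words are compared in the lexicographic order: $u<v$ if $u$ is a proper prefix of $v$, or if at the first position where they differ $u$ has the smaller letter. A cyclic rotation of $w$ is a word obtained by moving some number of first letters of $w$ to its end. A word is primitive if it is not of the form $u^k$ with $k\ge 2$. A Lyndon word is a word that is primitive and lexicographically not greater than any of its cyclic rotations (equivalently, strictly smaller than all its nontrivial cyclic rotations). Word-RAM model: a machine word has at least $\max(\log\sigma,\log n)$ bits, arithmetic operations on numbers fitting in a constant number of machine words take constant time, and basic arithmetic operations on (large) numbers of size at most $\sigma^n$ take $O(n)$ time. Unit-cost RAM model: every arithmetic operation, on integers of any size, takes constant time. *)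

(* Defs.v *)
From mathcomp Require Import all_boot all_order.
From mathcomp Require Import boolp.

Set Implicit Arguments.
Unset Strict Implicit.
Unset Printing Implicit Defensive.

(* The ordered alphabet of size sigma is 'I_sigma. *)

Definition lexle (sigma : nat) (u v : seq 'I_sigma) : bool :=
  (u <= v :> seqlexi 'I_sigma)%O.

Definition word_power (T : Type) (u : seq T) (k : nat) : seq T :=
  flatten (nseq k u).

Definition primitive (T : Type) (x : seq T) : Prop :=
  forall (u : seq T) (k : nat), 2 <= k -> x <> word_power u k.

Definition lyndon (sigma : nat) (x : seq 'I_sigma) : Prop :=
  primitive x /\ forall i : nat, lexle x (rot i x).

Definition Lynd (sigma n : nat) (w : n.-tuple 'I_sigma) : nat :=
  #|[set x : n.-tuple 'I_sigma | `[< lyndon x >] && lexle x w]|.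

(* Random access machines over natural numbers.  Memory cells hold numbers of
   any size; the two models below differ in what they charge and support. *)

Inductive arith := Add | Sub | Mul | Div.

(* Subtraction is truncated, division is Euclidean with quotient 0 when the
   divisor is 0. *)
Definition arith_op (o : arith) : nat -> nat -> nat :=
  match o with Add => addn | Sub => subn | Mul => muln | Div => divn end.

Inductive expr :=
  | Const of nat
  | Read of expr
  | Arith of arith & expr & expr.

Inductive cmd :=
  | Skip
  | Write of expr & expr
  | Seq of cmd & cmd
  | If of expr & cmd & cmd
  | While of expr & cmd.

Definition memory := nat -> nat.

Definition update (m : memory) (i v : nat) : memory :=
  fun j => if j == i then v else m j.

(* [charge v] is the time of one elementary operation whose operands and result
   have maximum v; None means that the machine does not support it. *)
Record machine := Machine {
  charge : nat -> option nat;
  addressable : pred nat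
}.

(* Value of an expression and evaluation time; None if the machine gets stuck. *)
Fixpoint eval (M : machine) (m : memory) (e : expr) : option (nat * nat) :=
  match e with
  | Const v => if charge M v is Some t then Some (v, t) else None
  | Read a =>
      if eval M m a is Some (i, t1) then
        if addressable M i then
          if charge M (m i) is Some t then Some (m i, t1 + t) else None
        else None
      else None
  | Arith o e1 e2 =>
      if eval M m e1 is Some (x, t1) then
        if eval M m e2 is Some (y, t2) then
          let z := arith_op o x y in
          if charge M (maxn (maxn x y) z) is Some t
          then Some (z, t1 + t2 + t) else None
        else None
      else None
  end.

(* [exec M m c m' t]: from memory m the program c halts in memory m' after
   time exactly t.  Conditions test whether a number is nonzero. *)
Inductive exec (M : machine) : memory -> cmd -> memory -> nat -> Prop :=
  | ExecSkip m :
      exec M m Skip m 1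
  | ExecWrite m a e i v t1 t2 t :
      eval M m a = Some (i, t1) -> eval M m e = Some (v, t2) ->
      addressable M i -> charge M v = Some t ->
      exec M m (Write a e) (update m i v) (t1 + t2 + t)
  | ExecSeq m m1 m2 c1 c2 t1 t2 :
      exec M m c1 m1 t1 -> exec M m1 c2 m2 t2 ->
      exec M m (Seq c1 c2) m2 (t1 + t2)
  | ExecIf m m' e c1 c2 v t1 t2 :
      eval M m e = Some (v, t1) ->
      exec M m (if v != 0 then c1 else c2) m' t2 ->
      exec M m (If e c1 c2) m' (t1 + 1 + t2)
  | ExecWhileStop m e c t1 :
      eval M m e = Some (0, t1) ->
      exec M m (While e c) m (t1 + 1)
  | ExecWhileStep m m1 m2 e c v t1 t2 t3 :
      eval M m e = Some (v, t1) -> v != 0 ->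
      exec M m c m1 t2 -> exec M m1 (While e c) m2 t3 ->
      exec M m (While e c) m2 (t1 + 1 + t2 + t3).

Definition unit_cost_ram : machine :=
  Machine (fun _ => Some 1) predT.

(* W is the number of bits of a machine word and k the constant number of words
   on which operations take constant time; addresses must fit in k words.
   Beyond that, numbers up to sigma ^ n are supported at cost n, and larger
   ones not at all. *)
Definition word_ram (k W sigma n : nat) : machine :=
  Machine
    (fun v => if v < 2 ^ (k * W) then Some 1
              else if v <= sigma ^ n then Some n
              else None)
    (fun i => i < 2 ^ (k * W)).

(* Cell 0 holds n, cell 1 holds sigma, cells 2, ..., n + 1 the letters of w;
   all other cells are 0. *)
Definition input (sigma n : nat) (w : n.-tuple 'I_sigma) : memory :=
  nth 0 [:: n, sigma & [seq val a | a <- w]].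

(* The result is left in cell 0. *)
Definition computes_within
    (M : machine) (p : cmd) (m : memory) (r bound : nat) : Prop :=
  exists (m' : memory) (t : nat),
    [/\ exec M m p m' t, m' 0 = r & t <= bound].

(* Base-2 logarithm as a factor of a time bound: rounded up, and at least 1 so
   that the bound does not vanish on a one-letter alphabet. *)
Definition log_factor (sigma : nat) : nat := maxn 1 (up_log 2 sigma).

(* Main.v *)
Require Import Defs.
From mathcomp Require Import all_boot all_order all_algebra.
From mathcomp Require Import boolp zify ring.

(* Let v be the largest word v <= w such that v_b <= v_t whenever v[0..t) has a
   border of length b; Duval's algorithm finds it in linear time, and the words
   minimal among their rotations exceed w exactly when they exceed v.  Read a
   word cyclically with an automaton whose state is the length of the current
   match with v: an equal letter advances, a larger letter resets to 0, a
   smaller one kills the run.  All rotations of x exceed v iff exactly one state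
   is mapped to itself by x.  Hence, with c_i the number of letters larger than
   v_i and C(z) = sum_i c_i z^(i+1), the number of such words of length d is the
   coefficient N_d of z^d in z C'(z) / (1 - C(z)).  Sieving sigma^d - N_d over
   the divisors d of n leaves, for d = n, the number n * Lynd(w).

   For each divisor d, the coefficient N_d is extracted by Graeffe's iteration
   A(z) / Q(z) = A(z) Q(-z) / (Q(z) Q(-z)).  A step halves the degree and at most
   doubles the number of base-beta limbs of the coefficients, so the total size
   stays O(d); Karatsuba multiplication after Kronecker substitution makes all
   steps together cost O(log d * d^(log_2 3)) = O(d^2), and the sum of d^2 over
   the divisors d of n is at most 2 n^2.  As beta = O(n^2 sigma), everything so
   far uses numbers of a constant number of machine words; only the last 2 n
   Horner steps, which assemble the result, handle numbers as large as sigma^n,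
   at cost O(n) each.  The same program therefore runs in time O(n^2) on both
   machines. *)

Set Implicit Arguments.
Unset Strict Implicit.
Unset Printing Implicit Defensive.

(** * Counting necklaces *)

(** The direct recurrence for [1 / (1 - C(z))] takes about [d^2] operations on numbers of up to [d]
    words; at cost [n] each this is cubic when [d = n]. This obstacle is why one single coefficient
    is extracted, from numbers cut into limbs. Their size is controlled by the sum of all entries
    ([weight]): it is submultiplicative, so a Graeffe step at most squares it while the number of
    limbs doubles, and [beta] only has to exceed the weights of [z C'(z)] and [1 - C(z)]. Machine
    numbers are naturals with truncated subtraction, so a coefficient is a pair of a positive and a
    negative part, never normalised; multiplying pairs is one more Kronecker substitution, evaluated
    at [-1]. The wanted coefficient always stays the last one: if [m = 2 m' + par], keeping the
    indices of parity [par] moves index [m] to [m']. Uniqueness of the fixed state is a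
    synchronisation property of the automaton: as [v] satisfies the border condition, every
    surviving run of at least [n] letters ends in the same state as the run from 0. *)

Definition border (v : nat -> nat) (b t : nat) : Prop :=
  b <= t /\ forall j, j < b -> v j = v (t - b + j).

Lemma border0 (v : nat -> nat) t : border v 0 t. Proof. by []. Qed.

Lemma borderS (v : nat -> nat) b t : border v b t -> v b = v t -> border v b.+1 t.+1.
Proof.
move=> [bt e] ebt; split=> // j; rewrite ltnS leq_eqVlt => /orP[/eqP ->|jb].
  by rewrite ebt; congr v; lia.
by rewrite e //; congr v; lia.
Qed.

(** Says that no suffix is smaller than the prefix of the same length, which characterises the
    prefixes of necklaces: a letter [v t < v b] after a border of length [b] would make the shift by
    [t - b] smaller than [v]. *)
Definition prenecklace (v : nat -> nat) (m : nat) : Prop :=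
  forall b t, b < t -> t < m -> border v b t -> v b <= v t.

Definition lexgt (n : nat) (f g : nat -> nat) : Prop :=
  exists j, [/\ j < n, forall l, l < j -> f l = g l & g j < f j].

Definition shift (p : nat) (f : nat -> nat) : nat -> nat := fun i => f (p + i).

Lemma lexgt_ext n f f' g g' :
  (forall i, i < n -> f i = f' i) -> (forall i, i < n -> g i = g' i) ->
  lexgt n f g -> lexgt n f' g'.
Proof.
move=> ef eg [j [jn ej lj]]; exists j; split=> //.
- by move=> l lj'; rewrite -ef -?eg ?ej //; lia.
- by rewrite -ef -?eg.
Qed.

(** Transitivity for [g < f <= h], with [f <= h] given as a failed strict comparison: [h] agrees
    with [f] until it exceeds it, or up to the position that decides [g < f]. *)
Lemma lexgt_trans n f g h : lexgt n f g -> ~ lexgt n f h -> lexgt n h g.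
Proof.
move=> [j [jn ej lj]] nfh.
have key : forall i, i <= j -> (lexgt n h g) \/ forall l, l < i -> h l = f l.
  elim=> [|i IHi] ij; first by right.
  case: (IHi (ltnW ij)) => [|e]; first by left.
  case: (ltngtP (h i) (f i)) => [lt|gt|eq].
  - by case: nfh; exists i; split=> // [|l li]; [lia|rewrite e].
  - left; exists i; split=> //; first lia.
      by move=> l li; rewrite e // ej //; lia.
    by rewrite -ej.
  - right=> l; rewrite ltnS leq_eqVlt => /orP[/eqP -> //|]; exact: e.
case: (key j (leqnn j)) => // e.
case: (ltngtP (h j) (f j)) => [lt|gt|eq].
- by case: nfh; exists j; split=> // l lj'; rewrite e.
- exists j; split=> //; last by lia.
  by move=> l lj'; rewrite e // ej.
- exists j; split=> //; last by rewrite eq.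
  by move=> l lj'; rewrite e // ej.
Qed.

(** * The matching automaton and its synchronisation *)

Section Automaton.

Variables (n : nat) (v : nat -> nat).

(** Completing the match ([q.+1 = n]) also kills the run, because a rotation equal to [v] does not
    exceed it. *)
Definition step (q a : nat) : option nat :=
  if a == v q then if q.+1 < n then Some q.+1 else None
  else if v q < a then Some 0 else None.

Fixpoint trace (f : nat -> nat) (q l : nat) : option nat :=
  if l is l'.+1 then
    if trace f q l' is Some r then step r (f l') else None
  else Some q.

Lemma step_lt q a r : 0 < n -> step q a = Some r -> r < n.
Proof. by rewrite /step; case: eqP => _; case: ifP => // h n0 [<-]. Qed.

Lemma trace_lt f q l r : 0 < n -> q < n -> trace f q l = Some r -> r < n.
Proof.
move=> n0 qn; elim: l r => [|l IHl] r /=; first by case=> <-.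
by case: trace => // r' /(step_lt n0).
Qed.

Lemma trace_ext f g q l :
  (forall i, i < l -> f i = g i) -> trace f q l = trace g q l.
Proof.
elim: l => //= l IHl e; rewrite IHl ?e // => i il.
by apply: e; lia.
Qed.

Lemma trace_add f q a l :
  trace f q (a + l) =
  if trace f q a is Some r then trace (shift a f) r l else None.
Proof.
elim: l => [|l IHl]; first by rewrite addn0; case: trace.
by rewrite addnS /= IHl; case: trace.
Qed.

Lemma trace_prefix f q a l r :
  trace f q (a + l) = Some r ->
  exists2 r', trace f q a = Some r' & trace (shift a f) r' l = Some r.
Proof. by rewrite trace_add; case: trace => // r' h; exists r'. Qed.

Hypothesis n0 : 0 < n.
Hypothesis pn : prenecklace v n.

Lemma prenecklace_le b t : t < n -> border v b t -> v b <= v t.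
Proof.
move=> tn bt; move: (bt.1); rewrite leq_eqVlt => /orP[/eqP -> //|lt].
exact: pn.
Qed.

(* A surviving run of length n from any state certifies that the word read is
   larger than v: as long as it agrees with v, the state keeps growing. *)
Lemma trace_lexgt f i r : i < n -> trace f i n = Some r -> lexgt n f v.
Proof.
move=> lin tr.
have key j : j <= n -> lexgt n f v \/
    [/\ forall l, l < j -> f l = v l, trace f i j = Some (i + j), i + j < n
      & border v j (i + j)].
  elim: j => [|j IHj] jn.
    by right; split=> //; rewrite ?addn0.
  case: (IHj (ltnW jn)) => [|[e tj ijn bj]]; first by left.
  have [r' tr' _] : exists2 r', trace f i j.+1 = Some r' &
      trace (shift j.+1 f) r' (n - j.+1) = Some r.
    by apply: trace_prefix; rewrite subnKC.
  have lev := prenecklace_le ijn bj.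
  have gtc : v j < f j -> lexgt n f v by move=> h; exists j.
  move: tr' => /=; rewrite tj /step; case: eqP => [ef|_].
    case: ifP => // sij _.
    case: (ltnP (v j) (f j)) => [/gtc|le]; first by left.
    have evj : v j = v (i + j) by lia.
    right; split; rewrite ?addnS //.
    - by move=> l; rewrite ltnS leq_eqVlt => /orP[/eqP ->|/e //]; lia.
    - exact: borderS.
  by case: ifP => // lt _; left; apply: gtc; lia.
case: (key n (leqnn n)) => // [[_ _]]; lia.
Qed.

(** Since [v r' <= v r] for a border [r'] of [r], a letter that survives at [r] survives at [r'],
    and a letter that resets [r] also resets [r']. Hence the second run stays on a border of the
    first one, and both coincide from the first reset of the first run on; [r = i + l] means that no
    reset has occurred. *)
Lemma trace_sync f i j l r : i < n -> border v j i -> trace f i l = Some r ->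
  exists r', [/\ trace f j l = Some r', border v r' r & r = i + l \/ r' = r].
Proof.
move=> lin bji; elim: l r => [|l IHl] r /=.
  by case=> <-; exists j; split=> //; left; rewrite addn0.
case tr: (trace f i l) => [r1|] // st.
have [r1' [t1 b1 o1]] := IHl _ tr.
have r1n := trace_lt n0 lin tr.
have lev := prenecklace_le r1n b1.
have brr t : border v t t by split=> // k _; congr v; lia.
rewrite t1; case: (r1' =P r1) => [e|ne].
  by rewrite e st; exists r; split=> //; right.
have e1 : r1 = i + l by case: o1.
have lt1 : r1' < r1 by have := b1.1; lia.
move: st; rewrite /step; case: (f l =P v r1) => [e|_].
  case: ifP => // h [<-]; case: (f l =P v r1') => [e'|ne'].
    rewrite (_ : r1'.+1 < n); last by lia.
    exists r1'.+1; split=> //; last by left; lia.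
    by apply: borderS => //; lia.
  rewrite (_ : v r1' < f l); last by lia.
  by exists 0; split=> //; left; lia.
case: ifP => // h [<-].
rewrite (_ : (f l == v r1') = false); last by lia.
by rewrite (_ : v r1' < f l); [exists 0; split=> //; right|lia].
Qed.

(** States stay below [n], so a run of at least [n] letters has been reset; 0 is a border of every
    state. *)
Lemma trace_sync0 f i l r : i < n -> n <= l -> trace f i l = Some r ->
  trace f 0 l = Some r.
Proof.
move=> lin nl tr; have [r' [t0 _]] := trace_sync lin (border0 v i) tr.
by case=> [e|<- //]; have := trace_lt n0 lin tr; lia.
Qed.

(** The state is the length of a suffix of the letters read that matches [v]. The shift starting at
    that suffix exceeds [v], so the next letter is neither too small nor the end of a full match. *)
Lemma lexgt_trace f : (forall p, lexgt n (shift p f) v) -> forall l,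
  exists r, [/\ r < n, r <= l, trace f 0 l = Some r
    & forall j, j < r -> f (l - r + j) = v j].
Proof.
move=> gt; elim=> [|l [r [rn rl tr e]]]; first by exists 0.
rewrite /= tr; have [j [jn ej lj]] := gt (l - r).
have rj : r <= j by rewrite leqNgt; apply/negP=> jr; move: lj; rewrite /shift e //; lia.
move: lj; rewrite /shift /step; move: rj; rewrite leq_eqVlt => /orP[/eqP <-|rj].
  rewrite subnK // => lj; rewrite (_ : (f l == v r) = false); last by lia.
  by rewrite lj; exists 0.
move=> _; have fl : f l = v r by rewrite -ej // /shift subnK.
rewrite fl eqxx (_ : r.+1 < n); last by lia.
exists r.+1; split=> // [|j']; first by lia.
by rewrite subSS ltnS leq_eqVlt => /orP[/eqP ->|/e //]; rewrite subnK.
Qed.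

Section Periodic.

Variables (f : nat -> nat) (d : nat).
Hypothesis per : forall p, f (p + d) = f p.

Lemma periodic_shift k : shift (k * d) f =1 f.
Proof.
elim: k => [|k IHk] p; first by rewrite /shift mul0n.
by rewrite /shift (_ : k.+1 * d + p = k * d + p + d) ?per; [exact: IHk|lia].
Qed.

Lemma trace_periodic q k l :
  trace f q (k * d + l) = if trace f q (k * d) is Some r then trace f r l else None.
Proof.
rewrite trace_add; case: trace => // r.
by apply: trace_ext => i _; rewrite periodic_shift.
Qed.

Lemma trace_loop q k : trace f q d = Some q -> trace f q (k * d) = Some q.
Proof.
move=> h; elim: k => //= k IHk.
by rewrite mulSn -{1}(mul1n d) trace_periodic mul1n h.
Qed.

Hypothesis d0 : 0 < d.

(** Repeating the loop gives surviving runs of every length; cut at position [p], such a run still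
    has [n] letters left, and [trace_lexgt] applies. *)
Lemma loop_lexgt q : q < n -> trace f q d = Some q ->
  forall p, lexgt n (shift p f) v.
Proof.
move=> qn lp p; have := trace_loop (p + n) lp.
rewrite (_ : (p + n) * d = p + (n + ((p + n) * d - p - n))); last by nia.
move=> /trace_prefix[r /(trace_lt n0 qn) rn].
move=> /trace_prefix[r' tr _]; exact: trace_lexgt tr.
Qed.

(** The fixed state is the one reached from 0 after [n] periods: one more period read before them
    does not change it, by synchronisation, and one more period read after them gives the same total
    word. *)
Lemma lexgt_loop : (forall p, lexgt n (shift p f) v) ->
  exists2 q, q < n & trace f q d = Some q.
Proof.
move=> gt; have [q [qn _ tq _]] := lexgt_trace gt (n * d).
exists q => //.
have [q1 [q1n _ t1 _]] := lexgt_trace gt d.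
have [r [rn _ tr _]] := lexgt_trace gt (n.+1 * d).
have e1 : trace f q1 (n * d) = Some r.
  by move: tr; rewrite mulSn -{1}(mul1n d) trace_periodic mul1n t1.
have e2 : trace f q d = Some r.
  by move: tr; rewrite -addn1 mulnDl mul1n trace_periodic tq.
have nd : n <= n * d by nia.
by move: (trace_sync0 q1n nd e1) e2; rewrite tq => -[->].
Qed.

(** Both loops, repeated [n] times, end where the run from 0 ends. *)
Lemma loop_uniq q q' : q < n -> q' < n ->
  trace f q d = Some q -> trace f q' d = Some q' -> q = q'.
Proof.
move=> qn qn' /(trace_loop n) h /(trace_loop n) h'.
have nd : n <= n * d by nia.
have := trace_sync0 qn nd h; have := trace_sync0 qn' nd h'.
by move=> -> [->].
Qed.

End Periodic.

End Automaton.

Definition letter (sigma : nat) (y : seq 'I_sigma) (i : nat) : nat :=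
  nth 0 (map val y) i.

Definition cyc (sigma : nat) (y : seq 'I_sigma) (i : nat) : nat :=
  letter y (i %% size y).

Lemma big_tupleS (sigma m : nat) (g : m.+1.-tuple 'I_sigma -> nat) :
  \sum_y g y = \sum_(a < sigma) \sum_(y : m.-tuple 'I_sigma) g [tuple of a :: y].
Proof.
rewrite pair_big /=.
rewrite (reindex (fun p : 'I_sigma * m.-tuple 'I_sigma => [tuple of p.1 :: p.2])) //=.
exists (fun y => (thead y, [tuple of behead y])) => [[a y] _|y _] /=.
  by congr pair; apply: val_inj.
by rewrite -tuple_eta.
Qed.

(** * Counting closed runs of the automaton *)

Section Paths.

Variables (n : nat) (v c : nat -> nat).
Hypothesis n0 : 0 < n.
Hypothesis c_out : forall i, n <= i -> c i = 0.

(** Entries of the powers of the transfer matrix; [c q] is the number of letters that reset state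
    [q]. *)
Fixpoint paths (q r m : nat) : nat :=
  if m is m'.+1 then
    (if q.+1 < n then paths q.+1 r m' else 0) + c q * paths 0 r m'
  else (q == r).

Lemma sum_gt (s u : nat) : \sum_(a < s) (u < a) = s.-1 - u.
Proof.
elim: s => [|s IHs]; first by rewrite big_ord0.
by rewrite big_ord_recr /= IHs; case: s IHs; lia.
Qed.

Lemma sum_ord_eq (s u : nat) : u < s -> \sum_(a < s) (val a == u) = 1.
Proof.
move=> us; rewrite (bigD1 (Ordinal us)) //= eqxx big1 ?addn0 // => a ne.
by apply/eqP; rewrite eqb0; apply: contraNneq ne => e; apply/eqP/val_inj.
Qed.

Lemma card_trace sigma q r m :
  (forall i, i < n -> v i < sigma) ->
  (forall i, i < n -> c i = sigma.-1 - v i) -> q < n ->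
  \sum_(y : m.-tuple 'I_sigma) (trace n v (letter y) q m == Some r) = paths q r m.
Proof.
move=> vs cE; elim: m q => [|m IHm] q qn.
  rewrite (eq_bigr (fun=> nat_of_bool (q == r))); last by [].
  by rewrite sum_nat_const card_tuple expn0 mul1n.
rewrite big_tupleS.
rewrite (eq_bigr (fun a : 'I_sigma => (val a == v q) *
   (if q.+1 < n then paths q.+1 r m else 0) + (v q < val a) * paths 0 r m)).
  rewrite big_split /= -!big_distrl /= sum_ord_eq ?vs // sum_gt mul1n.
  by rewrite -cE.
move=> a _.
transitivity (\sum_(y : m.-tuple 'I_sigma)
   (if step n v q a is Some q' then (trace n v (letter y) q' m == Some r : nat) else 0)).
  apply: eq_bigr => y _.
  have := trace_add n v (letter [tuple of a :: y]) q 1 m.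
  by rewrite add1n /= => ->; case: (step n v q a).
rewrite /step; case: eqP => [e|_]; last first.
  case: ltnP => _ /=; last by rewrite big1.
  by rewrite IHm // mul1n.
rewrite /= e ltnn mul1n mul0n addn0; case: ltnP => qn'; last by rewrite big1.
by rewrite IHm.
Qed.

(** Splits by the first reset, after [i] advances; the last summand is the run without reset. The
    sum needs no bound [q + i < n], because [c] vanishes from [n] on. *)
Lemma paths_unroll q r m : q < n ->
  paths q r m =
  \sum_(i < m) c (q + i) * paths 0 r (m.-1 - i) + ((r == q + m) && (q + m < n)).
Proof.
elim: m q => [|m IHm] q qn.
  by rewrite big_ord0 addn0 qn andbT eq_sym.
rewrite big_ord_recl /= addn0 subn0.
case: (ltnP q.+1 n) => qn'.
  rewrite IHm // addSnnS.
  rewrite [in RHS](eq_bigr (fun i : 'I_m => c (q.+1 + i) * paths 0 r (m.-1 - i))); first by rewrite addnC addnA.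
  move=> i _; rewrite /bump /= add1n addSnnS; congr (_ * paths _ _ _); lia.
rewrite big1 => [|i _]; last by rewrite c_out //= /bump; lia.
by rewrite (_ : (q + m.+1 < n) = false) ?andbF ?addn0 //; lia.
Qed.

(** The coefficients of [1 / (1 - C(z))]: a run from 0 to 0 is a sequence of blocks, each ended by a
    reset. *)
Definition blocks (m : nat) : nat := paths 0 0 m.

Lemma sum_ord_if (m k : nat) (g : nat -> nat) : k <= m ->
  \sum_(i < k) g i = \sum_(i < m) if i < k then g i else 0.
Proof. by move=> km; rewrite (big_ord_widen m g km) big_mkcond. Qed.

(** A run from 0 to [r] ends with exactly [r] advances. *)
Lemma paths0 r m : r < n -> paths 0 r m = if r <= m then blocks (m - r) else 0.
Proof.
move=> rn; elim/ltn_ind: m => m IHm.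
rewrite /blocks !paths_unroll // !add0n.
rewrite (sum_ord_if (fun i => c i * blocks ((m - r).-1 - i)) (leq_subr r m)).
transitivity (\sum_(i < m) (if i < m - r then c i * blocks ((m - r).-1 - i) else 0)
   + ((r == m) && (m < n))).
  congr addn; apply: eq_bigr => i _; rewrite IHm; last by case: i => /=; lia.
  case: (ltnP i (m - r)) => h.
    by rewrite (_ : _ <= _ = true); [congr (_ * blocks _); lia|lia].
  by rewrite (_ : _ <= _ = false) ?muln0 //; case: i h => /=; lia.
case: (leqP r m) => rm; last first.
  rewrite (_ : (r == m) = false) ?addn0; last by lia.
  by rewrite big1 // => i _; case: ifP => //; lia.
by congr addn; lia.
Qed.

Lemma blocksE m : 0 < m -> blocks m = \sum_(i < m) c i * blocks (m.-1 - i).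
Proof.
by move=> m0; rewrite /blocks paths_unroll // !add0n (_ : (0 == m) = false) ?addn0 //; lia.
Qed.

(** The coefficient of [z^d] in [z C'(z) / (1 - C(z))]; the factor [t.+1] comes from the
    derivative. *)
Definition cyclic (d : nat) : nat :=
  \sum_(t < d) t.+1 * c t * blocks (d.-1 - t).

(** The trace of the [d]-th power of the transfer matrix. A closed run from [q] is first reset in
    some state [t >= q], and what follows returns from 0 to [q]; the count depends on [t] alone, and
    [q] has [t + 1] choices. *)
Lemma sum_paths d : 0 < d -> d <= n -> \sum_(q < n) paths q q d = cyclic d.
Proof.
move=> d0 dn.
transitivity (\sum_(q < n) \sum_(t < d) (if q <= t then c t * blocks (d.-1 - t) else 0)).
  apply: eq_bigr => -[q qn] _ /=.
  rewrite paths_unroll // (_ : (q == q + d) = false) ?addn0; last by lia.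
  transitivity (\sum_(i < d) (if i < d - q then c (q + i) * blocks (d.-1 - (q + i)) else 0)).
    apply: eq_bigr => -[i id] _ /=; rewrite paths0 //.
    case: (ltnP i (d - q)) => h.
      by rewrite (_ : _ <= _ = true); [congr (_ * blocks _); lia|lia].
    by rewrite (_ : _ <= _ = false) ?muln0 //; lia.
  rewrite -(sum_ord_if (fun i => c (q + i) * blocks (d.-1 - (q + i))) (leq_subr q d)).
  case: (leqP q d) => qd; last first.
    rewrite (_ : d - q = 0) ?big_ord0; last by lia.
    by rewrite big1 // => -[t td] _ /=; case: ifP => //; lia.
  rewrite -(big_mkord xpredT (fun t => if q <= t then c t * blocks (d.-1 - t) else 0)).
  rewrite (big_cat_nat (leq0n q) qd) /= big_nat_cond [X in _ = X + _]big1 ?add0n; last first.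
    by move=> i /andP[/andP[_ iq] _]; rewrite leqNgt iq.
  rewrite -[X in _ = \sum_(X <= _ < _) _](add0n q) big_addn big_mkord; apply: eq_bigr => i _.
  by rewrite leq_addl addnC.
rewrite exchange_big; apply: eq_bigr => -[t td] _ /=.
transitivity (\sum_(q < n) if q < t.+1 then c t * blocks (d.-1 - t) else 0).
  by apply: eq_bigr => q _; rewrite ltnS.
rewrite -(sum_ord_if (fun=> c t * blocks (d.-1 - t)) (_ : t.+1 <= n)); last by lia.
by rewrite sum_nat_const card_ord mulnA.
Qed.

End Paths.

Section Loops.

Variables (sigma n : nat) (v c : nat -> nat).
Hypotheses (n0 : 0 < n) (pn : prenecklace v n).
Hypothesis v_lt : forall i, i < n -> v i < sigma.
Hypothesis cE : forall i, i < n -> c i = sigma.-1 - v i.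
Hypothesis c_out : forall i, n <= i -> c i = 0.

Definition above (f : nat -> nat) : Prop := forall p, lexgt n (shift p f) v.

Lemma cyc_periodic (y : seq 'I_sigma) p : cyc y (p + size y) = cyc y p.
Proof. by rewrite /cyc modnDr. Qed.

(** The indicator of [above] is the number of states fixed by [y], which is one or zero by
    [lexgt_loop], [loop_uniq] and [loop_lexgt]; summing over all words gives the trace. The
    comparison with [v] runs over [n] letters although the word repeats after [d]. *)
Lemma card_above d : 0 < d -> d <= n ->
  #|[set y : d.-tuple 'I_sigma | `[< above (cyc y) >]]| = cyclic n c d.
Proof.
move=> d0 dn; rewrite -(sum_paths n0 c_out d0 dn).
rewrite (eq_bigr (fun q : 'I_n =>
  \sum_(y : d.-tuple 'I_sigma) (trace n v (letter y) q d == Some (val q)))); last first.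
  by move=> q _; rewrite (card_trace (c := c) n0).
rewrite exchange_big /= -sum1_card big_mkcond /=; apply: eq_bigr => y _.
have tE q : trace n v (letter y) q d = trace n v (cyc y) q d.
  by apply: trace_ext => i id; rewrite /cyc modn_small // size_tuple.
have per p : cyc y (p + d) = cyc y p by rewrite -[in p + d](size_tuple y) cyc_periodic.
rewrite inE; case: asboolP => [ab|nab].
  have [q qn tq] := lexgt_loop n0 pn per d0 ab.
  rewrite (bigD1 (Ordinal qn)) //= tE tq eqxx big1 // => -[q' qn'] /eqP ne.
  apply/eqP; rewrite eqb0; apply/eqP; rewrite tE /= => tq'; apply: ne; apply: val_inj => /=.
  exact: (loop_uniq n0 pn per d0 _ _ tq' tq).
rewrite big1 // => -[q qn] _; apply/eqP; rewrite eqb0 tE /=; apply/eqP => tq.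
by apply: nab => p; exact: (loop_lexgt n0 pn per d0 _ tq).
Qed.

End Loops.

(** * Cyclic words, rotations and periods *)

Section Words.

Variable sigma : nat.
Implicit Types x y u : seq 'I_sigma.

Lemma letter_inj x y : size x = size y ->
  (forall i, i < size x -> letter x i = letter y i) -> x = y.
Proof.
move=> es e; apply: (inj_map val_inj); apply: (@eq_from_nth _ 0).
  by rewrite !size_map.
by move=> i; rewrite size_map => /e.
Qed.

Lemma letter_lt x i : i < size x -> letter x i < sigma.
Proof.
case: x => // a x h; rewrite /letter (nth_map a) //; exact: ltn_ord.
Qed.

Lemma lexle_lexgt x y : size x = size y ->
  lexle x y <-> ~ lexgt (size x) (letter x) (letter y).
Proof.
elim: x y => [|a x IHx] [|b y] //= es.
  by split=> // _ [j []].
case: es => es; rewrite /lexle Order.SeqLexiOrder.Exports.lexi_cons.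
have E : (a <= b)%O = (val a <= val b) by [].
have E' : (b <= a)%O = (val b <= val a) by [].
rewrite E E'; split.
  move=> /andP[ab /implyP bax] [[|j] [jn ej]]; rewrite /letter /= => lj.
    by move: lj; rewrite ltnNge ab.
  have e0 := ej 0 isT; rewrite /letter /= in e0.
  have : lexle x y by apply: bax; rewrite /= e0.
  by move=> /(IHx _ es); apply; exists j; split=> // l lj'; have := ej l.+1 lj'.
move=> ngt; apply/andP; split.
  by rewrite leqNgt; apply/negP => ba; apply: ngt; exists 0; split.
apply/implyP => ba; apply/(IHx _ es) => -[j [jn ej lj]].
have [ab|ab|ab] := ltngtP (val a) (val b).
- by move: ba; rewrite leqNgt ab.
- by apply: ngt; exists 0; split.
- by apply: ngt; exists j.+1; split=> // -[|l] // /ej.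
Qed.

Lemma letter_cyc x i : i < size x -> cyc x i = letter x i.
Proof. by move=> h; rewrite /cyc modn_small. Qed.

Lemma lexle_cyc x y : size x = size y ->
  lexle x y <-> ~ lexgt (size x) (cyc x) (cyc y).
Proof.
move=> es; rewrite lexle_lexgt //; split=> h g; apply: h.
  by apply: lexgt_ext g => i h; rewrite letter_cyc -?es.
by apply: lexgt_ext g => i h; rewrite letter_cyc -?es.
Qed.

Lemma cyc_rot x i p : 0 < size x -> i <= size x -> cyc (rot i x) p = cyc x (i + p).
Proof.
have [N EN] : exists N, size x = N by exists (size x).
rewrite /cyc size_rot /letter -modnDmr !EN => N0 iN.
move: (p %% N) (ltn_pmod p N0) => {}p pN.
rewrite map_rot /rot nth_cat size_drop size_map EN.
case: ltnP => h.
  by rewrite nth_drop modn_small //; lia.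
rewrite nth_take; last by lia.
congr nth; have -> : i + p = (p - (N - i)) + N by lia.
by rewrite modnDr modn_small //; lia.
Qed.

Lemma word_powerSr u k : word_power u k.+1 = word_power u k ++ u.
Proof.
rewrite /word_power; elim: k => [|k IHk] /=; first by rewrite cats0.
by rewrite -catA -IHk.
Qed.

Lemma size_word_power u k : size (word_power u k) = k * size u.
Proof.
by rewrite /word_power size_flatten /shape map_nseq sumn_nseq mulnC.
Qed.

Lemma letter_word_power u k i : i < k * size u ->
  letter (word_power u k) i = cyc u i.
Proof.
rewrite /cyc /letter; elim: k i => [|k IHk] i ik; first by lia.
rewrite /word_power /= map_cat nth_cat size_map.
case: ltnP => h; first by rewrite modn_small.
rewrite IHk; last by lia.
by rewrite -{2}(subnK h) modnDr.
Qed.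

End Words.

Section Rotations.

Variables (sigma n : nat).
Hypothesis n0 : 0 < n.
Implicit Types x y : n.-tuple 'I_sigma.

Lemma cyc_inj x y : cyc x =1 cyc y -> x = y.
Proof.
move=> e; apply: val_inj; apply: letter_inj; first by rewrite !size_tuple.
by move=> i h; rewrite -!letter_cyc // size_tuple // -(size_tuple x).
Qed.

Lemma rot_fixE x e : e <= n -> (rot e x == x) <-> forall p, cyc x (p + e) = cyc x p.
Proof.
move=> en; split=> [/eqP h p|h].
  by rewrite -{2}h cyc_rot ?size_tuple // addnC.
suff : [tuple of rot e x] = x by move=> /(congr1 val) /= ->.
by apply: cyc_inj => p /=; rewrite cyc_rot ?size_tuple // addnC.
Qed.

Lemma rot_full x : rot n x == x.
Proof. by have := rot_size (x : seq _); rewrite size_tuple => ->. Qed.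

Lemma period_exists x : exists e, (0 < e) && (rot e x == x).
Proof. by exists n; rewrite n0 rot_full. Qed.

Definition period x := ex_minn (period_exists x).

Lemma period_gt0 x : 0 < period x.
Proof. by rewrite /period; case: ex_minnP => e /andP[]. Qed.

Lemma rot_period x : rot (period x) x == x.
Proof. by rewrite /period; case: ex_minnP => e /andP[]. Qed.

Lemma period_min x e : 0 < e -> rot e x == x -> period x <= e.
Proof. by rewrite /period; case: ex_minnP => m _ h e0 r; apply: h; rewrite e0. Qed.

Lemma period_le x : period x <= n.
Proof. exact: period_min (rot_full x). Qed.

Lemma cyc_period x k p : cyc x (p + k * period x) = cyc x p.
Proof.
elim: k => [|k IHk]; first by rewrite mul0n addn0.
rewrite mulSn addnA addnAC.
by have [/(_ (rot_period x)) ->] := rot_fixE x (period_le x).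
Qed.

(** The remainder of [e] modulo the period would again be a period, so it is 0 by minimality. *)
Lemma rot_dvd x e : e <= n -> (rot e x == x) = (period x %| e).
Proof.
move=> en; apply/idP/idP => [r|/dvdnP[k ek]]; last first.
  by apply/rot_fixE => // p; rewrite ek cyc_period.
apply/negPn/negP; rewrite /dvdn -lt0n => h.
have lt : e %% period x < period x by rewrite ltn_mod period_gt0.
have le := period_le x.
suff /(period_min h) : rot (e %% period x) x == x by lia.
apply/rot_fixE => [|p]; first by lia.
rewrite -[LHS](cyc_period x (e %/ period x)) -addnA [_ %% _ + _]addnC -divn_eq.
by have [/(_ r) ->] := rot_fixE x en.
Qed.

Lemma period_dvd x : period x %| n.
Proof. by rewrite -rot_dvd // rot_full. Qed.

(** A period that is a proper divisor of [n] exhibits the word as a power of its prefix; conversely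
    [u^k] is fixed by the rotation by [size u]. *)
Lemma primitiveE x : primitive x <-> period x = n.
Proof.
split=> [pr|pe u k k2 e].
  have /dvdnP[k nk] := period_dvd x.
  have su : size (take (period x) x) = period x.
    by rewrite size_takel // size_tuple period_le.
  have p0 := period_gt0 x.
  case: (leqP 2 k) => k2; last first.
    by case: k nk k2 => [|[|//]] nk _; [move: n0; rewrite nk|move: nk; rewrite mul1n].
  case: (pr (take (period x) x) k k2); apply: letter_inj.
    by rewrite size_word_power su size_tuple.
  move=> i; rewrite size_tuple => ni.
  rewrite letter_word_power ?su -?nk // /cyc su /letter map_take nth_take ?ltn_mod //.
  rewrite -[RHS]/(letter x _) -letter_cyc; last first.
    by rewrite size_tuple; have := period_le x; have := ltn_pmod i p0; lia.
  rewrite -(cyc_period x (i %/ period x)) addnC -divn_eq letter_cyc //.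
  by rewrite size_tuple.
have sz : k * size u = n by rewrite -size_word_power -e size_tuple.
have : rot (size u) x == x.
  rewrite e; case: k k2 {e sz} => // k _.
  by rewrite {1}/word_power /= rot_size_cat -/(word_power u k) word_powerSr.
by move=> /(period_min _); rewrite pe; nia.
Qed.

End Rotations.

(** * The sieve over periods *)

Section Counting.

Variables (sigma n : nat) (v c : nat -> nat).
Hypotheses (n0 : 0 < n) (pn : prenecklace v n).
Hypothesis v_lt : forall i, i < n -> v i < sigma.
Hypothesis cE : forall i, i < n -> c i = sigma.-1 - v i.
Hypothesis c_out : forall i, n <= i -> c i = 0.

(** All words have length [n], whatever their period, so that the sets for different [e] partition
    one ambient set. *)
Definition low_words (e : nat) : {set n.-tuple 'I_sigma} :=
  [set x | (period n0 x == e) && `[< ~ above n v (cyc x) >]].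

Lemma above_ext f g : f =1 g -> above n v f -> above n v g.
Proof.
by move=> e ab p; apply: lexgt_ext (ab p) => // i _; rewrite /shift e.
Qed.

Section Extension.

Variable d : nat.
Hypotheses (d0 : 0 < d) (dn : d %| n).

Definition extension (y : d.-tuple 'I_sigma) : n.-tuple 'I_sigma :=
  [tuple tnth y (Ordinal (ltn_pmod i d0)) | i < n].

Lemma cyc_extension y : cyc (extension y) =1 cyc y.
Proof.
move=> p; rewrite /cyc !size_tuple /letter.
have pn' : p %% n < n by rewrite ltn_mod.
have a0 := tnth y (Ordinal (ltn_pmod 0 d0)).
rewrite (nth_map a0) ?size_tuple // (nth_map a0) ?size_tuple ?ltn_mod //.
rewrite -(tnth_nth a0 _ (Ordinal pn')) tnth_mktuple (tnth_nth a0) /=.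
by rewrite modn_dvdm.
Qed.

Lemma extension_inj : injective extension.
Proof.
move=> y y' e; apply: (@cyc_inj _ d) => p.
by rewrite -cyc_extension e cyc_extension.
Qed.

(** A word fixed by the rotation by [d] is the periodic extension of its prefix of length [d], and
    both have the same cyclic reading; the count is the complement of [card_above]. *)
Lemma card_rot_fix :
  #|[set x : n.-tuple 'I_sigma | (rot d x == x) && `[< ~ above n v (cyc x) >]]|
  = sigma ^ d - cyclic n c d.
Proof.
have dn' : d <= n by apply: dvdn_leq.
rewrite -(card_above n0 pn v_lt cE c_out d0 dn').
have -> : sigma ^ d = #|{: d.-tuple 'I_sigma}| by rewrite card_tuple card_ord.
set S := [set y : d.-tuple _ | _].
have := cardsCs (~: S); rewrite setCK => <-; rewrite /S.
rewrite -[RHS](card_imset _ extension_inj); apply: eq_card => x.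
rewrite inE; apply/andP/imsetP => [[r /asboolP nab]|[y]].
  have sx : size (take d x) == d by rewrite size_takel ?size_tuple.
  have ex : x = extension (Tuple sx).
    apply: cyc_inj => p; rewrite cyc_extension /cyc /= (eqP sx) /letter.
    rewrite map_take nth_take ?ltn_mod // -[RHS]/(letter x _) -[LHS]/(cyc x p).
    rewrite -letter_cyc ?size_tuple; last by have := ltn_pmod p d0; lia.
    have /dvdnP[k dk] : period n0 x %| d by rewrite -rot_dvd.
    rewrite {1}(divn_eq p d) addnC.
    by rewrite [X in _ %% _ + _ * X]dk mulnA cyc_period.
  exists (Tuple sx) => //; rewrite !inE; apply/asboolP => ab; apply: nab.
  by rewrite ex; apply: above_ext ab => p; rewrite cyc_extension.
rewrite !inE => /asboolP nab ->; split.
  apply/(rot_fixE n0) => // p.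
  by rewrite !cyc_extension /cyc size_tuple modnDr.
by apply/asboolP => ab; apply: nab; apply: above_ext ab => p; rewrite cyc_extension.
Qed.

Lemma cyclic_le : cyclic n c d <= sigma ^ d.
Proof.
have dn' : d <= n by apply: dvdn_leq.
rewrite -(card_above n0 pn v_lt cE c_out d0 dn').
have -> : sigma ^ d = #|{: d.-tuple 'I_sigma}| by rewrite card_tuple card_ord.
exact: max_card.
Qed.

(** The rotation by [d] fixes exactly the words whose period divides [d]; grouping them by period
    gives the identity. *)
Lemma sum_low_words :
  \sum_(e < d.+1 | e %| d) #|low_words e| + cyclic n c d = sigma ^ d.
Proof.
rewrite -(subnK cyclic_le); congr addn.
have dn' : d <= n by apply: dvdn_leq.
rewrite -card_rot_fix -sum1_card.
rewrite (partition_big (fun x => inord (period n0 x) : 'I_d.+1) (fun e : 'I_d.+1 => e %| d)) /=; last first.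
  move=> x; rewrite inE rot_dvd // => /andP[pd _].
  by rewrite inordK // ltnS dvdn_leq.
apply: eq_bigr => e ed; rewrite -sum1_card; apply: eq_bigl => x.
rewrite !inE rot_dvd // andbAC; congr andb.
apply/eqP/andP => [pe|[pd /eqP <-]].
  by rewrite pe ed; split=> //; apply/eqP/val_inj; rewrite /= inordK.
by rewrite inordK // ltnS dvdn_leq.
Qed.

End Extension.

Variable w : n.-tuple 'I_sigma.
(** The only link between [w] and [v]; it is supplied by [lexgt_lowered]. *)
Hypothesis vw : forall x : n.-tuple 'I_sigma, (forall i, lexle x (rot i x)) ->
  (lexgt n (cyc x) (cyc w) <-> lexgt n (cyc x) v).

Lemma lexleE (x y : n.-tuple 'I_sigma) : lexle x y <-> ~ lexgt n (cyc x) (cyc y).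
Proof. by rewrite lexle_cyc ?size_tuple. Qed.

Definition rotation (x : n.-tuple 'I_sigma) (i : nat) : n.-tuple 'I_sigma :=
  [tuple of rot i x].

Lemma cyc_rotation x i p : i <= n -> cyc (rotation x i) p = cyc x (i + p).
Proof. by move=> h; rewrite cyc_rot ?size_tuple. Qed.

Lemma cyc_addn (x : n.-tuple 'I_sigma) p : cyc x (p + n) = cyc x p.
Proof. by have := cyc_periodic x p; rewrite size_tuple. Qed.

Lemma period_rotation x i : i <= n -> period n0 (rotation x i) = period n0 x.
Proof.
move=> lin; apply/eqP; rewrite eqn_dvd -!rot_dvd ?period_le //.
have h1 := cyc_period n0 x 1; have h2 := cyc_period n0 (rotation x i) 1.
apply/andP; split; apply/(rot_fixE n0); rewrite ?period_le // => p.
  by rewrite !cyc_rotation // addnA -[period _ _]mul1n h1.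
have e q : cyc x q = cyc (rotation x i) (q + (n - i)).
  rewrite cyc_rotation // (_ : i + (q + (n - i)) = q + n); last by lia.
  by rewrite cyc_addn.
by rewrite !e addnAC -[period _ _]mul1n h2.
Qed.

(** A necklace is its own least rotation, so all rotations exceed [v] as soon as it does itself. *)
Lemma necklace_above (x : n.-tuple 'I_sigma) : (forall i, lexle x (rot i x)) ->
  (above n v (cyc x) <-> ~ lexle x w).
Proof.
move=> nx; split=> [ab le|nle p].
  apply: ((lexleE x w).1 le); apply/(vw nx); exact: ab 0.
have gt0 : lexgt n (cyc x) v.
  by apply/(vw nx); apply: contrapT => h; apply: nle; apply/lexleE.
have pn' : p %% n <= n by apply: ltnW; rewrite ltn_mod.
have ng := (lexleE x (rotation x (p %% n))).1 (nx _).
apply: lexgt_ext (lexgt_trans gt0 ng) => // i _.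
by rewrite cyc_rotation // /shift /cyc size_tuple modnDml.
Qed.

Lemma rotation_add x i j : i <= n -> j <= n -> exists2 k, k < n &
  rotation (rotation x i) j = rotation x k.
Proof.
move=> lin ljn; exists ((i + j) %% n); first by rewrite ltn_mod.
apply: cyc_inj => p; rewrite !cyc_rotation //; last by apply: ltnW; rewrite ltn_mod.
by rewrite /cyc size_tuple modnDml addnA.
Qed.

Lemma rot_rotation (x : n.-tuple 'I_sigma) i : exists2 k, k < n & rot i x = rotation x k.
Proof.
case: (ltnP i n) => h; first by exists i.
exists 0 => //; rewrite /rotation /= rot0.
by rewrite rot_oversize // size_tuple.
Qed.

(** Rotation maps pairs of a Lyndon word up to [w] and an index below [n] bijectively onto the set:
    primitivity makes the rotations of one word distinct, and the least rotation of a word in the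
    set is such a Lyndon word. *)
Lemma card_low_words : #|low_words n| = n * Lynd w.
Proof.
pose Ly := [set x : n.-tuple 'I_sigma | `[< lyndon x >] && lexle x w].
have per1 (x : n.-tuple 'I_sigma) : lyndon x -> period n0 x = n by case=> /(primitiveE n0).
pose h (p : n.-tuple 'I_sigma * 'I_n) := rotation p.1 p.2.
rewrite -[X in X * _](card_ord n) mulnC /Lynd -/Ly -cardsT -cardsX.
rewrite -(card_in_imset (f := h)); last first.
  move=> [x i] [y j]; rewrite !inE /= !andbT => /andP[/asboolP lx _].
  move=> /andP[/asboolP ly _]; rewrite /h /= => e.
  have back z (k : 'I_n) : rotation (rotation z k) (n - k) = z.
    apply: cyc_inj => p; rewrite !cyc_rotation ?leq_subr // ?(ltnW (ltn_ord k)) //.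
    rewrite (_ : k + (n - k + p) = p + n); last by have := ltn_ord k; lia.
    by rewrite cyc_addn.
  (* Each of two Lyndon words in one rotation class is a rotation of the other, so they are below
     each other. *)
  have xy : x = y.
    have le12 (z z' : n.-tuple 'I_sigma) (k k' : 'I_n) : lyndon z -> rotation z k = rotation z' k' -> lexle z z'.
      move=> [_ lz] e'; have := back z' k'; rewrite -e'.
      have [m mn ->] := rotation_add z (ltnW (ltn_ord k)) (leq_subr k' n).
      by move=> <-; apply: lz.
    apply: val_inj; apply: (@Order.le_anti _ (seqlexi 'I_sigma)); apply/andP.
    by split; [exact: (le12 _ _ _ _ lx e)|exact: (le12 _ _ _ _ ly (esym e))].
  move: e; rewrite xy => e; congr pair; apply: val_inj => /=.
  wlog ij : i j e / i <= j.
    by move=> wl; case: (leqP i j) => [/wl|/ltnW/wl]; [exact|move=> ->].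
  have [jn lin] := (ltn_ord j, ltn_ord i).
  have : period n0 y <= j - i \/ j - i = 0.
    case: (posnP (j - i)) => [|pos]; [by right|left].
    apply: (period_min n0) => //; apply/(rot_fixE n0) => [|p]; first lia.
    have := congr1 (fun z : n.-tuple _ => cyc z (p + n - i)) e.
    rewrite /= !cyc_rotation ?(ltnW (ltn_ord _)) //.
    rewrite (_ : i + (p + n - i) = p + n); last by lia.
    rewrite (_ : j + (p + n - i) = p + (j - i) + n); last by lia.
    by rewrite !cyc_addn.
  by rewrite per1 //; lia.
apply: eq_card => x; rewrite inE; apply/andP/imsetP => [[/eqP px /asboolP nab]|[[z i] zi ->]].
  pose le (a b : 'I_n) := lexle (rotation x a) (rotation x b).
  have [k kmin] : exists k : 'I_n, forall j : 'I_n, lexle (rotation x k) (rotation x j).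
    have [k _ kmin] := @Order.TotalTheory.arg_minP _ (seqlexi 'I_sigma) _ (Ordinal n0)
      xpredT (fun i : 'I_n => tval (rotation x i)) isT.
    by exists k => j; exact: kmin.
  have kn := ltnW (ltn_ord k).
  pose z := rotation x k.
  have nz i : lexle z (rot i z).
    have [m mn ->] := rot_rotation z i.
    have [m' mn' ->] := rotation_add x kn (ltnW mn).
    exact: (kmin (Ordinal mn')).
  have lz : lyndon z by split=> //; apply/(primitiveE n0); rewrite period_rotation.
  have xz p : cyc x p = cyc z (p + (n - k)).
    rewrite cyc_rotation // (_ : k + (p + (n - k)) = p + n); last by lia.
    by rewrite cyc_addn.
  (* Otherwise all rotations of [z], which are those of [x], would exceed [v]. *)
  have zw : lexle z w.
    apply: contrapT => /(necklace_above nz) ab; apply: nab => p.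
    apply: lexgt_ext (ab (p + (n - k))) => // i _.
    by rewrite /shift xz; congr cyc; lia.
  have xz' : x = rotation z ((n - k) %% n).
    apply: cyc_inj => p; rewrite cyc_rotation; last by apply: ltnW; rewrite ltn_mod.
    by rewrite xz addnC /cyc size_tuple modnDml.
  have mk : (n - k) %% n < n by rewrite ltn_mod.
  exists (z, Ordinal mk) => //; rewrite !inE /= zw !andbT.
  exact/asboolP.
move: zi; rewrite !inE /= andbT => /andP[/asboolP lz zw]; rewrite /h /=.
have lin := ltnW (ltn_ord i).
rewrite period_rotation // per1 // eqxx; split=> //; apply/asboolP => ab.
have : above n v (cyc z).
  move=> p; apply: lexgt_ext (ab (p + (n - i))) => // j _.
  rewrite /shift cyc_rotation // (_ : i + (p + (n - i) + j) = p + j + n); last by lia.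
  by rewrite cyc_addn.
by move=> /(necklace_above lz.2).
Qed.

End Counting.

(** * Duval's algorithm and the largest prenecklace up to [w] *)

Section Duval.

Variable w : nat -> nat.

Definition longest_border (q t : nat) : Prop :=
  [/\ q < t, border w q t & forall b, b < t -> border w b t -> b <= q].

(* k is one plus the last position where decreasing the letter of w leaves a
   prenecklace; after it, every letter is forced by a border up to position t *)
Definition last_drop (k t : nat) : Prop :=
  [/\ k <= t, 0 < w k.-1, prenecklace w k.-1,
      forall b, b < k.-1 -> border w b k.-1 -> w b < w k.-1
    & forall i, k <= i -> i < t -> exists2 b, b < i & border w b i /\ w i = w b].

(** [fl] is 0 as long as the letters read form a prenecklace. After a failure at [t0] the state is
    frozen, since only the drop position found before [t0] matters. [k = 0] means that nothing can
    be decreased: all letters so far are 0. *)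
Definition duval_inv (t q k fl : nat) : Prop :=
  if fl == 0 then
    [/\ prenecklace w t, longest_border q t, (k = 0 -> forall i, i < t -> w i = 0)
      & (0 < k -> last_drop k t)]
  else 0 < k /\ exists t0, [/\ t0 < t, last_drop k t0
      & exists2 b, b < t0 & border w b t0 /\ w t0 < w b].

(** Only the longest border is examined: in a prenecklace every shorter border [b] has [w b <= w q].
    A letter larger than [w q] is therefore larger than after every border, so it may be decreased,
    and no nonempty border survives it. *)
Definition duval_step (t : nat) (s : nat * nat * nat) : nat * nat * nat :=
  let: (q, k, fl) := s in
  if fl == 0 then
    if w q < w t then (0, t.+1, fl)
    else if w t < w q then (q, k, 1) else (q.+1, k, fl)
  else s.

Lemma borderW b q t : b <= q -> border w q t -> border w b t -> border w b q.
Proof.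
move=> bq [qt eq] [bt eb]; split=> // j jb.
by rewrite eb // [RHS]eq; [congr w; lia|lia].
Qed.

Lemma border_pred b t : border w b.+1 t.+1 -> border w b t /\ w b = w t.
Proof.
move=> [bt e]; split; last by rewrite e //; congr w; lia.
by split=> // j jb; rewrite e; [congr w; lia|lia].
Qed.

Lemma duval_init : duval_inv 1 0 (0 < w 0) 0.
Proof.
have pre m : m <= 1 -> prenecklace w m by move=> m1 b t; lia.
rewrite /duval_inv eqxx; split; first exact: pre.
- by split=> // b; lia.
- by case h: (0 < w 0) => // _ [|i] // _; lia.
- case h: (0 < w 0) => // _; split=> //; try exact: pre; lia.
Qed.

Lemma duval_next t q k fl : 0 < t -> duval_inv t q k fl ->
  let: (q', k', fl') := duval_step t (q, k, fl) in duval_inv t.+1 q' k' fl'.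
Proof.
move=> t0; rewrite /duval_step /duval_inv; case: (fl =P 0) => fl0; last first.
  move=> [k0 [u [ut h1 h2]]]; rewrite (introF eqP fl0).
  by split=> //; exists u; split=> //; lia.
move=> [pre [qt bq mx] kz kd].
have wle b : b < t -> border w b t -> w b <= w q.
  move=> bt bb; have bleq := mx _ bt bb.
  case: (b =P q) => [->//|ne]; apply: pre => //; last by apply: borderW bleq bq bb.
  by lia.
have preS : w q <= w t -> prenecklace w t.+1.
  move=> qlt b u bu; rewrite ltnS leq_eqVlt => /orP[/eqP eu|ut] bb; last exact: pre.
  by subst u; apply: leq_trans qlt; exact: wle.
case: ltnP => [lt|ge].
  rewrite fl0 eqxx; split=> //; first by apply: preS; lia.
  - split=> // -[|b] // bt /border_pred[bb eb].
    by have := wle b bt bb; lia.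
  - move=> _; split=> //=; [lia|move=> b bt bb|lia].
    by have := wle b bt bb; lia.
case: ltnP => [lt|le].
  rewrite /=; have k0 : 0 < k.
    by rewrite lt0n; apply/eqP => /kz z; move: lt; rewrite (z q).
  split=> //; exists t; split=> //; first exact: kd.
  by exists q.
have ewq : w q = w t by lia.
rewrite fl0 eqxx; split=> //; first exact: preS.
- split=> //; first exact: borderS.
  by move=> -[|b] // bt /border_pred[bb eb]; rewrite ltnS; exact: mx.
- move=> k0 i; rewrite ltnS leq_eqVlt => /orP[/eqP ->|]; last exact: kz.
  by rewrite -ewq kz.
move=> /kd[kt wk pk bk ik]; split=> //; first lia.
move=> i ki; rewrite ltnS leq_eqVlt => /orP[/eqP ->|]; last exact: ik.
by exists q.
Qed.

Variables (sigma n : nat).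
Hypothesis n0 : 0 < n.
Hypothesis w_lt : forall i, i < n -> w i < sigma.

Definition lowered (k fl i : nat) : nat :=
  if fl == 0 then w i
  else if i < k.-1 then w i else if i == k.-1 then (w i).-1 else sigma.-1.

Variables (q k fl : nat).
Hypothesis inv : duval_inv n q k fl.

Lemma lowered_lt i : i < n -> lowered k fl i < sigma.
Proof.
move=> lin; have h := w_lt lin; rewrite /lowered.
by do !case: ifP => _ //; lia.
Qed.

(** After the drop position all letters are maximal and cannot be too small; at it, [last_drop]
    provides strict inequalities, which leave room for the decrease by one. *)
Lemma lowered_prenecklace : prenecklace (lowered k fl) n.
Proof.
move: inv; rewrite /duval_inv /lowered; case: eqP => _; first by case.
move=> [k0 [u [un [ku wk pk bk ik] _]]] b t bt tn bb.
have wb i : i < k.-1 -> w i < sigma by move=> h; apply: w_lt; lia.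
have bw : t <= k.-1 -> border w b t.
  move=> tk; split=> [|j jb]; first by lia.
  have := bb.2 j jb.
  have -> : j < k.-1 by lia.
  by have -> : t - b + j < k.-1 by lia.
case: (ltngtP t k.-1) => tk.
- by rewrite (_ : b < k.-1); [apply: pk => //; apply: bw; lia|lia].
- case: ifP => bk'; first by have := wb _ bk'; lia.
  case: ifP => // /eqP e; have : w b < sigma by apply: w_lt; lia.
  by lia.
- rewrite tk -{1}tk bt.
  by have := bk b; rewrite -tk => /(_ bt (bw _)); rewrite tk => /(_ (leqnn _)); lia.
Qed.

(** The converse is the point. If [f] exceeds the lowered word, the first difference is at or before
    the drop position, as later letters are maximal. While [f] agrees with [w] beyond it, borders of
    [w] are borders of [f] and force its letters to be at least those of [w], and strictly larger at
    [u], where [w] stops being a prenecklace. *)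
Lemma lexgt_lowered f : (forall i, i < n -> f i < sigma) -> prenecklace f n ->
  lexgt n f w <-> lexgt n f (lowered k fl).
Proof.
move=> f_lt pf; move: inv; rewrite /duval_inv /lowered; case: eqP => [_ _|_].
  by split; apply: lexgt_ext.
move=> [k0 [u [un [ku wk pk bk ik] [b bu [bb lb]]]]]; split.
  move=> [j [jn ej lj]].
  case: (leqP k j) => kj; last first.
    exists j; split=> // [l lj'|]; first by rewrite ej // (_ : l < k.-1); [|lia].
    by case: (ltngtP j k.-1) => h; lia.
  exists k.-1; split=> [|l lk|]; first by lia.
    by rewrite ej ?lk; lia.
  by rewrite ltnn eqxx ej; lia.
move=> [j [jn ej lj]].
have gtw i : i < n -> (forall l, l < i -> f l = w l) -> w i < f i -> lexgt n f w.
  by move=> lin e h; exists i.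
case: (ltngtP j k.-1) lj => jk lj.
- apply: (gtw j) => // l lj'; rewrite ej // (_ : l < k.-1) //; lia.
- by have := f_lt j jn; lia.
have e1 l : l < k.-1 -> f l = w l by move=> lk; rewrite ej ?jk // lk.
have key i : k.-1 <= i -> i <= u -> lexgt n f w \/ forall l, l < i -> f l = w l.
  elim: i => [|i IHi] ki iu; first by right.
  case: (leqP k.-1 i) => ki'; last first.
    by right=> l li; apply: e1; lia.
  have [|e] := IHi ki' (ltnW iu); [by left|].
  have lin : i < n by lia.
  have wf : w i <= f i.
    case: (k.-1 =P i) => [ek|ne]; first by rewrite -ek -jk; lia.
    have [b' b'i [bb' ewb]] : exists2 b, b < i & border w b i /\ w i = w b by apply: ik; lia.
    rewrite ewb -e //; apply: pf => //; split=> [|m mb]; first by lia.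
    by rewrite !e; [exact: bb'.2|lia|lia].
  case: (ltnP (w i) (f i)) => [/(gtw i lin e)|fw]; [by left|right=> l].
  by rewrite ltnS leq_eqVlt => /orP[/eqP ->|/e //]; lia.
have [||//|e] := key u; [by lia|by []|].
apply: (gtw u) => //; apply: leq_trans lb _; rewrite -e //.
apply: pf => //; split=> [|m mb]; first by lia.
by rewrite !e; [exact: bb.2|lia|lia].
Qed.

End Duval.

(** A violation at a border [b] of [t] would make the rotation by [t - b] smaller. *)
Lemma necklace_prenecklace sigma n (x : n.-tuple 'I_sigma) :
  (forall i, lexle x (rot i x)) -> prenecklace (cyc x) n.
Proof.
move=> nx b t bt tn bb; rewrite leqNgt; apply/negP => lt.
have tb : t - b <= n by lia.
apply: ((lexleE x (rotation x (t - b))).1 (nx _)).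
exists b; split=> [|l lb|]; first by lia.
  by rewrite cyc_rotation //; [exact: bb.2|lia].
by rewrite cyc_rotation //; [rewrite subnK // ltnW|lia].
Qed.

Import GRing.Theory Num.Theory.

(** * Products and Graeffe's iteration *)

Section Karatsuba.

Variable s : nat.

(** The recursion is unrolled in one array: at level [l] it holds [3^l] blocks of length
    [2^(s - l)]. The two halves of a block stay in place and their sum is appended behind all
    halves. *)
Fixpoint kara_eval (g : nat -> nat) (l : nat) : nat -> nat :=
  if l is l'.+1 then
    let B := 3 ^ l' in let h := 2 ^ (s - l) in let f := kara_eval g l' in
    fun k => if k < 2 * B * h then f k
      else let b := (k - 2 * B * h) %/ h in let j := (k - 2 * B * h) %% h in
           f (2 * b * h + j) + f ((2 * b + 1) * h + j)
  else g.

(** Zeros in between, because the product of two blocks of length 1 gets a block of length 2. *)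
Definition kara_point (f g : nat -> nat) : nat -> nat :=
  fun k => if odd k then 0 else f k./2 * g k./2.

(* m levels above the pointwise products *)
Fixpoint kara_interp (z : nat -> nat) (m : nat) : nat -> nat :=
  if m is m'.+1 then
    let B := 3 ^ (s - m) in let h := 2 ^ m' in let f := kara_interp z m' in
    fun k => let b := k %/ (4 * h) in let j := k %% (4 * h) in
      f k + (if (h <= j) && (j < 3 * h) then
               f (4 * B * h + 2 * b * h + (j - h)) -
               (f (4 * b * h + (j - h)) + f (4 * b * h + 2 * h + (j - h)))
             else 0)
  else z.

Local Open Scope ring_scope.

Definition block (f : nat -> nat) (h b : nat) : {poly int} :=
  \poly_(j < h) (f (b * h + j)%N)%:Z.

Lemma block_split f h b :
  block f (2 * h) b = block f h (2 * b)%N + 'X^h * block f h (2 * b + 1)%N.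
Proof.
apply/polyP => i; rewrite coefD coefXnM !coef_poly.
case: (ltnP i h) => ih.
  rewrite addr0 (_ : (i < 2 * h)%N = true); last by lia.
  by congr (Posz (f _)); lia.
rewrite (_ : (i - h < h)%N = (i < 2 * h)%N); last by lia.
rewrite add0r; case: ifP => // _.
by congr (Posz (f _)); nia.
Qed.

Lemma block_eval g l b : (l < s)%N -> (b < 3 ^ l)%N ->
  let h := (2 ^ (s - l.+1))%N in
  [/\ block (kara_eval g l.+1) h (2 * b)%N = block (kara_eval g l) h (2 * b)%N,
      block (kara_eval g l.+1) h (2 * b + 1)%N = block (kara_eval g l) h (2 * b + 1)%N &
      block (kara_eval g l.+1) h (2 * 3 ^ l + b)%N =
      block (kara_eval g l) h (2 * b)%N + block (kara_eval g l) h (2 * b + 1)%N].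
Proof.
move=> ls bB h; have h0 : (0 < h)%N by rewrite expn_gt0.
split; apply/polyP => i; rewrite ?coefD !coef_poly; case: ltnP => ih //=;
  rewrite -/h; move: (3 ^ l)%N bB => B bB.
- by rewrite (_ : _ < _ = true)%N //; nia.
- by rewrite (_ : _ < _ = true)%N //; nia.
rewrite (_ : _ < _ = false)%N; last by nia.
rewrite (_ : (2 * B + b) * h + i - 2 * B * h = b * h + i)%N; last by nia.
by rewrite divnMDl // divn_small // addn0 modnMDl modn_small.
Qed.

Variables (g g' : nat -> nat).

Definition kara_z := kara_interp (kara_point (kara_eval g s) (kara_eval g' s)).

(** Karatsuba's identity, stated over the integers so that the middle term is a genuine difference
    of polynomials. *)
Lemma kara_block m : (m <= s)%N -> forall b, (b < 3 ^ (s - m))%N ->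
  block (kara_z m) (2 * 2 ^ m)%N b =
  block (kara_eval g (s - m)) (2 ^ m)%N b * block (kara_eval g' (s - m)) (2 ^ m)%N b.
Proof.
elim: m => [|m IHm] ms b; rewrite ?subn0.
  move=> _; rewrite muln1 /block; apply/polyP => i.
  have p1 f : \poly_(j < 1) (f (b * 1 + j)%N)%:Z = (f b : nat)%:Z%:P.
    apply/polyP => j; rewrite coef_poly coefC.
    by case: j => [|j] //=; rewrite muln1 addn0.
  rewrite !p1 -polyCM coefC coef_poly /kara_z /= /kara_point.
  case: i => [|[|i]] //=.
    by rewrite addn0 oddM andbF muln2 doubleK.
  by rewrite addn1 muln2 /= odd_double.
move=> bB; have ms' := ltnW ms; have IH := IHm ms'.
pose l := (s - m.+1)%N; have el : (s - m = l.+1)%N by rewrite /l; lia.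
have ls : (l < s)%N by rewrite /l; lia.
have hE : (s - l.+1 = m)%N by rewrite /l; lia.
rewrite el in IH; rewrite -/l in bB *.
have := @block_eval g l b ls bB; have := @block_eval g' l b ls bB.
rewrite hE expnS /=; set h := (2 ^ m)%N.
move=> [e1 e2 e3] [d1 d2 d3].
have h0 : (0 < h)%N by rewrite expn_gt0.
have b3 : (3 ^ l.+1 = 3 * 3 ^ l)%N by rewrite expnS.
have := IH (2 * b)%N; have := IH (2 * b + 1)%N; have := IH (2 * 3 ^ l + b)%N.
rewrite -/h e1 e2 e3 d1 d2 d3 b3 => I3 I2 I1.
have {}I1 := I1 (ltac:(lia)); have {}I2 := I2 (ltac:(lia)); have {}I3 := I3 (ltac:(lia)).
rewrite (block_split (kara_eval g l)) (block_split (kara_eval g' l)).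
move: I1 I2 I3.
set X0 := block (kara_eval g l) _ (2 * b)%N.
set X1 := block (kara_eval g l) _ (2 * b + 1)%N.
set Y0 := block (kara_eval g' l) _ (2 * b)%N.
set Y1 := block (kara_eval g' l) _ (2 * b + 1)%N.
set Z0 := block (kara_z m) _ (2 * b)%N.
set Z1 := block (kara_z m) _ (2 * b + 1)%N.
set Z2 := block (kara_z m) _ _.
move=> I1 I2 I3.
have M : Z2 - Z0 - Z1 = X0 * Y1 + X1 * Y0 by rewrite I1 I2 I3; ring.
(* Nonnegative middle coefficients make the truncated subtraction in [kara_interp] exact. *)
have M0 i : 0 <= (X0 * Y1 + X1 * Y0)`_i.
  rewrite coefD !coefM; apply: addr_ge0; apply: sumr_ge0 => j _;
  by rewrite !coef_poly; do 2 case: ifP => // _; rewrite -PoszM.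
(* Hence, shifted by [h], the middle term only meets positions from [h] to [3 * h]. *)
have szM i : (2 * h <= i)%N -> (X0 * Y1 + X1 * Y0)`_i = 0.
  by move=> hi; rewrite -M !coefB !coef_poly ltnNge hi.
have T2 : (X0 + 'X^h * X1) * (Y0 + 'X^h * Y1) =
    Z0 + 'X^h * (X0 * Y1 + X1 * Y0) + 'X^(h + h) * Z1.
  by rewrite I1 I2 exprD; ring.
rewrite T2; move: M M0 szM; set T := X0 * Y1 + X1 * Y0 => M M0 szM.
apply/polyP => i; rewrite !coefD !coefXnM.
have cM k : (k < 2 * h)%N ->
   (Z2 - Z0 - Z1)`_k = (kara_z m (4 * 3 ^ l * h + 2 * b * h + k) -
     (kara_z m (4 * b * h + k) + kara_z m (4 * b * h + 2 * h + k)))%N%:Z.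
  move=> kh; have := M0 k; rewrite -M !coefB !coef_poly kh.
  rewrite (_ : (2 * 3 ^ l + b) * (2 * h) + k = 4 * 3 ^ l * h + 2 * b * h + k)%N; last by ring.
  rewrite (_ : 2 * b * (2 * h) + k = 4 * b * h + k)%N; last by ring.
  rewrite (_ : (2 * b + 1) * (2 * h) + k = 4 * b * h + 2 * h + k)%N; last by ring.
  by lia.
rewrite coef_poly; case: ltnP => ih; last first.
  have -> : (i < h)%N = false by lia.
  have -> : (i < h + h)%N = false by lia.
  rewrite szM /=; last by lia.
  rewrite !coef_poly (_ : (i < 2 * h)%N = false); last by lia.
  by rewrite (_ : (i - (h + h) < 2 * h)%N = false) //; lia.
have dE : ((b * (2 * (2 * h)) + i) %/ (4 * h) = b)%N.
  by rewrite (_ : b * (2 * (2 * h)) = b * (4 * h))%N ?divnMDl ?divn_small ?addn0 //; lia.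
have mE : ((b * (2 * (2 * h)) + i) %% (4 * h) = i)%N.
  by rewrite (_ : b * (2 * (2 * h)) = b * (4 * h))%N ?modnMDl ?modn_small //; lia.
rewrite {1}/kara_z /= -/kara_z -/h dE mE -/l PoszD addrAC; congr (_ + _); last first.
  case: (ltnP i h) => hi //=; case: (ltnP i (3 * h)) => hi'.
    by rewrite -M cM //; lia.
  by rewrite szM //; lia.
rewrite !coef_poly; case: (ltnP i (2 * h)) => hi.
  rewrite (_ : i < h + h)%N ?addr0; last by lia.
  by congr (Posz (kara_z m _)); lia.
rewrite (_ : i < h + h = false)%N ?add0r; last by lia.
rewrite (_ : i - (h + h) < 2 * h)%N; last by lia.
by congr (Posz (kara_z m _)); nia.
Qed.

(** At the top level there is a single block, wide enough for the whole product. *)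
Lemma kara_conv k : (forall i, (2 ^ s <= i)%N -> g i = 0%N) ->
  (forall i, (2 ^ s <= i)%N -> g' i = 0%N) -> (k < 2 * 2 ^ s)%N ->
  kara_z s k = (\sum_(j < k.+1) g j * g' (k - j))%N.
Proof.
move=> z z' ks; have := @kara_block s (leqnn _) 0%N; rewrite subnn expn0 => /(_ isT).
move=> /(congr1 (fun p : {poly int} => p`_k)); rewrite coef_poly ks mul0n add0n => e.
apply/eqP; rewrite -eqz_nat e coefM ; apply/eqP.
rewrite (big_morph Posz PoszD (erefl 0%:Z)); apply: eq_bigr => j _.
have cb f (i : nat) : (forall i, (2 ^ s <= i)%N -> f i = 0%N) ->
    (block (kara_eval f 0) (2 ^ s) 0)`_i = (f i)%:Z.
  by move=> fz; rewrite coef_poly; case: ltnP => // /fz ->.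
by rewrite !cb // PoszM.
Qed.

Lemma kara_eval_le f G l k : (forall i, (f i <= G)%N) -> (kara_eval f l k <= 2 ^ l * G)%N.
Proof.
move=> fG; elim: l k => [|l IHl] k /=; first by rewrite mul1n.
rewrite expnS; have h i := IHl i; case: ifP => _; first by have := h k; lia.
set i1 := (X in (kara_eval f l X + _)%N); set i2 := (X in (_ + kara_eval f l X)%N).
by have := h i1; have := h i2; lia.
Qed.

Lemma kara_interp_le z G m k : (forall i, (z i <= G)%N) -> (kara_interp z m k <= 2 ^ m * G)%N.
Proof.
move=> fG; elim: m k => [|m IHm] k /=; first by rewrite mul1n.
rewrite expnS; have h i := IHm i; case: ifP => _; last by have := h k; lia.
set i1 := (X in (_ + (kara_interp z m X - _))%N).
by have := h k; have := h i1; lia.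
Qed.

End Karatsuba.

Lemma sum_mul (R : nmodType) (A K : nat) (F : nat -> R) :
  (\sum_(j < A * K) F j = \sum_(a < A) \sum_(l < K) F (a * K + l)%N)%R.
Proof.
elim: A => [|A IHA]; first by rewrite !big_ord0.
by rewrite big_ord_recr /= -IHA mulSnr big_split_ord.
Qed.

(** * Kronecker substitution and signed pairs *)

Section Kronecker.

Variable R : comNzRingType.
Variables (K L : nat) (x y : nat -> R) (beta : R).
Hypothesis KL : 2 * L <= K.
Hypothesis x0 : forall a l, L <= l -> l < K -> x (a * K + l) = 0%R.
Hypothesis y0 : forall a l, L <= l -> l < K -> y (a * K + l) = 0%R.

Local Open Scope ring_scope.

Definition conv (u v : nat -> R) (k : nat) : R := \sum_(j < k.+1) u j * v (k - j)%N.

Definition chunk (u : nat -> R) (a : nat) : R := \sum_(l < L) u (a * K + l)%N * beta ^+ l.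

(** Products of chunks of length [L] fit in the stride [K >= 2 * L] without overlap, so evaluating
    each block at [beta] is multiplicative. The ring element [beta] is free: [-1] serves for signed
    pairs, the limb base for long entries. *)
Lemma conv_chunk b : \sum_(l < K) conv x y (b * K + l)%N * beta ^+ l
  = \sum_(a < b.+1) chunk x a * chunk y (b - a)%N.
Proof.
pose px a := \poly_(l < L) x (a * K + l)%N; pose py a := \poly_(l < L) y (a * K + l)%N.
have hx a : chunk x a = (px a).[beta].
  rewrite (horner_coef_wide _ (size_poly _ _)); apply: eq_bigr => l _.
  by rewrite coef_poly ltn_ord.
have hy a : chunk y a = (py a).[beta].
  rewrite (horner_coef_wide _ (size_poly _ _)); apply: eq_bigr => l _.
  by rewrite coef_poly ltn_ord.
transitivity (\sum_(l < K) (\sum_(a < b.+1) (px a * py (b - a)%N)`_l) * beta ^+ l).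
  apply: eq_bigr => -[l lK] _ /=; congr (_ * _).
  transitivity (\sum_(j < b.+1 * K) (if (j <= b * K + l)%N then x j * y (b * K + l - j)%N else 0)).
    rewrite /conv -big_mkcond /= (big_ord_widen (b.+1 * K) (fun j => x j * y (b * K + l - j)%N)) //.
    by rewrite mulSn; lia.
  rewrite (sum_mul _ _ (fun j => if (j <= b * K + l)%N then x j * y (b * K + l - j)%N else 0)).
  apply: eq_bigr => -[a ab] _ /=.
  rewrite coefM (big_ord_widen K (fun i => (px a)`_i * (py (b - a)%N)`_(l - i))) //.
  rewrite [RHS]big_mkcond; apply: eq_bigr => -[i iK] _ /=.
  rewrite !coef_poly.
  case: (ltnP i L) => iL; last by rewrite x0 // !mul0r; do 2 case: ifP.
  have abK : (a * K <= b * K)%N by rewrite leq_mul2r -ltnS ab orbT.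
  have eK : ((b - a) * K = b * K - a * K)%N by rewrite mulnBl.
  case: (leqP i l) => il.
    rewrite (_ : (a * K + i <= b * K + l)%N); last by lia.
    rewrite (_ : (b * K + l - (a * K + i) = (b - a) * K + (l - i))%N); last by lia.
    rewrite ltnS il; case: (ltnP (l - i) L) => // h; rewrite y0 ?mulr0 //; lia.
  (* For [l < i] the subtraction borrows: the index falls at offset [K + l - i >= L] of the
     preceding block, inside the zero padding of [y]. *)
  rewrite [(i < l.+1)%N]ltnS [(i <= l)%N]leqNgt il /=; case: ifP => // h.
  have ab' : (a < b)%N.
    by rewrite ltnNge; apply/negP => ba; have := leq_mul ba (leqnn K); lia.
  have eK' : ((b - a) * K = (b - a).-1 * K + K)%N by rewrite -mulSnr prednK // subn_gt0.
  rewrite (_ : (b * K + l - (a * K + i) = (b - a).-1 * K + (K + l - i))%N); last by lia.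
  by rewrite y0 ?mulr0 //; lia.
under eq_bigr do rewrite mulr_suml.
rewrite exchange_big; apply: eq_bigr => a _ /=.
rewrite hx hy -hornerM; symmetry.
rewrite (horner_coef_wide (n := K)).
  apply: eq_bigr => l _; congr (_ * _).
apply: leq_trans (size_polyMleq _ _) _; apply: leq_trans (leq_pred _) _.
by apply: leq_trans (leq_add (size_poly _ _) (size_poly _ _)) _; rewrite addnn -mul2n.
Qed.

End Kronecker.

(* A signed sequence is stored as pairs of naturals: entry 2i minus entry 2i+1.
   Multiplying such pairs is multiplying polynomials in a variable whose square
   is 1; spreading the pairs with period 4 makes the product a plain convolution. *)
Definition signed (x : nat -> nat) (i : nat) : int :=
  (Posz (x (2 * i)) - Posz (x (2 * i + 1)))%R.

Definition spread (m : nat) (x : nat -> nat) (a : nat) : nat :=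
  if (a %% 4 < 2) && (a %/ 4 <= m) then x (2 * (a %/ 4) + a %% 4) else 0.

Definition convn (x y : nat -> nat) (b : nat) : nat :=
  \sum_(a < b.+1) x a * y (b - a).

(** The product of two pairs has exponents 0 to 2 in the sign variable; exponents [l] and [l + 2]
    are merged because its square is 1. Only coefficients whose index has parity [par] are kept. *)
Definition section_mul (m par : nat) (x y : nat -> nat) (e : nat) : nat :=
  let b := 4 * (2 * (e %/ 2) + par) + e %% 2 in
  convn (spread m x) (spread m y) b + convn (spread m x) (spread m y) (b + 2).

(** Substitutes [-z] for [z]: the two entries of a pair are exchanged at odd indices. *)
Definition alternate (q : nat -> nat) (e : nat) : nat :=
  q (2 * (e %/ 2) + (e %% 2 + e %/ 2) %% 2).

Lemma section_mulE m par x y i l : l < 2 ->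
  let F := convn (spread m x) (spread m y) in
  section_mul m par x y (i * 2 + l) =
  F (4 * (2 * i + par) + l) + F (4 * (2 * i + par) + l + 2).
Proof.
by move=> l2; rewrite /section_mul divnMDl // modnMDl divn_small // modn_small // addn0.
Qed.

Lemma alternateE q i l : l < 2 -> alternate q (i * 2 + l) = q (2 * i + (l + i) %% 2).
Proof.
rewrite /alternate => l2; have -> : (i * 2 + l) %/ 2 = i by lia.
by have -> : (i * 2 + l) %% 2 = l by lia.
Qed.

(** An [l^1] norm of unnormalised pairs. *)
Definition weight (m : nat) (x : nat -> nat) : nat := \sum_(e < 2 * m.+1) x e.

Lemma PoszS (I : Type) (r : seq I) (P : pred I) (F : I -> nat) :
  Posz (\sum_(i <- r | P i) F i) = (\sum_(i <- r | P i) Posz (F i))%R.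
Proof. exact: (big_morph Posz PoszD (erefl (Posz 0))). Qed.

Lemma sum_muln (A K : nat) (F : nat -> nat) :
  \sum_(j < A * K) F j = \sum_(a < A) \sum_(l < K) F (a * K + l).
Proof. exact: sum_mul. Qed.

(** [signed] is the value of a pair at [-1], so this is [conv_chunk] with stride 4 and
    [beta = -1]. *)
Lemma signed_section_mul m par x y i : 2 * i + par <= m ->
  signed (section_mul m par x y) i =
  (\sum_(j < (2 * i + par).+1) signed x j * signed y (2 * i + par - j)%N)%R.
Proof.
move=> im; set b := 2 * i + par.
have sp u a l : 2 <= l -> l < 4 -> Posz (spread m u (a * 4 + l)) = 0%R.
  move=> l2 l4; rewrite /spread modnMDl modn_small //.
  by rewrite ltnNge l2.
have := conv_chunk (R := int) (K := 4) (L := 2) (x := fun k => Posz (spread m x k))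
  (y := fun k => Posz (spread m y k)) (-1)%R isT (sp x) (sp y) b.
have cE u a : a <= b -> chunk (R := int) 4 2 (-1)%R (fun k => Posz (spread m u k)) a = signed u a.
  move=> ab; rewrite /chunk !big_ord_recr big_ord0 /= /signed /spread !modnMDl !divnMDl //.
  rewrite /= !addn0 (_ : a <= m) ?expr0 ?expr1 ?mulr1 ?add0r ?mulrN1 //; last by lia.
move=> E; transitivity (\sum_(l < 4) conv (R := int) (fun k => Posz (spread m x k))
    (fun k => Posz (spread m y k)) (b * 4 + l)%N * (-1) ^+ l)%R; last first.
  rewrite E; apply: eq_bigr => -[a ab] _ /=.
  by rewrite !cE //; lia.
have vE k : conv (R := int) (fun k => Posz (spread m x k)) (fun k => Posz (spread m y k)) k
    = Posz (convn (spread m x) (spread m y) k).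
  by rewrite /convn PoszS; apply: eq_bigr => j _; rewrite PoszM.
rewrite !big_ord_recr big_ord0 /= !vE /signed /section_mul.
have -> : 2 * i %/ 2 = i by lia.
have -> : (2 * i + 1) %/ 2 = i by lia.
have -> : 2 * i %% 2 = 0 by lia.
have -> : (2 * i + 1) %% 2 = 1 by lia.
rewrite -/b !PoszD [b * 4]mulnC !addn0.
have -> : 4 * b + 1 + 2 = 4 * b + 3 by lia.
by rewrite expr0 expr1 !exprS expr0; ring.
Qed.

Lemma signed_alternate q i : signed (alternate q) i = ((-1) ^+ i * signed q i)%R.
Proof.
rewrite /signed /alternate.
have -> : 2 * i %/ 2 = i by lia.
have -> : (2 * i + 1) %/ 2 = i by lia.
have -> : 2 * i %% 2 = 0 by lia.
have -> : (2 * i + 1) %% 2 = 1 by lia.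
rewrite -signr_odd; case: (boolP (odd i)) => oi.
  have -> : (0 + i) %% 2 = 1 by rewrite add0n modn2 oi.
  have -> : (1 + i) %% 2 = 0 by rewrite modn2 /= oi.
  by rewrite expr1 addn0; ring.
have -> : (0 + i) %% 2 = 0 by rewrite add0n modn2 (negbTE oi).
have -> : (1 + i) %% 2 = 1 by rewrite modn2 /= oi.
by rewrite expr0 addn0; ring.
Qed.

Lemma sum_stride (par m m' : nat) (F : nat -> nat) : 2 * m' + par <= m ->
  \sum_(i < m'.+1) F (2 * i + par) <= \sum_(i < m.+1) F i.
Proof.
elim: m' m => [|m' IHm] m h.
  have pm : par < m.+1 by lia.
  by rewrite big_ord1 (bigD1 (Ordinal pm)) //= muln0 add0n leq_addr.
rewrite big_ord_recr /=.
have h' : 2 * m' + par <= 2 * m' + par by [].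
have := IHm _ h'.
have -> : m.+1 = (2 * m' + par).+1 + (m - (2 * m' + par)) by lia.
rewrite big_split_ord /= => le; apply: leq_add => //.
have lt : 1 < m - (2 * m' + par) by lia.
rewrite (bigD1 (Ordinal lt)) //=; apply: leq_trans (leq_addr _ _).
by rewrite eq_leq //; congr F; lia.
Qed.

(** Submultiplicativity of the [l^1] norm; truncation to [N] terms only drops nonnegative
    products. *)
Lemma sum_conv (N : nat) (x y : nat -> nat) :
  \sum_(b < N) convn x y b <= (\sum_(a < N) x a) * (\sum_(b < N) y b).
Proof.
rewrite (eq_bigr (fun b : 'I_N => \sum_(a < N) (if a <= b then x a * y (b - a) else 0))).
  rewrite exchange_big big_distrl /=; apply: leq_sum => a _.
  have sh m : \sum_(b < m) (if a <= b then x a * y (b - a) else 0) = x a * \sum_(b < m - a) y b.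
    elim: m => [|m IHm]; first by rewrite !big_ord0 muln0.
    rewrite big_ord_recr /= IHm; case: leqP => h; last first.
      by rewrite addn0; congr (_ * _); rewrite (_ : m.+1 - a = m - a) //; lia.
    by rewrite subSn // big_ord_recr /= mulnDr.
  rewrite sh leq_mul2l; apply/orP; right.
  have le := leq_subr a N.
  rewrite (big_ord_widen N y le) [X in _ <= X](bigID (fun b : 'I_N => b < N - a)) /=.
  exact: leq_addr.
move=> b _; rewrite /convn (big_ord_widen N (fun a => x a * y (b - a))) //.
by rewrite big_mkcond.
Qed.

Lemma weight_spread m x : \sum_(a < 4 * m.+1) spread m x a = weight m x.
Proof.
rewrite /weight [4 * _]mulnC [2 * _]mulnC !sum_muln; apply: eq_bigr => -[a am] _ /=.
rewrite !big_ord_recr !big_ord0 /spread /= !modnMDl !divnMDl //= !addn0 -ltnS am.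
by rewrite !modn_small // [2 * a]mulnC.
Qed.

Lemma weight_section_mul m m' par x y : 2 * m' + par <= m ->
  weight m' (section_mul m par x y) <= weight m x * weight m y.
Proof.
move=> h; rewrite -(weight_spread m x) -(weight_spread m y).
apply: leq_trans (sum_conv _ _ _); set F := convn _ _.
rewrite [4 * _]mulnC sum_muln.
apply: leq_trans (sum_stride (fun i => \sum_(l < 4) F (i * 4 + l)) h).
rewrite /weight mulnC sum_muln; apply/eq_leq/eq_bigr => -[i im] _ /=.
rewrite !big_ord_recr !big_ord0 /= !section_mulE // -/F; move: (2 * i + par) => b.
have -> : 4 * b + 0 + 2 = b * 4 + 2 by lia.
have -> : 4 * b + 1 + 2 = b * 4 + 3 by lia.
rewrite [4 * b]mulnC; lia.
Qed.

Lemma weight_alternate m q : weight m (alternate q) = weight m q.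
Proof.
rewrite /weight mulnC !sum_muln; apply: eq_bigr => -[i im] _ /=.
rewrite !big_ord_recr !big_ord0 /= !alternateE // [2 * i]mulnC !modn2 /=.
by case: (boolP (odd i)) => oi; rewrite !add0n // addnC.
Qed.

(** The identity [Q G = A] of power series modulo [z^(m+1)], with constant coefficient 1 in [Q]. *)
Definition solves (m : nat) (a q : nat -> nat) (g : nat -> int) : Prop :=
  signed q 0 = 1%R /\
  forall i, i <= m -> (\sum_(j < i.+1) signed q j * g (i - j)%N)%R = signed a i.

(** * Graeffe's iteration *)

Section Graeffe.

Local Open Scope ring_scope.

Definition prefix_poly (m : nat) (u : nat -> int) : {poly int} := \poly_(i < m.+1) u i.

Lemma coef_prefix m u i : (i <= m)%N -> (prefix_poly m u)`_i = u i.
Proof. by move=> im; rewrite coef_poly ltnS im. Qed.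

Lemma coef_prefixM m u v k : (k <= m)%N ->
  (prefix_poly m u * prefix_poly m v)`_k = \sum_(j < k.+1) u j * v (k - j)%N.
Proof.
move=> km; rewrite coefM; apply: eq_bigr => -[j jk] _ /=.
by rewrite !coef_prefix //; lia.
Qed.

Lemma sum_even (i par : nat) (F : nat -> int) : (par < 2)%N ->
  (forall j, odd j -> F j = 0) ->
  \sum_(j < (2 * i + par).+1) F j = \sum_(j < i.+1) F (2 * j)%N.
Proof.
move=> p2 F0; elim: i => [|i IHi].
  rewrite muln0 add0n big_ord1; case: par p2 => [|[|//]] _; first by rewrite big_ord1.
  by rewrite big_ord_recr big_ord1 /= (F0 1%N) // addr0.
rewrite (_ : (2 * i.+1 + par = (2 * i + par).+2)%N); last by lia.
rewrite 2!big_ord_recr /= IHi [in RHS]big_ord_recr /= -addrA; congr (_ + _).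
case: par p2 {IHi} => [|[|//]] _; rewrite ?addn0 ?addn1.
  rewrite (F0 (2 * i).+1) ?add0r; last by rewrite /= mul2n odd_double.
  by congr F; lia.
rewrite (F0 (2 * i).+3) ?addr0; last by rewrite /= mul2n odd_double.
by congr F; lia.
Qed.

(** After multiplication of [Q G = A] by [Q(-z)] the left factor is even, so the equations at
    indices of parity [par] involve only coefficients of [G] of that parity. *)
Lemma graeffe_step m par m' a q g : m = (2 * m' + par)%N -> (par < 2)%N -> solves m a q g ->
  solves m' (section_mul m par a (alternate q)) (section_mul m 0 q (alternate q))
    (fun i => g (2 * i + par)%N).
Proof.
move=> em p2 [q0 sol].
pose r i : int := (-1) ^+ i * signed q i.
pose PQ := prefix_poly m (signed q); pose PR := prefix_poly m r.
pose PA := prefix_poly m (signed a); pose PG := prefix_poly m g.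
have cQR k : (k <= m)%N ->
    (PQ * PR)`_k = \sum_(j < k.+1) signed q j * signed (alternate q) (k - j)%N.
  move=> km; rewrite coef_prefixM //; apply: eq_bigr => j _.
  by rewrite signed_alternate.
(* Exchanging the factors replaces [j] by [k - j], which flips the sign when [k] is odd; the
   coefficient equals its own negative. *)
have odd0 k : odd k -> (PQ * PR)`_k = 0.
  move=> ok; suff : (PQ * PR)`_k = - (PQ * PR)`_k by lia.
  rewrite {1}coefM coefMr -sumrN; apply: eq_bigr => -[j jk] _ /=.
  rewrite /PQ /PR !coef_poly; case: ifP => jm; last by rewrite mul0r mulr0 oppr0.
  case: ifP => km; last by rewrite mulr0 mul0r oppr0.
  rewrite /r (_ : (-1) ^+ (k - j) = - (-1) ^+ j :> int); first by ring.
  rewrite -(signr_odd _ (k - j)) -(signr_odd _ j) oddB // ok.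
  by case: (odd j).
have cQG k : (k <= m)%N -> (PQ * PG)`_k = PA`_k.
  by move=> km; rewrite coef_prefixM // sol // coef_prefix.
have key k : (k <= m)%N -> (PQ * PR * PG)`_k = (PA * PR)`_k.
  move=> km; rewrite (_ : PQ * PR * PG = PQ * PG * PR); last by ring.
  rewrite !coefM; apply: eq_bigr => -[j jk] _ /=.
  by rewrite cQG //; lia.
split.
  rewrite signed_section_mul // muln0 big_ord1 subnn signed_alternate expr0 mul1r q0.
  by rewrite mul1r.
move=> i im'; rewrite signed_section_mul; last by lia.
transitivity (PA * PR)`_(2 * i + par); last first.
  rewrite coef_prefixM; last by lia.
  by apply: eq_bigr => j _; rewrite signed_alternate.
rewrite -key; last by lia.
rewrite coefM (@sum_even i par (fun j => (PQ * PR)`_j * PG`_(2 * i + par - j)) p2); last first.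
  by move=> j /odd0 ->; rewrite mul0r.
apply: eq_bigr => -[j ji] _ /=.
rewrite signed_section_mul ?addn0; last by lia.
rewrite cQR; last by lia.
by rewrite coef_prefix; [congr (_ * g _); lia|lia].
Qed.

Lemma solves0 a q g : solves 0 a q g -> signed a 0 = g 0%N.
Proof. by move=> [q0 /(_ 0%N isT)]; rewrite big_ord1 q0 mul1r. Qed.

Section Initial.

Variables (n : nat) (c : nat -> nat).
Hypotheses (n0 : (0 < n)%N) (c_out : forall i, (n <= i)%N -> c i = 0%N).

(** [1 - C(z)] in signed pairs; [2 < e] excludes entry 1, the negative part of the constant
    coefficient. *)
Definition den0 (e : nat) : nat :=
  if e == 0%N then 1%N else if odd e && (2 < e)%N then c (e %/ 2).-1 else 0%N.

(** [z C'(z)] in signed pairs, without negative parts. *)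
Definition num0 (e : nat) : nat := if odd e then 0%N else (e %/ 2 * c (e %/ 2).-1)%N.

Lemma signed_den0 i : signed den0 i = if i is i'.+1 then - (c i')%:Z else 1.
Proof.
case: i => [|i]; rewrite /signed /den0 //.
have -> : odd (2 * i.+1 + 1) by rewrite mul2n addn1 /= odd_double.
have -> : odd (2 * i.+1) = false by rewrite mul2n odd_double.
have -> : (2 < 2 * i.+1 + 1)%N by lia.
have -> : ((2 * i.+1 + 1) %/ 2 = i.+1)%N by lia.
have -> : (2 * i.+1 + 1 == 0)%N = false by lia.
have -> : (2 * i.+1 == 0)%N = false by lia.
by rewrite sub0r.
Qed.

Lemma signed_num0 i : signed num0 i = (i * c i.-1)%N%:Z.
Proof.
rewrite /signed /num0.
have -> : odd (2 * i + 1) by rewrite mul2n addn1 /= odd_double.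
have -> : odd (2 * i) = false by rewrite mul2n odd_double.
have -> : (2 * i %/ 2 = i)%N by lia.
by rewrite subr0.
Qed.

(** With [B] the series of [blocks], [Q B = 1] by [blocksE] and [A B] is the series of [cyclic];
    hence [Q (A B) = A]. *)
Lemma solves_initial d : solves d num0 den0 (fun k => (cyclic n c k)%:Z).
Proof.
split=> [|i id]; first by rewrite signed_den0.
pose PQ := prefix_poly d (signed den0); pose PA := prefix_poly d (signed num0).
pose PB := prefix_poly d (fun k => (blocks n c k)%:Z).
have cAB k : (k <= d)%N -> (PA * PB)`_k = (cyclic n c k)%:Z.
  move=> kd; rewrite coef_prefixM // big_ord_recl signed_num0 mul0n mul0r add0r /cyclic.
  rewrite PoszS; apply: eq_bigr => -[j jk] _ /=.
  rewrite signed_num0 /bump /= add1n PoszM; congr (_ * (blocks n c _)%:Z); lia.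
have cQB k : (k <= d)%N -> (PQ * PB)`_k = (k == 0%N)%:Z.
  move=> kd; rewrite coef_prefixM // big_ord_recl signed_den0 mul1r subn0.
  case: k kd => [|k] kd; first by rewrite big_ord0 addr0.
  rewrite blocksE // PoszS -big_split big1 //= => -[j jk] _ /=.
  rewrite signed_den0 /bump /= add1n subSS PoszM; ring.
transitivity (PQ * (PA * PB))`_i.
  rewrite coefM; apply: eq_bigr => -[j ji] _ /=.
  by rewrite coef_prefix ?cAB //; lia.
rewrite (_ : PQ * (PA * PB) = PA * (PQ * PB)); last by ring.
rewrite coefM big_ord_recr /= subnn cQB // mulr1 big1 ?add0r ?coef_prefix // => -[j ji] _ /=.
rewrite cQB; last by lia.
by rewrite (_ : (i - j == 0)%N = false) ?mulr0 //; lia.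
Qed.

End Initial.

End Graeffe.

Lemma PoszX (a l : nat) : Posz (a ^ l) = (Posz a ^+ l)%R.
Proof. by elim: l => [|l IHl] //; rewrite expnS exprS PoszM IHl. Qed.

(** * Arithmetic on limbs *)

Definition limbs (beta L : nat) (f : nat -> nat) : nat := \sum_(l < L) f l * beta ^ l.

Lemma limbs_ext beta L f g : (forall l, l < L -> f l = g l) -> limbs beta L f = limbs beta L g.
Proof. by move=> e; apply: eq_bigr => -[l lL] _ /=; rewrite e. Qed.

Lemma limbsS beta L f : limbs beta L.+1 f = limbs beta L f + f L * beta ^ L.
Proof. by rewrite /limbs big_ord_recr. Qed.

Lemma limbsD beta L f g :
  limbs beta L (fun l => f l + g l) = limbs beta L f + limbs beta L g.
Proof. by rewrite /limbs -big_split; apply: eq_bigr => l _; rewrite mulnDl. Qed.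

Lemma limbs_lt beta L f : (forall l, l < L -> f l < beta) -> limbs beta L f < beta ^ L.
Proof.
elim: L => [|L IHL] h; first by rewrite /limbs big_ord0.
rewrite limbsS expnS; have := IHL (fun l lL => h l (ltnW lL)).
have := h L (ltnSn L); move: (beta ^ L) (f L) => P x xb lt.
by have : x.+1 * P <= beta * P; [rewrite leq_mul2r xb orbT|lia].
Qed.

Lemma limbs_compl beta L f : 0 < beta -> (forall l, l < L -> f l < beta) ->
  limbs beta L (fun l => beta.-1 - f l) + limbs beta L f + 1 = beta ^ L.
Proof.
move=> b0; elim: L => [|L IHL] h; first by rewrite /limbs !big_ord0.
rewrite !limbsS expnS -(IHL (fun l lL => h l (ltnW lL))).
have hx := h L (ltnSn L); have e : beta ^ L = limbs beta L (fun l => beta.-1 - f l) + limbs beta L f + 1.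
  by rewrite IHL // => l lL; apply: h; apply: ltnW.
rewrite -e; move: (beta ^ L) (f L) hx e => P x xb e.
have -> : beta * P = (beta.-1 - x) * P + x * P + P.
  by rewrite -mulnDl -{3}(mul1n P) -mulnDl; congr (_ * _); lia.
by lia.
Qed.

Lemma limbs_pad beta L L' f : L <= L' -> (forall l, L <= l -> l < L' -> f l = 0) ->
  limbs beta L' f = limbs beta L f.
Proof.
move=> /subnK <-; move: (L' - L) => d; elim: d => [//|d IHd] z.
rewrite addSn limbsS IHd => [|l h1 h2]; last by apply: z => //; lia.
by rewrite z ?mul0n ?addn0 //; lia.
Qed.

Section Carry.

Variables (beta : nat) (t : nat -> nat) (c0 : nat).

Fixpoint carry (l : nat) : nat := if l is l'.+1 then (t l' + carry l') %/ beta else c0.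

Definition digit (l : nat) : nat := (t l + carry l) %% beta.

Lemma carry_sum L : limbs beta L digit + carry L * beta ^ L = limbs beta L t + c0.
Proof.
elim: L => [|L IHL]; first by rewrite /limbs !big_ord0 /= muln1.
rewrite !limbsS expnS /= /digit.
have : ((t L + carry L) %% beta) * beta ^ L + (t L + carry L) %/ beta * (beta * beta ^ L)
    = t L * beta ^ L + carry L * beta ^ L.
  by rewrite mulnA -!mulnDl addnC -divn_eq.
by move: IHL; rewrite /digit; lia.
Qed.

Lemma digit_lt l : 0 < beta -> digit l < beta.
Proof. exact: ltn_pmod. Qed.

Lemma limbs_digit L : 0 < beta ->
  limbs beta L digit = (limbs beta L t + c0) %% beta ^ L.
Proof.
move=> b0; rewrite -carry_sum addnC modnMDl modn_small //.
by apply: limbs_lt => l _; apply: digit_lt.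
Qed.

(** Division of [2 * T] by [beta >= 2] returns below [T], so carries never outgrow the columns. *)
Lemma carry_le T l : 1 < beta -> c0 <= T -> (forall i, i < l -> t i <= T) -> carry l <= T.
Proof.
move=> b1 cT; elim: l => //= l IHl h.
have h1 := h l (ltnSn l); have h2 : carry l <= T by apply: IHl => i il; apply: h; lia.
have b0 : 0 < beta by lia.
by rewrite -ltnS ltn_divLR //; nia.
Qed.

End Carry.

(** Both Kronecker substitutions at once: [b %/ 4] is the coefficient, [b %% 4] the power of the
    sign variable and [l] the limb. Slots are [2 * L] wide with [L] limbs in use. *)
Definition layout (m L : nat) (src : nat -> nat) (k : nat) : nat :=
  let b := k %/ (2 * L) in let l := k %% (2 * L) in
  if [&& l < L, b %% 4 < 2 & b %/ 4 <= m] then src ((2 * (b %/ 4) + b %% 4) * L + l) else 0.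

Lemma layoutE m L src b l : l < 2 * L -> layout m L src (b * (2 * L) + l) =
  if [&& l < L, b %% 4 < 2 & b %/ 4 <= m] then src ((2 * (b %/ 4) + b %% 4) * L + l) else 0.
Proof.
move=> lL; rewrite /layout.
have K0 : 0 < 2 * L by apply: leq_ltn_trans lL.
have -> : (b * (2 * L) + l) %/ (2 * L) = b by rewrite divnMDl // divn_small // addn0.
by have -> : (b * (2 * L) + l) %% (2 * L) = l by rewrite modnMDl modn_small.
Qed.

Definition entry (beta L : nat) (src : nat -> nat) (e : nat) : nat :=
  limbs beta L (fun l => src (e * L + l)).

(** The limbs of the convolution need not be below [beta], yet their value is already right; carries
    are propagated only afterwards. *)
Lemma layout_conv beta m L x y b :
  limbs beta (2 * L) (fun l => convn (layout m L x) (layout m L y) (b * (2 * L) + l)) =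
  convn (spread m (entry beta L x)) (spread m (entry beta L y)) b.
Proof.
apply/eqP; rewrite -eqz_nat; apply/eqP; rewrite /limbs /convn !PoszS.
have z u a l : L <= l -> l < 2 * L -> Posz (layout m L u (a * (2 * L) + l)) = 0%R.
  by move=> h1 h2; rewrite layoutE // ltnNge h1.
have := conv_chunk (R := int) (x := fun k => Posz (layout m L x k))
  (y := fun k => Posz (layout m L y k)) (Posz beta) (leqnn (2 * L)) (z x) (z y) b.
have cE u a : chunk (R := int) (2 * L) L (Posz beta) (fun k => Posz (layout m L u k)) a =
    Posz (spread m (entry beta L u) a).
  rewrite /chunk /spread /entry /limbs; case: ifP => h.
    rewrite PoszS; apply: eq_bigr => -[l lL] _ /=.
    by rewrite layoutE ?lL ?h ?PoszM ?PoszX //; lia.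
  rewrite big1 // => -[l lL] _ /=; rewrite layoutE; last by lia.
  by rewrite lL h mul0r.
move=> E; transitivity (\sum_(l < 2 * L) conv (R := int) (fun k => Posz (layout m L x k))
    (fun k => Posz (layout m L y k)) (b * (2 * L) + l)%N * Posz beta ^+ l)%R.
  apply: eq_bigr => l _; rewrite PoszM /conv PoszS PoszX; congr (_ * _)%R.
by rewrite E; apply: eq_bigr => a _; rewrite !cE PoszM.
Qed.

Lemma spread_ext m x y : (forall e, e < 2 * m.+1 -> x e = y e) -> spread m x =1 spread m y.
Proof. by move=> h a; rewrite /spread; case: ifP => // /andP[h1 h2]; apply: h; lia. Qed.

Lemma convn_ext x x' y y' : x =1 x' -> y =1 y' -> convn x y =1 convn x' y'.
Proof. by move=> e e' b; rewrite /convn; apply: eq_bigr => a _; rewrite e e'. Qed.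

Lemma section_mul_le m m' par x y e : 2 * m' + par <= m -> e < 2 * m'.+1 ->
  section_mul m par x y e <= weight m x * weight m y.
Proof.
move=> h em; apply: leq_trans (weight_section_mul x y h).
by rewrite /weight (bigD1 (Ordinal em)) //= leq_addr.
Qed.

(** * Programs over arrays, with a time bound *)

Definition arrays : nat := 40.
Definition big_cell : nat := 39.
Definition max_degree : nat := 12.
(** A generous bound on the machine time of a single assignment or test on small numbers, so that
    times of programs can be counted in such steps. *)
Definition unit_time : nat := 500.

Inductive term :=
  | Cst of nat
  | Len
  | Sgm
  | Get of nat & term
  | Bin of arith & term & term.

Declare Scope ram_scope.
Delimit Scope ram_scope with ram.
Bind Scope ram_scope with term.
Notation "x + y" := (Bin Defs.Add x y) : ram_scope.
Notation "x - y" := (Bin Defs.Sub x y) : ram_scope.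
Notation "x * y" := (Bin Defs.Mul x y) : ram_scope.
Notation "x / y" := (Bin Defs.Div x y) : ram_scope.
Coercion Cst : nat >-> term.

Definition state := nat -> nat -> nat.

Definition upd (s : state) (j i x : nat) : state :=
  fun j' i' => if (j' == j) && (i' == i) then x else s j' i'.

(* Array j, index i lives at address n + 2 + arrays * i + j, so that all
   arrays are unbounded and disjoint, and the input is never moved. *)
Definition address (j : nat) (e : expr) : expr :=
  Arith Add (Arith Add (Read (Const 0)) (Const (2 + j)))
            (Arith Mul (Const arrays) e).

Fixpoint compile (e : term) : expr :=
  match e with
  | Cst k => Const k
  | Len => Read (Const 0)
  | Sgm => Read (Const 1)
  | Get j e => Read (address j (compile e))
  | Bin o e1 e2 => Arith o (compile e1) (compile e2)
  end.

Fixpoint duration (e : term) : nat :=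
  match e with
  | Cst _ => 1
  | Len | Sgm => 2
  | Get _ e => duration e + 8
  | Bin _ e1 e2 => duration e1 + duration e2 + 1
  end.

(** Values stay below [V ^ degree e]: a sum takes one more degree as [2 <= V], while truncated
    differences and quotients do not exceed their first argument. *)
Fixpoint degree (e : term) : nat :=
  match e with
  | Bin Add e1 e2 => (maxn (degree e1) (degree e2)).+1
  | Bin Mul e1 e2 => degree e1 + degree e2
  | Bin _ e1 _ => degree e1
  | _ => 1
  end.

(** An index needs two spare degrees, since its address multiplies it by [arrays] and adds [n] and
    an offset. Terms cannot read [big_cell], whose content may exceed [V]. *)
Fixpoint wf (e : term) : bool :=
  match e with
  | Cst k => k <= 64
  | Len | Sgm => true
  | Get j e => [&& wf e, degree e + 2 <= max_degree, j < arrays & j != big_cell]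
  | Bin o e1 e2 => [&& wf e1, wf e2 & degree (Bin o e1 e2) <= max_degree]
  end.

Definition assign (j : nat) (i e : term) : cmd :=
  Write (address j (compile i)) (compile e).

(** Letter [i] of the input lies in cell [i + 2], below all arrays. *)
Definition fetch (j : nat) (i : term) : cmd :=
  Write (address j (compile i)) (Read (Arith Add (compile i) (Const 2))).

(* A register is an array of which only index 0 is used. *)
Definition reg (r : nat) : term := Get r (Cst 0).

Definition branch (e : term) (c1 c2 : cmd) : cmd := If (compile e) c1 c2.

(** The truncated difference becomes 0 exactly when the counter reaches [e]. *)
Definition for_loop (r : nat) (e : term) (c : cmd) : cmd :=
  Seq (assign r (Cst 0) (Cst 0))
      (While (compile (Bin Defs.Sub e (reg r)))
             (Seq c (assign r (Cst 0) (Bin Add (reg r) (Cst 1))))).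

(* V bounds the content of every cell in use, apart from the last one; values of
   expressions stay below V ^ max_degree and cost one time unit. *)
Record ram_spec (n sigma : nat) (ws : seq nat) (M : machine) (V : nat) : Prop := RamSpec {
  ram_size : size ws = n;
  ram_min : 64 <= V;
  ram_n : n <= V;
  ram_sigma : sigma <= V;
  ram_letter : forall i, nth 0 ws i <= V;
  ram_charge : forall v, v <= V ^ max_degree -> charge M v = Some 1;
  ram_addressable : forall v, v <= V ^ max_degree -> addressable M v }.

(** * A timed program logic *)

Section Semantics.

Variables (n sigma : nat) (ws : seq nat) (M : machine) (V : nat).
Hypothesis ok : ram_spec n sigma ws M V.

Let size_ws := ram_size ok.
Let V64 := ram_min ok.
Let nV := ram_n ok.
Let sV := ram_sigma ok.
Let charge_small := ram_charge ok.
Let address_small := ram_addressable ok.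

Definition mem (s : state) : memory := fun a =>
  if a == 0 then n else if a == 1 then sigma
  else if a < n + 2 then nth 0 ws (a - 2)
  else s ((a - n - 2) %% arrays) ((a - n - 2) %/ arrays).

Definition bounded (s : state) : Prop :=
  forall j i, j < arrays -> j != big_cell -> s j i <= V.

Fixpoint den (s : state) (e : term) : nat :=
  match e with
  | Cst k => k
  | Len => n
  | Sgm => sigma
  | Get j e => s j (den s e)
  | Bin o e1 e2 => arith_op o (den s e1) (den s e2)
  end.

Definition location (j i : nat) : nat := n + (2 + j) + arrays * i.

Lemma mem_location s j i : j < arrays -> mem s (location j i) = s j i.
Proof.
move=> jJ; rewrite /mem /location; set x := arrays * i.
have -> : (n + (2 + j) + x == 0) = false by lia.
have -> : (n + (2 + j) + x == 1) = false by lia.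
have -> : (n + (2 + j) + x < n + 2) = false by lia.
have -> : n + (2 + j) + x - n - 2 = i * arrays + j by rewrite /x mulnC; lia.
by rewrite modnMDl modn_small // divnMDl // divn_small // addn0.
Qed.

Lemma mem_upd s j i x : j < arrays ->
  update (mem s) (location j i) x = mem (upd s j i x).
Proof.
move=> jJ; apply/funext => a; rewrite /update.
case: eqP => [->|ne]; first by rewrite mem_location // /upd !eqxx.
rewrite /mem /upd; case: eqP => // a0; case: eqP => // a1; case: ltnP => // an.
case: ifP => // /andP[/eqP ej /eqP ei]; case: ne; rewrite /location -ej -ei.
by have := divn_eq (a - n - 2) arrays; lia.
Qed.

Lemma mem_letter s i : i < n -> mem s (i + 2) = nth 0 ws i.
Proof.
move=> lin; rewrite /mem; have -> : (i + 2 == 0) = false by lia.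
have -> : (i + 2 == 1) = false by lia.
by rewrite ltn_add2r lin addnK.
Qed.

Lemma mem_init : mem (fun _ _ => 0) =1 nth 0 [:: n, sigma & ws].
Proof.
move=> [|[|a]] //; rewrite /mem /=; case: ltnP => h; first by rewrite subn2.
by rewrite nth_default // size_ws; lia.
Qed.

Lemma expV a b : a <= b -> V ^ a <= V ^ b.
Proof. by move=> ab; rewrite leq_pexp2l //; lia. Qed.

Lemma V_pos a : 0 < V ^ a.
Proof. by rewrite expn_gt0; lia. Qed.

Lemma degree_gt0 e : 0 < degree e.
Proof. by elim: e => //= -[] e1 h1 e2 h2 //; lia. Qed.

Lemma wf_degree e : wf e -> degree e <= max_degree.
Proof. by case: e => //= o e1 e2 /and3P[]. Qed.

Lemma wf_address e : degree e + 2 <= max_degree -> forall j x, j < arrays -> x <= V ^ degree e ->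
  [/\ location j x <= V ^ max_degree, arrays * x <= V ^ max_degree & n + (2 + j) <= V ^ max_degree].
Proof.
move=> de j x jJ xV.
have h1 := expV de; have d0 := degree_gt0 e.
have h2 : V ^ (degree e + 2) = V * V * V ^ degree e by rewrite addnC expnD.
have h3 : V <= V ^ degree e by have := expV d0; rewrite expn1.
have jJ' : j < 40 by [].
rewrite /location (_ : arrays = 40) //.
have h4 : 64 * 64 * V ^ degree e <= V * V * V ^ degree e.
  by rewrite leq_mul2r leq_mul ?orbT.
by split; lia.
Qed.

Lemma eval_const m k : k <= V ^ max_degree -> eval M m (Const k) = Some (k, 1).
Proof. by move=> h; rewrite /= charge_small. Qed.

Lemma eval_read m a i t : eval M m a = Some (i, t) ->
  i <= V ^ max_degree -> m i <= V ^ max_degree -> eval M m (Read a) = Some (m i, t + 1).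
Proof. by move=> /= -> h1 h2; rewrite address_small // charge_small. Qed.

Lemma eval_arith m o e1 e2 x t1 y t2 :
  eval M m e1 = Some (x, t1) -> eval M m e2 = Some (y, t2) ->
  x <= V ^ max_degree -> y <= V ^ max_degree -> arith_op o x y <= V ^ max_degree ->
  eval M m (Arith o e1 e2) = Some (arith_op o x y, t1 + t2 + 1).
Proof. by move=> /= -> -> h1 h2 h3; rewrite charge_small // !geq_max h1 h2. Qed.

Lemma V_le : V <= V ^ max_degree.
Proof. by have := @expV 1 max_degree isT; rewrite expn1. Qed.

Lemma eval_address s j e x t : j < arrays -> degree e + 2 <= max_degree ->
  eval M (mem s) (compile e) = Some (x, t) -> x <= V ^ degree e ->
  eval M (mem s) (address j (compile e)) = Some (location j x, t + 7).
Proof.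
move=> jlt de ev xV; have [loc1 loc2 loc3] := wf_address de jlt xV.
have jlt' : j < 40 by [].
have VD := V_le.
have x' : x <= V ^ max_degree by apply: leq_trans xV (expV _); lia.
have e0 : eval M (mem s) (Read (Const 0)) = Some (n, 2).
  have nD := leq_trans nV VD.
  exact: (eval_read (m := mem s) (eval_const (mem s) (leq0n _)) (leq0n _) nD).
have e1 : eval M (mem s) (Const (2 + j)) = Some (2 + j, 1) by apply: eval_const; lia.
have e2 : eval M (mem s) (Const arrays) = Some (arrays, 1).
  by apply: eval_const; rewrite /arrays; lia.
have jD : 2 + j <= V ^ max_degree by lia.
have aD : arrays <= V ^ max_degree by rewrite /arrays; lia.
have e3 := eval_arith (o := Add) e0 e1 (leq_trans nV VD) jD loc3.
have e4 := eval_arith (o := Mul) e2 ev aD x' loc2.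
rewrite /address (eval_arith (o := Add) e3 e4) //.
by congr (Some (_, _)); lia.
Qed.

Lemma eval_ok s e : bounded s -> wf e ->
  eval M (mem s) (compile e) = Some (den s e, duration e) /\ den s e <= V ^ degree e.
Proof.
move=> bs; have VD := V_le.
elim: e => [k||| j e IHe| o e1 IH1 e2 IH2].
- by move=> /= k64; rewrite charge_small ?expn1; [split=> //; lia|lia].
- move=> _; split; last by rewrite /= expn1.
  exact: (eval_read (m := mem s) (eval_const (mem s) (leq0n _)) (leq0n _) (leq_trans nV VD)).
- move=> _; split; last by rewrite /= expn1.
  have h1 : 1 <= V ^ max_degree by exact: V_pos.
  exact: (eval_read (m := mem s) (eval_const (mem s) h1) h1 (leq_trans sV VD)).
- case/and4P=> we de jlt jb; have [ev dV] := IHe we.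
  have [loc1 _ _] := wf_address de jlt dV.
  have gV := bs j (den s e) jlt jb.
  split; last by rewrite /= expn1.
  have gV' : mem s (location j (den s e)) <= V ^ max_degree.
    by rewrite mem_location //; apply: leq_trans gV VD.
  have := eval_read (eval_address jlt de ev dV) loc1 gV'.
  by rewrite mem_location // => E; rewrite [compile _]/= E /= -addnA.
case/and3P=> w1 w2; have [v1 d1] := IH1 w1; have [v2 d2] := IH2 w2.
have d1' := leq_trans d1 (expV (wf_degree w1)).
have d2' := leq_trans d2 (expV (wf_degree w2)).
move=> de; suff d3 : arith_op o (den s e1) (den s e2) <= V ^ degree (Bin o e1 e2).
  by split=> //; apply: eval_arith => //; apply: leq_trans d3 (expV de).
case: o {de} => /=.
- rewrite expnS; set m := maxn _ _.
  have e1m : V ^ degree e1 <= V ^ m by apply: expV; rewrite leq_maxl.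
  have e2m : V ^ degree e2 <= V ^ m by apply: expV; rewrite leq_maxr.
  by have : 2 * V ^ m <= V * V ^ m; [rewrite leq_mul2r; lia|lia].
- by lia.
- by rewrite expnD leq_mul.
- by apply: leq_trans (leq_div _ _) d1.
Qed.

(** A total-correctness triple with time in units of [unit_time]; [bounded] is carried along as an
    implicit part of the pre- and postcondition. *)
Definition run (s : state) (c : cmd) (Q : state -> Prop) (T : nat) : Prop :=
  bounded s -> exists s' t, [/\ exec M (mem s) c (mem s') t, bounded s', Q s'
    & t <= unit_time * T].

Lemma run_le s c (Q Q' : state -> Prop) T T' :
  run s c Q T -> (forall s', bounded s' -> Q s' -> Q' s') -> T <= T' -> run s c Q' T'.
Proof.
move=> h q le bs; have [s' [t [ex bs' qs tT]]] := h bs.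
exists s', t; split=> //; first exact: q.
by apply: leq_trans tT _; rewrite leq_mul2l le orbT.
Qed.

Lemma run_leT s c (Q : state -> Prop) T T' : run s c Q T -> T <= T' -> run s c Q T'.
Proof. by move=> h le; apply: run_le h _ le. Qed.

Lemma run_bounded s c Q T : (bounded s -> run s c Q T) -> run s c Q T.
Proof. by move=> h bs; apply: h. Qed.

Lemma run_seq s c1 c2 Q T1 T2 :
  run s c1 (fun s' => run s' c2 Q T2) T1 -> run s (Seq c1 c2) Q (T1 + T2).
Proof.
move=> h bs; have [s' [t1 [ex1 bs' h2 le1]]] := h bs.
have [s'' [t2 [ex2 bs'' q le2]]] := h2 bs'.
exists s'', (t1 + t2); split=> //; first exact: ExecSeq ex1 ex2.
by rewrite mulnDr leq_add.
Qed.

Lemma run_skip s (Q : state -> Prop) : Q s -> run s Skip Q 1.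
Proof. by move=> q bs; exists s, 1; split=> //; exact: ExecSkip. Qed.

Definition wf_assign (j : nat) (i e : term) : bool :=
  [&& wf i, wf e, degree i + 2 <= max_degree, j < arrays, j != big_cell
    & duration i + duration e + 10 <= unit_time].

Lemma bounded_upd s j i x : bounded s -> x <= V -> bounded (upd s j i x).
Proof. by move=> bs xV j' i' h1 h2; rewrite /upd; case: ifP => // _; exact: bs. Qed.

Lemma run_assign s j i e (Q : state -> Prop) : wf_assign j i e -> den s e <= V ->
  Q (upd s j (den s i) (den s e)) -> run s (assign j i e) Q 1.
Proof.
move=> /and5P[wi we di jlt /andP[jb le]] eV q bs.
have [ev1 _] := eval_ok bs we; have [ev3 dV] := eval_ok bs wi.
have ev2 := eval_address jlt di ev3 dV; have [loc1 _ _] := wf_address di jlt dV.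
exists (upd s j (den s i) (den s e)), (duration i + 7 + duration e + 1); split=> //.
- rewrite -mem_upd //; apply: ExecWrite ev2 ev1 _ _; first exact: address_small.
  by apply: charge_small; apply: leq_trans eV _; have := @expV 1 max_degree isT; rewrite expn1.
- exact: bounded_upd.
- by move: le; rewrite /unit_time muln1; lia.
Qed.

Definition wf_test (e : term) : bool := wf e && (duration e < unit_time).

Lemma run_branch s e c1 c2 Q T : wf_test e ->
  (den s e <> 0 -> run s c1 Q T) -> (den s e = 0 -> run s c2 Q T) ->
  run s (branch e c1 c2) Q T.+1.
Proof.
move=> /andP[we le] h1 h2 bs; have [ev _] := eval_ok bs we.
have [s' [t [ex bs' q tT]]] : exists s' t,
    [/\ exec M (mem s) (if den s e != 0 then c1 else c2) (mem s') t, bounded s', Q s'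
      & t <= unit_time * T].
  by case: eqP => h /=; [exact: h2|exact: h1].
exists s', (duration e + 1 + t); split=> //; first exact: ExecIf ev ex.
by rewrite mulnS leq_add // addn1.
Qed.

Lemma wf_assign_reg r e : r < arrays -> r != big_cell -> wf e ->
  duration e + 11 <= unit_time -> wf_assign r (Cst 0) e.
Proof. by move=> h1 h2 h3 h4; apply/and5P; split=> //; apply/andP; split=> //=; lia. Qed.

(** Each round pays 2 for the test and the increment; the final 2 pays for the initialisation and
    the last test. The bound [e] is evaluated anew at every test, hence the condition that it
    remains [N]. *)
Lemma run_for s r e c (inv : nat -> state -> Prop) (N : nat) (T : nat -> nat) :
  r < arrays -> r != big_cell -> wf_test (Bin Defs.Sub e (reg r)) -> N <= V ->
  inv 0 (upd s r 0 0) ->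
  (forall k s', k <= N -> inv k s' -> s' r 0 = k -> den s' e = N) ->
  (forall k s', k < N -> inv k s' -> s' r 0 = k ->
     run s' c (fun s'' => s'' r 0 = k /\ inv k.+1 (upd s'' r 0 k.+1)) (T k)) ->
  run s (for_loop r e c) (inv N) (\sum_(k < N) (T k + 2) + 2).
Proof.
move=> r1 r2 wt NV i0 en body; rewrite addnC -[2]/(1 + 1) -addnA; apply: run_seq.
apply: run_assign => //; first exact: wf_assign_reg.
rewrite /=; move: i0; set s0 := upd _ _ _ _ => i0.
have r0 : s0 r 0 = 0 by rewrite /s0 /upd !eqxx.
suff H m k s1 : k + m = N -> inv k s1 -> s1 r 0 = k ->
    run s1 (While (compile (Bin Defs.Sub e (reg r)))
             (Seq c (assign r (Cst 0) (Bin Add (reg r) (Cst 1)))))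
      (inv N) (1 + \sum_(i < m) (T (k + i) + 2)).
  exact: (H N 0 s0 erefl i0 r0).
elim: m k s1 => [|m IHm] k s1 km ik rk bs.
  have [ev _] := eval_ok bs (andP wt).1.
  have e0 : den s1 (Bin Defs.Sub e (reg r)) = 0.
    by rewrite /= rk (en k) //; lia.
  rewrite e0 in ev; exists s1, (duration (Bin Defs.Sub e (reg r)) + 1); split=> //.
  - exact: ExecWhileStop.
  - by move: ik; rewrite -km addn0.
  - by rewrite big_ord0 addn0 muln1 addn1; case/andP: wt.
have [ev _] := eval_ok bs (andP wt).1.
have e0 : den s1 (Bin Defs.Sub e (reg r)) != 0.
  by rewrite /= rk (en k) //; lia.
have kN : k < N by lia.
have [s2 [t2 [ex2 bs2 [r2k i2] le2]]] := body k s1 kN ik rk bs.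
have [s3 [t3 [ex3 bs3 q3 le3]]] : exists s3 t3, [/\
    exec M (mem s2) (assign r (Cst 0) (Bin Add (reg r) (Cst 1))) (mem s3) t3, bounded s3,
    s3 = upd s2 r 0 k.+1 & t3 <= unit_time * 1].
  apply: (run_assign (s := s2) (Q := fun s3 => s3 = upd s2 r 0 k.+1)) => //.
  - by apply: wf_assign_reg => //=; rewrite r1 r2.
  - by rewrite /= r2k; lia.
  - by rewrite /= r2k addn1.
subst s3; have rk3 : upd s2 r 0 k.+1 r 0 = k.+1 by rewrite /upd !eqxx.
have [|s4 [t4 [ex4 bs4 q4 le4]]] := IHm k.+1 _ _ i2 rk3 bs3; first by lia.
exists s4, (duration (Bin Defs.Sub e (reg r)) + 1 + (t2 + t3) + t4); split=> //.
  by apply: ExecWhileStep ev e0 _ ex4; exact: ExecSeq ex2 ex3.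
have du : duration (Bin Defs.Sub e (reg r)) + 1 <= unit_time * 1.
  by rewrite muln1 addn1; case/andP: wt.
rewrite big_ord_recl addn0.
rewrite (eq_bigr (fun i : 'I_m => T (k.+1 + i) + 2)); last first.
  by move=> i _; rewrite lift0 addSnnS.
move: le4; set S := \sum_(i < m) _ => le4.
rewrite (_ : 1 + (T k + 2 + S) = 1 + (T k + 1) + (1 + S)); last by lia.
by rewrite mulnDr leq_add // mulnDr leq_add // mulnDr leq_add.
Qed.

Lemma run_for_const s r e c (inv : nat -> state -> Prop) (N T : nat) :
  r < arrays -> r != big_cell -> wf_test (Bin Defs.Sub e (reg r)) -> N <= V ->
  inv 0 (upd s r 0 0) ->
  (forall k s', k <= N -> inv k s' -> s' r 0 = k -> den s' e = N) ->
  (forall k s', k < N -> inv k s' -> s' r 0 = k ->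
     run s' c (fun s'' => s'' r 0 = k /\ inv k.+1 (upd s'' r 0 k.+1)) T) ->
  run s (for_loop r e c) (inv N) (N * (T + 2) + 2).
Proof.
move=> r1 r2 wt NV i0 en body.
have h := run_for (T := fun=> T) r1 r2 wt NV i0 en body.
by rewrite sum_nat_const card_ord in h.
Qed.

Lemma run_assign_seq s j i e c Q T : wf_assign j i e -> den s e <= V ->
  run (upd s j (den s i) (den s e)) c Q T -> run s (Seq (assign j i e) c) Q T.+1.
Proof. by move=> w le h; rewrite -add1n; apply: run_seq; exact: run_assign. Qed.

End Semantics.

Notation "# r" := (reg r) (at level 0, r at level 0) : ram_scope.
Notation "a .@ i" := (Get a i) (at level 2, i at level 0, format "a .@ i") : ram_scope.
Notation "r <- e" := (assign r (Cst 0) e) (at level 70).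
Notation "c1 ;; c2" := (Seq c1 c2) (at level 80, right associativity).
Notation "'for' r '<<' e 'do' c 'od'" := (for_loop r e c)
  (at level 75, r at level 0, e at level 60, c at level 90).

Definition frame (L : seq nat) (s s' : state) : Prop :=
  forall j, j \notin L -> s' j =1 s j.

Lemma frame_refl L s : frame L s s. Proof. by []. Qed.

Lemma upd_ne s j i x j' i' : j' != j -> upd s j i x j' i' = s j' i'.
Proof. by rewrite /upd => /negbTE ->. Qed.

Lemma upd_other s j i x j' : j' != j -> upd s j i x j' = s j'.
Proof. by move=> ne; apply/funext => i'; exact: upd_ne. Qed.

Lemma frame_upd L s s' j i x : frame L s s' -> j \in L -> frame L s (upd s' j i x).
Proof.
move=> fr jL j' j'L i'; rewrite /upd; case: eqP => [e|_]; last exact: fr.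
by rewrite e jL in j'L.
Qed.

Lemma frame_trans L s s1 s2 : frame L s s1 -> frame L s1 s2 -> frame L s s2.
Proof. by move=> f1 f2 j jL i; rewrite f2 ?f1. Qed.

Lemma frame_sub L L' s s' : all (fun j => j \in L') L -> frame L s s' -> frame L' s s'.
Proof. by move=> /allP sub f j jL; apply: f; apply: contra jL => /sub. Qed.

Notation rLev := 0 (only parsing).
Notation rBlk := 1 (only parsing).
Notation rPos := 2 (only parsing).
Notation rCnt := 3 (only parsing).
Notation rLen := 4 (only parsing).
Notation rSize := 11 (only parsing).
Notation rLog := 12 (only parsing).
Notation aX := 28 (only parsing).
Notation aY := 29 (only parsing).
Notation aZ := 30 (only parsing).

(** * The program and its verification *)

(** At level [l], [rCnt] holds [3^l] and [rLen] half of the current block length. *)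
Definition eval_prog : cmd :=
  rCnt <- 1 ;; rLen <- #rSize / 2 ;;
  for rLev << #rLog do
    for rBlk << #rCnt do
      for rPos << #rLen do
        assign aX ((2 * #rCnt + #rBlk) * #rLen + #rPos)
          (aX.@(2 * #rBlk * #rLen + #rPos) + aX.@((2 * #rBlk + 1) * #rLen + #rPos))
      od
    od ;;
    rCnt <- #rCnt * 3 ;; rLen <- #rLen / 2
  od.

Ltac asg :=
  match goal with ok : ram_spec _ _ _ _ _ |- _ =>
    eapply (run_assign_seq ok); [by []|rewrite /upd /=|rewrite /=]
  end.

Ltac loop I N T :=
  match goal with ok : ram_spec _ _ _ _ _ |- _ =>
    eapply run_le; [apply: (run_for ok (inv := I) (N := N) (T := T)); [by []|by []|by []|..]|..]
  end.

Ltac loop_const I N T :=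
  match goal with ok : ram_spec _ _ _ _ _ |- _ =>
    eapply run_le;
      [apply: (run_for_const ok (inv := I) (N := N) (T := T)); [by []|by []|by []|..]|..]
  end.

(** * Karatsuba as a program *)

Section Programs.

Variables (n sigma : nat) (ws : seq nat) (M : machine) (V : nat).
Hypothesis ok : ram_spec n sigma ws M V.

Notation run := (run n sigma ws M V).
Notation bounded := (bounded V).

Definition filled (L : seq nat) (a : nat) (pos val : nat -> nat) (k : nat) (s s' : state) : Prop :=
  [/\ frame L s s', forall j, j < k -> s' a (pos j) = val j
    & forall p, (forall j, j < k -> p <> pos j) -> s' a p = s a p].

Lemma run_fill s r a e i x N (pos val : nat -> nat) :
  r != a -> r < arrays -> r != big_cell -> wf_test (Bin Defs.Sub e (reg r)) ->
  wf_assign a i x -> N <= V ->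
  (forall j k, j < N -> k < N -> pos j = pos k -> j = k) ->
  (forall k s', k <= N -> filled [:: r; a] a pos val k s s' -> s' r 0 = k -> den n sigma s' e = N) ->
  (forall k s', k < N -> filled [:: r; a] a pos val k s s' -> s' r 0 = k -> bounded s' ->
     [/\ den n sigma s' i = pos k, den n sigma s' x = val k & val k <= V]) ->
  run s (for_loop r e (assign a i x)) (filled [:: r; a] a pos val N s) (N * 3 + 2).
Proof.
move=> ra r1 r2 we wa NV inj he hb.
have rin : r \in [:: r; a] by rewrite inE eqxx.
have ain : a \in [:: r; a] by rewrite !inE eqxx orbT.
have updr k s' y : filled [:: r; a] a pos val k s s' -> filled [:: r; a] a pos val k s (upd s' r 0 y).
  move=> [h1 h2 h3]; split; first exact: frame_upd.
    by move=> j /h2; rewrite /upd eq_sym (negbTE ra).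
  by move=> p /h3; rewrite /upd eq_sym (negbTE ra).
apply: (run_for_const ok (T := 1) (inv := fun k => filled [:: r; a] a pos val k s)) => //.
  by apply: updr; split.
move=> k s' kN fk rk; apply: run_bounded => bs.
have [e1 e2 vV] := hb k s' kN fk rk bs.
apply: (run_assign ok) => //; first by rewrite e2.
rewrite e1 e2; split; first by rewrite /upd (negbTE ra).
apply: updr; case: fk => h1 h2 h3; split; first exact: frame_upd.
  move=> j; rewrite /upd eqxx /= ltnS leq_eqVlt => /orP[/eqP ->|jk]; first by rewrite eqxx.
  case: eqP => [epos|_]; last exact: h2.
  by have := inj j k (ltn_trans jk kN) kN epos; lia.
move=> p np; rewrite /upd eqxx /=; case: eqP => [ep|_].
  by case: (np k (leqnn _)).
by apply: h3 => j jk; apply: np; apply: ltnW.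
Qed.

(** Level [l] appends [3^l] sums of length [2^(S - l - 1)] to the initial [2^S] cells, and the array
    ends with [3^S] cells: the evaluation is linear in its output. *)
Lemma sum_levels S : \sum_(l < S) 3 ^ l * 2 ^ (S - l.+1) + 2 ^ S = 3 ^ S.
Proof.
elim: S => [|S IHS]; first by rewrite big_ord0.
rewrite big_ord_recr /= subnn muln1.
rewrite (eq_bigr (fun l : 'I_S => 2 * (3 ^ l * 2 ^ (S - l.+1)))).
  by rewrite -big_distrr /= (expnS 2 S) (expnS 3 S) -IHS; ring.
by move=> [l lS] _ /=; rewrite mulnCA -expnS; congr (_ * 2 ^ _); lia.
Qed.

Lemma eval_prog_run s S (g : nat -> nat) :
  s rSize 0 = 2 ^ S -> s rLog 0 = S -> 3 ^ S <= V ->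
  (forall k, k < 2 ^ S -> s aX k = g k) ->
  (forall l k, l <= S -> kara_eval S g l k <= V) ->
  run s eval_prog
    (fun s' => [/\ forall k, k < 3 ^ S -> s' aX k = kara_eval S g S k, s' rCnt 0 = 3 ^ S
     & frame [:: 0; 1; 2; 3; 4; aX] s s']) (20 * 3 ^ S).
Proof.
move=> sz lg SV ag gV; apply: run_bounded => bs.
have V64 := ram_min ok.
have p2 : 0 < 2 ^ S by rewrite expn_gt0.
have p23 : 2 ^ S <= 3 ^ S by rewrite -sum_levels leq_addl.
have SS : S < 2 ^ S by apply: ltn_expl.
pose h l := 2 ^ (S - l.+1).
pose inv l (s' : state) := [/\ frame [:: 0; 1; 2; 3; 4; aX] s s', s' 3 0 = 3 ^ l,
  s' 4 0 = 2 ^ (S - l) %/ 2 & forall k, k < 3 ^ l * 2 ^ (S - l) -> s' aX k = kara_eval S g l k].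
eapply run_leT; rewrite /eval_prog.
  asg; first by lia.
  asg; first by rewrite sz; lia.
  loop inv S (fun l => 3 ^ l * h l * 7 + 4).
  - lia.
  - split=> //.
    + by do !apply: frame_upd => //.
    + by rewrite /upd /= subn0 sz.
    + by move=> k; rewrite mul1n subn0 => /ag.
  - by move=> k s' kS [fr _ _ _] _ /=; rewrite fr.
  - move=> l s1 lS [fr e3 e4 eX] r0; apply: run_bounded => bs1.
    have {}e4 : s1 4 0 = h l by rewrite e4 /h (_ : S - l = (S - l.+1).+1) ?expnS ?mulKn //; lia.
    have e2 : 2 ^ (S - l) = 2 * h l by rewrite /h -expnS; congr (2 ^ _); lia.
    have h0 : 0 < h l by rewrite expn_gt0.
    rewrite e2 in eX; set B := 3 ^ l in e3 eX *.
    have tot : 3 * B * h l <= 3 ^ S.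
      have : 3 ^ l.+1 * h l <= 3 ^ l.+1 * 3 ^ (S - l.+1).
        by rewrite leq_mul2l -(sum_levels (S - l.+1)) leq_addl orbT.
      by rewrite -expnD subnKC // expnS.
    (* The first [2 * B] half blocks are in place from the start; [b] of the sums have been
       appended. *)
    pose inv2 b (s' : state) := frame [:: 1; 2; aX] s1 s' /\
      forall k, k < (2 * B + b) * h l -> s' aX k = kara_eval S g l.+1 k.
    eapply run_leT; first apply: run_seq.
    + loop inv2 B (fun b : nat => h l * 3 + 2).
      * by nia.
      * split; first by apply: frame_upd.
        move=> k; rewrite addn0 => kB; rewrite /upd /= eX; last by lia.
        by rewrite -/B -/(h l) kB.
      * by move=> k s' _ [fr' _] _ /=; rewrite fr' ?e3.
      * move=> b s2 bB [fr2 e] r1; apply: run_bounded => bs2.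
        have [f3 f4] : s2 3 0 = B /\ s2 4 0 = h l by rewrite !fr2 ?e3 ?e4.
        eapply run_le; [apply: (run_fill (N := h l)
          (pos := fun j => (2 * B + b) * h l + j)
          (val := fun j => kara_eval S g l.+1 ((2 * B + b) * h l + j)))|..] => //.
        -- by nia.
        -- by move=> j k _ _; apply: addnI.
        -- by move=> k s' _ [fr' _ _] _ /=; rewrite fr' ?f4.
        -- move=> j s' jh [fr' hj hp] r2 bs' /=; rewrite !(fr' 3 isT) !(fr' 4 isT) !(fr' 1 isT) f3 f4 r1 r2; split=> //.
             rewrite !hp; try by move=> j' jj'; nia.
             rewrite !e; try by nia.
             rewrite /= -/B -/(h l).
             rewrite (_ : _ < _ = true); last by nia.
             rewrite (_ : _ < _ = true); last by nia.
             rewrite (_ : _ < _ = false); last by nia.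
             rewrite (_ : (2 * B + b) * h l + j - 2 * B * h l = b * h l + j); last by nia.
             by rewrite divnMDl // divn_small // addn0 modnMDl modn_small.
           exact: (gV l.+1 _ lS).
        -- move=> s' _ [fr' hj hp]; split; first by rewrite fr'.
           split; first by apply: frame_upd => //; apply: (frame_trans fr2); apply: frame_sub fr'.
           move=> k kb; rewrite /upd /=.
           case: (ltnP k ((2 * B + b) * h l)) => kk; last first.
             by rewrite -(subnKC kk) hj //; nia.
           by rewrite hp ?e // => j _; nia.
      * move=> s2 bs2 [fr2 e].
        asg; first by rewrite fr2 // e3; nia.
        apply: (run_assign ok) => //.
          by rewrite /= /upd /= fr2 // e4; nia.
        rewrite /= /upd /=; split; first by rewrite fr2.
        split.
        -- do 3 (apply: frame_upd => //).
           by apply: (frame_trans fr); apply: frame_sub fr2.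
        -- by rewrite /upd /= fr2 // e3 mulnC -expnS.
        -- by rewrite /upd /= fr2 // e4 /h.
        -- move=> k kl; rewrite /upd /= e //.
           move: kl; rewrite -/(h l) expnS -/B; nia.
      * exact: leqnn.
    + rewrite sum_nat_const card_ord; nia.
  - move=> s' _ [fr e3 _ e]; split; [|exact: e3|exact: fr].
    by move=> k kS; apply: e; rewrite subnn muln1.
  - exact: leqnn.
rewrite big_split /= sum_nat_const card_ord big_split sum_nat_const card_ord /= -big_distrl /=.
have E : \sum_(l < S) 3 ^ l * h l + 2 ^ S = 3 ^ S := sum_levels S.
by move: E; move: (\sum_(l < S) 3 ^ l * h l) => A E; lia.
Qed.

(** Two passes per block: the middle terms first overwrite the product of the sums, because adding
    them at once would alter the low and high products that later differences still need. *)
Definition interp_prog : cmd :=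
  rLen <- 1 ;;
  for rLev << #rLog do
    rCnt <- #rCnt / 3 ;;
    for rBlk << #rCnt do
      for rPos << 2 * #rLen do
        assign aZ (4 * #rCnt * #rLen + 2 * #rBlk * #rLen + #rPos)
          (aZ.@(4 * #rCnt * #rLen + 2 * #rBlk * #rLen + #rPos) -
           (aZ.@(4 * #rBlk * #rLen + #rPos) + aZ.@(4 * #rBlk * #rLen + 2 * #rLen + #rPos)))
      od ;;
      for rPos << 2 * #rLen do
        assign aZ (4 * #rBlk * #rLen + #rLen + #rPos)
          (aZ.@(4 * #rBlk * #rLen + #rLen + #rPos) +
           aZ.@(4 * #rCnt * #rLen + 2 * #rBlk * #rLen + #rPos))
      od
    od ;;
    rLen <- 2 * #rLen
  od.

Lemma sum_levels_rev S : \sum_(m < S) 3 ^ (S - m.+1) * 2 ^ m + 2 ^ S = 3 ^ S.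
Proof.
rewrite -[RHS]sum_levels; congr addn; rewrite [RHS](reindex_inj rev_ord_inj) /=.
by apply: eq_bigr => -[m mS] _ /=; congr (_ * 2 ^ _); lia.
Qed.

Lemma interp_prog_run s S (z : nat -> nat) :
  s rCnt 0 = 3 ^ S -> s rLog 0 = S -> 4 * 3 ^ S <= V ->
  (forall k, k < 2 * 3 ^ S -> s aZ k = z k) ->
  (forall m k, m <= S -> kara_interp S z m k <= V) ->
  run s interp_prog
    (fun s' => (forall k, k < 2 * 2 ^ S -> s' aZ k = kara_interp S z S k) /\
       frame [:: 0; 1; 2; 3; 4; aZ] s s') (40 * 3 ^ S).
Proof.
move=> cn lg SV az gV; apply: run_bounded => bs.
have V64 := ram_min ok.
have p2 : 0 < 2 ^ S by rewrite expn_gt0.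
have p23 : 2 ^ S <= 3 ^ S by rewrite -sum_levels leq_addl.
have SS : S < 2 ^ S by apply: ltn_expl.
pose inv m (s' : state) := [/\ frame [:: 0; 1; 2; 3; 4; aZ] s s', s' 3 0 = 3 ^ (S - m),
  s' 4 0 = 2 ^ m & forall k, k < 2 * 3 ^ (S - m) * 2 ^ m -> s' aZ k = kara_interp S z m k].
eapply run_leT; rewrite /interp_prog.
  asg; first by lia.
  loop inv S (fun m => 3 ^ (S - m.+1) * 2 ^ m * 18 + 5).
  - lia.
  - split=> //.
    + by do !apply: frame_upd => //.
    + by rewrite /upd /= subn0.
    + by move=> k; rewrite subn0 muln1 => /az.
  - by move=> k s' kS [fr _ _ _] _ /=; rewrite fr.
  - move=> m s1 mS [fr e3 e4 eX] r0; apply: run_bounded => bs1.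
    have eB : 3 ^ (S - m) = 3 * 3 ^ (S - m.+1) by rewrite -expnS; congr (3 ^ _); lia.
    have H0 : 0 < 2 ^ m by rewrite expn_gt0.
    rewrite eB in e3 eX; set B := 3 ^ (S - m.+1) in e3 eX *; set H := 2 ^ m in e4 eX H0 *.
    have tot : 3 * B * H <= 3 ^ S.
      rewrite -eB; apply: leq_trans (_ : 3 ^ (S - m) * 3 ^ m <= _).
        by rewrite leq_mul2l -(sum_levels m) leq_addl orbT.
      by rewrite -expnD subnK // ltnW.
    have tot' : B * H <= 3 ^ S by nia.
    eapply run_leT.
      asg; first by rewrite e3 mulKn //; nia.
      set s1' := upd _ _ _ _.
      (* Blocks below [b] have reached level [m.+1]; from [b] on, both the blocks and their products
         of sums are still at level [m]. *)
      pose inv2 b (s' : state) := [/\ frame [:: 1; 2; aZ] s1' s',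
        forall k, k < 4 * b * H -> s' aZ k = kara_interp S z m.+1 k,
        forall k, 4 * b * H <= k -> k < 4 * B * H -> s' aZ k = kara_interp S z m k
      & forall k, 4 * B * H + 2 * b * H <= k -> k < 6 * B * H -> s' aZ k = kara_interp S z m k].
      apply: run_seq; loop inv2 B (fun b : nat => 2 * H * 3 + 2 + (2 * H * 3 + 2)).
      * by nia.
      * split.
        -- by apply: frame_upd.
        -- by move=> k; rewrite muln0 mul0n.
        -- by move=> k _ kB; rewrite /s1' /upd /= eX //; nia.
        -- by move=> k _ kB; rewrite /s1' /upd /= eX //; nia.
      * by move=> k s' _ [fr' _ _ _] _ /=; rewrite fr' // /s1' /upd /= e3 mulKn.
      * move=> b s2 bB [fr2 e5 e6 e7] r1; apply: run_bounded => bs2.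
        have f3 : s2 3 0 = B by rewrite fr2 // /s1' /upd /= e3 mulKn.
        have f4 : s2 4 0 = H by rewrite fr2 // /s1' /upd /= e4.
        pose mid j := kara_interp S z m (4 * B * H + 2 * b * H + j) -
          (kara_interp S z m (4 * b * H + j) + kara_interp S z m (4 * b * H + 2 * H + j)).
        have kstep j : j < 4 * H -> kara_interp S z m.+1 (4 * b * H + j) =
            kara_interp S z m (4 * b * H + j) +
            (if (H <= j) && (j < 3 * H) then mid (j - H) else 0).
          move=> jH; rewrite /= -/B -/H.
          have -> : (4 * b * H + j) %/ (4 * H) = b.
            by rewrite (_ : 4 * b * H = b * (4 * H)) ?divnMDl ?divn_small ?addn0 //; lia.
          have -> // : (4 * b * H + j) %% (4 * H) = j.
          by rewrite (_ : 4 * b * H = b * (4 * H)) ?modnMDl ?modn_small //; lia.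
        have kmid j : j < 2 * H -> kara_interp S z m.+1 (4 * b * H + H + j) =
            kara_interp S z m (4 * b * H + H + j) + mid j.
          move=> jH; rewrite -addnA kstep; last by lia.
          by rewrite leq_addr (_ : H + j < 3 * H) ?addKn //; lia.
        apply: run_seq; eapply run_le; [apply: (run_fill (N := 2 * H)
          (pos := fun j => 4 * B * H + 2 * b * H + j) (val := mid))|..] => //.
        -- by nia.
        -- by move=> j k _ _; apply: addnI.
        -- by move=> k s' _ [fr' _ _] _ /=; rewrite fr' ?f4.
        -- move=> j s' jh [fr' hj hp] r2 bs' /=.
           rewrite !(fr' 3 isT) !(fr' 4 isT) !(fr' 1 isT) f3 f4 r1 r2; split=> //.
             rewrite !hp; try by move=> j' jj'; nia.
             by rewrite e7 ?e6 ?[s2 _ (_ + 2 * H + _)]e6 //; nia.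
           by apply: leq_trans (leq_subr _ _) (gV _ _ (ltnW mS)).
        -- move=> s3 bs3 [fr3 hj hp].
           have g1 : s3 1 0 = b by rewrite fr3.
           have g3 : s3 3 0 = B by rewrite fr3.
           have g4 : s3 4 0 = H by rewrite fr3.
           eapply run_le; [apply: (run_fill (N := 2 * H)
             (pos := fun j => 4 * b * H + H + j)
             (val := fun j => kara_interp S z m (4 * b * H + H + j) + mid j))|..] => //.
           ++ by nia.
           ++ by move=> j k _ _; apply: addnI.
           ++ by move=> k s' _ [fr' _ _] _ /=; rewrite fr' ?g4.
           ++ move=> j s' jh [fr' hj' hp'] r2 bs' /=.
              rewrite !(fr' 3 isT) !(fr' 4 isT) !(fr' 1 isT) g3 g4 g1 r2; split=> //.
                rewrite !hp'; try by move=> j' jj'; nia.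
                rewrite hj // hp; last by move=> j' jj'; nia.
                by rewrite e6 //; nia.
              by rewrite -kmid // gV.
           ++ move=> s' _ [fr' hj' hp']; split; first by rewrite fr'.
              split.
              ** apply: frame_upd => //; apply: (frame_trans fr2).
                 apply: (frame_trans (frame_sub _ fr3)); first by [].
                 by apply: frame_sub fr'.
              ** move=> k kb; rewrite upd_ne //.
                 case: (ltnP k (4 * b * H)) => kb'.
                   rewrite hp'; last by move=> j _; nia.
                   by rewrite hp ?e5 // => j _; nia.
                 rewrite -(subnKC kb') kstep; last by nia.
                 set j := k - 4 * b * H; case: ifP => hjj.
                   rewrite (_ : 4 * b * H + j = 4 * b * H + H + (j - H)); last by lia.
                   by rewrite hj' //; lia.
                 have jH : j < 4 * H by rewrite /j; nia.
                 rewrite addn0 hp'; last by move=> j' jj'; lia.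
                 rewrite hp; last by move=> j' jj'; nia.
                 by rewrite e6 //; nia.
              ** move=> k kb kB; rewrite upd_ne // hp'; last by move=> j' jj'; nia.
                 by rewrite hp ?e6 //; [nia|move=> j' jj'; nia].
              ** move=> k kb kB; rewrite upd_ne // hp'; last by move=> j' jj'; nia.
                 by rewrite hp ?e7 //; [nia|move=> j' jj'; nia].
      * move=> s2 bs2 [fr2 e5 e6 e7].
        have f4 : s2 4 0 = H by rewrite fr2 // /s1' /upd /= e4.
        apply: (run_assign ok) => //; first by rewrite /= f4; nia.
        rewrite /=; split; first by rewrite upd_ne // fr2.
        split.
        -- do 2 (apply: frame_upd => //).
           apply: (frame_trans fr); apply: (@frame_trans _ _ s1').
             by apply: frame_upd.
           by apply: frame_sub fr2.
        -- by rewrite /upd /= fr2 // /s1' /upd /= e3 mulKn.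
        -- by rewrite /upd /= f4 expnS.
        -- by move=> k kl; rewrite !upd_ne // e5 //; move: kl; rewrite -/B expnS -/H; nia.
      * exact: leqnn.
    rewrite sum_nat_const card_ord; nia.
  - move=> s' _ [fr e3 _ e]; split; [|exact: fr].
    by move=> k kS; apply: e; rewrite subnn muln1.
  - exact: leqnn.
rewrite big_split /= sum_nat_const card_ord big_split sum_nat_const card_ord /= -big_distrl /=.
by have := sum_levels_rev S; move: (\sum_(m < S) _) => A E; lia.
Qed.

End Programs.

Notation rEnt := 5 (only parsing).
Notation rCy := 7 (only parsing).
Notation rAcc := 8 (only parsing).
Notation rDeg := 9 (only parsing).
Notation rLimb := 10 (only parsing).
Notation rBeta := 13 (only parsing).
Notation rTmp := 24 (only parsing).
Notation aA := 31 (only parsing).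
Notation aQ := 32 (only parsing).

Definition carry_loop (N x : term) (a : nat) (i : term) : cmd :=
  for rPos << N do
    rAcc <- x + #rCy ;;
    assign a i (#rAcc - #rBeta * (#rAcc / #rBeta)) ;;
    rCy <- #rAcc / #rBeta
  od.

(** Entry [e = 2 a + s] goes to slot [4 a + s], which is [e + 2 * (e / 2)]. The term [idx] lets the
    entries be read in another order, as [Q(-z)] requires. *)
Definition load_prog (src : nat) (idx : term) : cmd :=
  for rPos << #rSize do assign aX #rPos 0 od ;;
  for rEnt << 2 * (#rDeg + 1) do
    rTmp <- idx ;;
    for rPos << #rLimb do
      assign aX ((#rEnt + 2 * (#rEnt / 2)) * (2 * #rLimb) + #rPos)
        src.@(#rTmp * #rLimb + #rPos)
    od
  od.

Definition source (L : nat) (phi f : nat -> nat) (k : nat) : nat :=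
  f (phi (k %/ L) * L + k %% L).

Lemma entry_source beta L phi f e : entry beta L (source L phi f) e = entry beta L f (phi e).
Proof.
apply: limbs_ext => l lL; rewrite /source.
have L0 : 0 < L by apply: leq_ltn_trans lL.
by rewrite divnMDl // divn_small // addn0 modnMDl modn_small.
Qed.

(** The first index term is [alt_entry], with the remainder expressed by division. [rTmp] is the
    start of slot [4 * (2 * (e / 2) + par) + e mod 2]. Everything is read before [dst] is written,
    so [dst] may be [src] or [aQ]. *)
Definition mul_prog (dst src : nat) (par : term) : cmd :=
  load_prog aQ (#rEnt + #rEnt / 2 - 2 * ((#rEnt - #rEnt / 2) / 2)) ;;
  eval_prog ;;
  for rPos << #rCnt do assign aY #rPos aX.@(#rPos) od ;;
  load_prog src #rEnt ;;
  eval_prog ;;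
  for rPos << #rCnt do assign aZ (2 * #rPos) (aX.@(#rPos) * aY.@(#rPos)) od ;;
  for rPos << #rCnt do assign aZ (2 * #rPos + 1) 0 od ;;
  interp_prog ;;
  for rEnt << 2 * (#rDeg / 2 + 1) do
    rTmp <- (#rEnt + 6 * (#rEnt / 2) + 4 * par) * (2 * #rLimb) ;;
    rCy <- 0 ;;
    carry_loop (2 * #rLimb) (aZ.@(#rTmp + #rPos) + aZ.@(#rTmp + 4 * #rLimb + #rPos))
      dst (#rEnt * (2 * #rLimb) + #rPos)
  od.

(** * Multiplication of signed multi-limb sequences *)

Section Programs.

Variables (n sigma : nat) (ws : seq nat) (M : machine) (V : nat).
Hypothesis ok : ram_spec n sigma ws M V.

Notation run := (run n sigma ws M V).
Notation bounded := (bounded V).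
Notation den := (den n sigma).

Lemma run_carry s N x a i K (pos t : nat -> nat) beta c0 T :
  a \notin [:: 2; 7; 8; 13] -> a < arrays -> a != big_cell ->
  wf_test (Bin Defs.Sub N (reg rPos)) -> wf_assign rAcc (Cst 0) (x + #rCy) ->
  wf_assign a i (#rAcc - #rBeta * (#rAcc / #rBeta)) ->
  s rBeta 0 = beta -> 1 < beta -> s rCy 0 = c0 -> c0 <= T -> (forall l, l < K -> t l <= T) ->
  2 * T <= V -> K <= V ->
  (forall j k, j < K -> k < K -> pos j = pos k -> j = k) ->
  let F := filled [:: 2; 7; 8; a] a pos (digit beta t c0) in
  (forall k s', k <= K -> F k s s' -> s' rPos 0 = k -> den s' N = K) ->
  (forall k s', k < K -> F k s s' -> s' rPos 0 = k -> den s' i = pos k /\ den s' x = t k) ->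
  run s (carry_loop N x a i) (F K s) (K * 5 + 2).
Proof.
rewrite !inE !negb_or => /and4P[a2 a7 a8 a13] aJ ab wN wx wa sb b1 sc cT tT TV KV inj F hN hx.
have V64 := ram_min ok.
have cy k : k <= K -> carry beta t c0 k <= T.
  by move=> kK; apply: carry_le => // l lk; apply: tT; lia.
have updr r k s' y : r \in [:: 2; 7; 8] -> F k s s' -> F k s (upd s' r 0 y).
  move=> rL [h1 h2 h3].
  have ne : a != r.
    by move: rL; rewrite !inE => /or3P[] /eqP ->.
  split; first by apply: frame_upd => //; move: rL; rewrite !inE => /or3P[] ->; rewrite ?orbT.
    by move=> j /h2; rewrite upd_ne.
  by move=> p /h3; rewrite upd_ne.
pose inv k s' := F k s s' /\ s' rCy 0 = carry beta t c0 k.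
eapply run_le.
- apply: (run_for_const ok (T := 3) (inv := inv) (N := K)) => //.
  + split; last by rewrite upd_ne.
    by apply: updr => //; split.
  + by move=> k s' kK [h _]; exact: hN h.
  + move=> k s1 kK [h e7] e2; apply: run_bounded => bs1.
    have [ei ex] := hx k s1 kK h e2.
    have sb1 : s1 13 0 = beta.
      by case: h => fr _ _; rewrite fr // !inE /= eq_sym.
    have ck := cy k (ltnW kK); have tk := tT k kK.
    apply: (run_assign_seq ok) => //=; first by rewrite ex e7; lia.
    rewrite ex e7; set s2 := upd s1 _ _ _.
    have h2 : F k s s2 by exact: updr.
    have [ei2 _] := hx k s2 kK h2 e2.
    have sb2 : s2 13 0 = beta by rewrite /s2 upd_ne.
    have s28 : s2 8 0 = t k + carry beta t c0 k by [].
    have dE : t k + carry beta t c0 k - beta * ((t k + carry beta t c0 k) %/ beta) = digit beta t c0 k.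
      by rewrite /digit {1}(divn_eq (t k + _) beta) mulnC addKn.
    have dV : digit beta t c0 k <= t k + carry beta t c0 k by exact: leq_mod.
    apply: (run_assign_seq ok) => //=; rewrite ?ei2 ?sb2 ?s28 ?dE; first by lia.
    have dvV : (t k + carry beta t c0 k) %/ beta <= V.
      by apply: leq_trans (leq_div _ _) _; lia.
    apply: (run_assign ok) => //=; rewrite ?(upd_ne, s28, sb2) //= ?(eq_sym _ a) //.
    split; first by [].
    split; last by [].
    do 2 apply/updr => //.
    case: h2 => f1 f2 f3; split.
    * by apply: frame_upd => //; rewrite !inE eqxx ?orbT.
    * move=> j; rewrite /upd eqxx /= ltnS leq_eqVlt => /orP[/eqP ->|jk]; first by rewrite eqxx.
      case: eqP => [epos|_]; last exact: f2.
      by have := inj j k (ltn_trans jk kK) kK epos; lia.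
    * move=> p np; rewrite /upd eqxx /=; case: eqP => [ep|_].
        by case: (np k (leqnn _)).
      by apply: f3 => j jk; apply: np; apply: ltnW.
- by move=> s' _ [].
- by [].
Qed.

Lemma load_prog_run s src idx phi S m L :
  src \in [:: aA; aQ] -> wf_assign rTmp (Cst 0) idx ->
  s rSize 0 = 2 ^ S -> s rDeg 0 = m -> s rLimb 0 = L -> 0 < L ->
  8 * m.+1 * L <= 2 ^ S -> 2 ^ S <= V ->
  (forall s', s' rDeg 0 = m -> forall e, e < 2 * m.+1 -> s' rEnt 0 = e ->
     den s' idx = phi e /\ phi e < 2 * m.+1) ->
  run s (load_prog src idx)
    (fun s' => (forall k, k < 2 ^ S -> s' aX k = layout m L (source L phi (s src)) k) /\
       frame [:: 2; 5; 24; aX] s s') (12 * 2 ^ S).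
Proof.
move=> srcE wi sz dg lb L0 fit SV hi; apply: run_bounded => bs.
have V64 := ram_min ok.
have srcX : src \notin [:: 2; 5; 24; aX] by move: srcE; rewrite !inE => /orP[] /eqP ->.
have mL : 8 * m.+1 <= 2 ^ S by nia.
eapply run_leT; rewrite /load_prog.
  apply: run_seq; eapply run_le; [apply: (run_fill ok (N := 2 ^ S) (pos := id) (val := fun=> 0))|..];
    try by [].
  - by move=> k s' _ [fr _ _] _ /=; rewrite fr.
  - move=> s1 bs1 [fr1 z1 _].
    pose F := source L phi (s src).
    (* The layout restricted to its first [e] entries. *)
    pose lay e k := if [&& k %% (2 * L) < L, k %/ (2 * L) %% 4 < 2 &
       2 * (k %/ (2 * L) %/ 4) + k %/ (2 * L) %% 4 < e]
      then F ((2 * (k %/ (2 * L) %/ 4) + k %/ (2 * L) %% 4) * L + k %% (2 * L)) else 0.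
    pose inv e (s' : state) := frame [:: 2; 5; 24; aX] s s' /\
       forall k, k < 2 ^ S -> s' aX k = lay e k.
    loop inv (2 * m.+1) (fun e : nat => 1 + (L * 3 + 2)).
    + by lia.
    + split.
        by apply: frame_upd => //; apply: frame_sub fr1.
      by move=> k kS; rewrite upd_ne // z1 // /lay ltn0 !andbF.
    + by move=> e s' _ [fr' _] _ /=; rewrite fr' // dg; lia.
    + move=> e s2 em [fr2 lay2] re; apply: run_bounded => bs2.
      have d2 : s2 rDeg 0 = m by rewrite fr2.
      have [ei phm] := hi s2 d2 e em re.
      apply: (run_assign_seq ok) => //=; rewrite ei; first by lia.
      set s3 := upd _ _ _ _.
      have f5 : s3 5 0 = e by rewrite /s3 upd_ne.
      have f10 : s3 10 0 = L by rewrite /s3 upd_ne // fr2.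
      have f24 : s3 24 0 = phi e by [].
      pose pos l := (e + 2 * (e %/ 2)) * (2 * L) + l.
      have e2 : e %/ 2 <= m by lia.
      have pb : (e + 2 * (e %/ 2)) * (2 * L) + 2 * L <= 2 ^ S.
        by apply: leq_trans fit; rewrite -mulSnr mulnCA -[8]/(2 * 4) -!mulnA leq_mul2l /= mulnA leq_mul2r; lia.
      have pq : phi e * L + L <= 2 ^ S.
        by apply: leq_trans fit; rewrite -mulSnr leq_mul2r; lia.
      have posq l : l < L -> pos l %/ (2 * L) = e + 2 * (e %/ 2) /\ pos l %% (2 * L) = l.
        move=> lL; have K0 : 0 < 2 * L by lia.
        have lK : l < 2 * L by lia.
        by rewrite /pos divnMDl // (divn_small lK) addn0 modnMDl (modn_small lK).
      eapply run_le; [apply: (run_fill ok (N := L) (pos := pos)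
        (val := fun l => F (e * L + l)))|..] => //.
      * by move: srcE; rewrite !inE => /orP[] /eqP ->.
      * by lia.
      * by move=> j k _ _; apply: addnI.
      * by move=> k s' _ [fr' _ _] _ /=; rewrite fr'.
      * move=> l s' lL [fr' _ _] rl bs' /=.
        have sX : src \notin [:: 2; aX] by move: srcX; rewrite !inE !negb_or => /and4P[-> _ _ ->].
        have s24 : src != 24 by move: srcX; rewrite !inE !negb_or => /and4P[_ _ -> _].
        rewrite rl !(fr' 5 isT) !(fr' 10 isT) (fr' 24 isT) f5 f10 f24.
        rewrite (fr' src sX) /s3 upd_ne // fr2 //.
        have eF : F (e * L + l) = s src (phi e * L + l).
          by rewrite /F /source divnMDl // divn_small // addn0 modnMDl modn_small.
        split=> //; rewrite eF; apply: bs.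
          by move: srcE; rewrite !inE => /orP[] /eqP ->.
        by move: srcE; rewrite !inE => /orP[] /eqP ->.
      * move=> s' _ [fr' hj hp]; split; first by rewrite fr'.
        split.
          apply: frame_upd => //; apply: (frame_trans fr2); apply: (@frame_trans _ _ s3).
            exact: frame_upd.
          by apply: frame_sub fr'.
        move=> k kS; rewrite upd_ne //.
        case: (boolP [&& k %% (2 * L) < L & k == pos (k %% (2 * L))]) => [/andP[kl /eqP kp]|nk].
          rewrite {1}kp hj // /lay {1 2 3 4 5 6 7 8}kp; have [-> ->] := posq _ kl.
          rewrite (_ : (e + 2 * (e %/ 2)) %% 4 < 2); last by lia.
          rewrite (_ : 2 * ((e + 2 * (e %/ 2)) %/ 4) + (e + 2 * (e %/ 2)) %% 4 = e); last by lia.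
          by rewrite kl ltnSn.
        rewrite hp; last first.
          move=> j jL kj; case/negP: nk; have [_ e'] := posq _ jL.
          by rewrite kj e' jL eqxx.
        rewrite /s3 upd_ne // lay2 // /lay; case: ltnP nk => //= kl nk.
        case: ltnP => //= b4.
        rewrite ltnS [in RHS]leq_eqVlt; case: eqP => //= eb.
        case/eqP: nk; rewrite {1}(divn_eq k (2 * L)) /pos; congr (_ * _ + _).
        by lia.
    + move=> s' _ [fr' lay']; split=> // k kS; rewrite lay' // /lay /layout.
      congr (if _ then _ else _); case: ltnP => //= _.
      move: (k %/ (2 * L)) => b; case: ltnP => //= b4; apply/idP/idP; lia.
    + exact: leqnn.
rewrite sum_nat_const card_ord; nia.
Qed.

Definition represents (beta : nat) (f : nat -> nat) (m L : nat) (x : nat -> nat) : Prop :=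
  forall e, e < 2 * m.+1 -> (forall l, l < L -> f (e * L + l) < beta) /\ entry beta L f e = x e.

Definition alt_entry (e : nat) : nat := 2 * (e %/ 2) + (e %% 2 + e %/ 2) %% 2.

Lemma alt_entry_lt e m : e < 2 * m.+1 -> alt_entry e < 2 * m.+1.
Proof. by rewrite /alt_entry; lia. Qed.

Lemma layout_out m L src S k : 0 < L -> 8 * m.+1 * L <= 2 ^ S -> 2 ^ S <= k -> layout m L src k = 0.
Proof.
move=> L0 fit kS; rewrite /layout.
suff -> : (k %/ (2 * L) %/ 4 <= m) = false by rewrite !andbF.
apply/negbTE; rewrite -ltnNge -divnMA leq_divRL; last by lia.
by apply: leq_trans kS; apply: leq_trans fit; lia.
Qed.

Lemma layout_le beta m L f phi x k : represents beta f m L x ->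
  (forall e, e < 2 * m.+1 -> phi e < 2 * m.+1) -> layout m L (source L phi f) k <= beta.
Proof.
move=> rep hphi; rewrite /layout; case: ifP => // /and3P[lL b4 bm].
move: (k %/ (2 * L)) b4 bm => b b4 bm; move: (k %% (2 * L)) lL => l lL.
have L0 : 0 < L by apply: leq_ltn_trans lL.
rewrite /source divnMDl // (divn_small lL) addn0 modnMDl (modn_small lL).
have eb : 2 * (b %/ 4) + b %% 4 < 2 * m.+1 by lia.
by apply: ltnW; have [h _] := rep _ (hphi _ eb); apply: h.
Qed.

(** [8 * m.+1 * L] is the length of the layout, [4 * m.+1] slots of [2 * L] cells. The weight bounds
    keep every entry of the product below [beta ^ (2 * L)], so reduction modulo that power loses
    nothing. *)
Lemma mul_prog_run s dst src par S m L p beta (x y : nat -> nat) :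
  src \in [:: aA; aQ] -> dst \in [:: aA; aQ] ->
  wf_assign rTmp (Cst 0) ((#rEnt + 6 * (#rEnt / 2) + 4 * par) * (2 * #rLimb)) ->
  (forall s', s' rDeg 0 = m -> den s' par = p) -> 2 * (m %/ 2) + p <= m ->
  s rSize 0 = 2 ^ S -> s rLog 0 = S -> s rDeg 0 = m -> s rLimb 0 = L -> s rBeta 0 = beta ->
  0 < L -> 1 < beta -> 8 * m.+1 * L <= 2 ^ S -> 4 * 3 ^ S <= V ->
  4 * (2 ^ S * (2 ^ S * beta) ^ 2) <= V ->
  represents beta (s src) m L x -> represents beta (s aQ) m L y ->
  weight m x < beta ^ L -> weight m y < beta ^ L ->
  run s (mul_prog dst src par)
    (fun s' => represents beta (s' dst) (m %/ 2) (2 * L) (section_mul m p x (alternate y)) /\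
       frame [:: 0; 1; 2; 3; 4; 5; 7; 8; 24; aX; aY; aZ; dst] s s') (200 * 3 ^ S).
Proof.
move=> srcE dstE wpar hpar pm sz lg dg lb bt L0 b1 fit SV HV repx repy wx wy.
apply: run_bounded => bs; have V64 := ram_min ok.
have p2 : 0 < 2 ^ S by rewrite expn_gt0.
have p23 : 2 ^ S <= 3 ^ S by rewrite -sum_levels leq_addl.
have p2V : 2 ^ S <= V by lia.
pose gx := layout m L (source L id (s src)); pose gy := layout m L (source L alt_entry (s aQ)).
have gxb k : gx k <= beta by apply: layout_le repx _.
have gyb k : gy k <= beta by apply: layout_le repy _ => e; exact: alt_entry_lt.
have evb g l k : (forall i, g i <= beta) -> l <= S -> kara_eval S g l k <= 2 ^ S * beta.
  move=> gb lS; apply: leq_trans (kara_eval_le S l k gb) _.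
  by rewrite leq_mul2r leq_pexp2l // orbT.
have sq : 2 ^ S * beta <= (2 ^ S * beta) ^ 2 by rewrite expnS expn1 leq_pmulr //; nia.
have sq2 : (2 ^ S * beta) ^ 2 <= 2 ^ S * (2 ^ S * beta) ^ 2 by rewrite leq_pmull.
have evV g l k : (forall i, g i <= beta) -> l <= S -> kara_eval S g l k <= V.
  by move=> gb lS; apply: leq_trans (evb g l k gb lS) _; lia.
pose z := kara_point (kara_eval S gx S) (kara_eval S gy S).
have zb k : z k <= (2 ^ S * beta) ^ 2.
  rewrite /z /kara_point; case: ifP => // _.
  by rewrite expnS expn1 leq_mul // evb.
have zib l k : l <= S -> kara_interp S z l k <= 2 ^ S * (2 ^ S * beta) ^ 2.
  move=> lS; apply: leq_trans (kara_interp_le S l k zb) _.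
  by rewrite leq_mul2r leq_pexp2l // orbT.
eapply run_leT; rewrite /mul_prog.
  apply: run_seq; eapply run_le; [apply: (load_prog_run (phi := alt_entry) (S := S) (m := m) (L := L))|..] => //.
    move=> s' _ e em re /=; split; last exact: alt_entry_lt.
    by rewrite re /alt_entry; lia.
  move=> s1 bs1 [x1 fr1].
  apply: run_seq; eapply run_le; [apply: (eval_prog_run ok (S := S) (g := gy))|..] => //.
  - by rewrite fr1.
  - by rewrite fr1.
  - by lia.
  - by move=> l k lS; apply: evV.
  move=> s2 bs2 [x2 cn2 fr2].
  apply: run_seq; eapply run_le; [apply: (run_fill ok (N := 3 ^ S) (pos := id) (val := kara_eval S gy S))|..]; try by [].
  - by lia.
  - by move=> k s' _ [fr' _ _] _ /=; rewrite fr'.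
  - move=> k s' kS [fr' _ _] rk _ /=; rewrite rk fr' // x2 //; split=> //; exact: evV.
  move=> s3 bs3 [fr3 y3 _].
  have f3 j : j \notin [:: 0; 1; 2; 3; 4; 5; 24; 28; 29] -> s3 j =1 s j.
    move=> jn i; have [h1 h2 h3] : [/\ j \notin [:: 2; 29], j \notin [:: 0; 1; 2; 3; 4; 28] & j \notin [:: 2; 5; 24; 28]].
      by move: jn; rewrite !inE !negb_or => /and5P[-> -> -> -> /and5P[-> -> -> -> ->]].
    by rewrite fr3 // fr2 // fr1.
  apply: run_seq; eapply run_le; [apply: (load_prog_run (phi := id) (S := S) (m := m) (L := L))|..] => //;
    try by rewrite f3.
  move=> s4 bs4 [x4 fr4].
  have {}x4 k : k < 2 ^ S -> s4 28 k = gx k.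
    move=> kS; rewrite x4 // /gx /layout; case: ifP => // _; rewrite /source.
    by rewrite f3 //; move: srcE; rewrite !inE => /orP[] /eqP ->.
  apply: run_seq; eapply run_le; [apply: (eval_prog_run ok (S := S) (g := gx))|..] => //.
  - by rewrite fr4 // f3.
  - by rewrite fr4 // f3.
  - by lia.
  - by move=> l k lS; apply: evV.
  move=> s5 bs5 [x5 cn5 fr5].
  have y5 k : k < 3 ^ S -> s5 29 k = kara_eval S gy S k.
    by move=> kS; rewrite fr5 // fr4 // (y3 k).
  apply: run_seq; eapply run_le; [apply: (run_fill ok (N := 3 ^ S) (pos := fun k => 2 * k) (val := fun k => z (2 * k)))|..]; try by [].
  - by lia.
  - by move=> j k _ _; lia.
  - by move=> k s' _ [fr' _ _] _ /=; rewrite fr'.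
  - move=> k s' kS [fr' _ _] rk _ /=; rewrite rk !fr' // x5 // y5 //; split=> //.
      by rewrite /z /kara_point mul2n odd_double doubleK.
    by apply: leq_trans (zb _) _; lia.
  move=> s6 bs6 [fr6 z6 _].
  apply: run_seq; eapply run_le; [apply: (run_fill ok (N := 3 ^ S) (pos := fun k => 2 * k + 1) (val := fun=> 0))|..]; try by [].
  - by lia.
  - by move=> j k _ _; lia.
  - by move=> k s' _ [fr' _ _] _ /=; rewrite fr' // fr6.
  - by move=> k s' kS [fr' _ _] rk _ /=; rewrite rk.
  move=> s7 bs7 [fr7 z7 n7].
  have z7' k : k < 2 * 3 ^ S -> s7 30 k = z k.
    move=> kS; case: (boolP (odd k)) => ok'.
      have ek : k = 2 * (k %/ 2) + 1 by have := modn2 k; rewrite ok'; lia.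
      by rewrite {1}ek z7 ?/z ?/kara_point ?ok' //; lia.
    have ek : k = 2 * (k %/ 2) by have := modn2 k; rewrite (negbTE ok'); lia.
    rewrite n7; last by move=> j _; rewrite ek; lia.
    by rewrite {1}ek z6 -?ek //; lia.
  have f7 j : j \notin [:: 0; 1; 2; 3; 4; 5; 24; 28; 29; 30] -> s7 j =1 s j.
    move=> jn i; have [h1 h2 h3 h4 h5] : [/\ j \notin [:: 2; 30], j \notin [:: 0; 1; 2; 3; 4; 28], j \notin [:: 2; 5; 24; 28], j \notin [:: 2; 30] & j \notin [:: 0; 1; 2; 3; 4; 5; 24; 28; 29]].
      by move: jn; rewrite !inE !negb_or => /and5P[-> -> -> -> /and5P[-> -> -> -> /andP[-> ->]]].
    by rewrite fr7 // fr6 // fr5 // fr4 // f3.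
  apply: run_seq; eapply run_le; [apply: (interp_prog_run ok (S := S) (z := z))|..] => //.
  - by rewrite fr7 // fr6 // cn5.
  - by rewrite f7.
  - by move=> l k lS; apply: leq_trans (zib l k lS) _; lia.
  move=> s8 bs8 [z8 fr8].
  have f8 j : j \notin [:: 0; 1; 2; 3; 4; 5; 24; 28; 29; 30] -> s8 j =1 s j.
    move=> jn i; have h1 : j \notin [:: 0; 1; 2; 3; 4; 30].
      by move: jn; rewrite !inE !negb_or => /and5P[-> -> -> -> /and5P[-> _ _ _ /andP[_ ->]]].
    by rewrite fr8 // f7.
  have zc k : k < 2 * 2 ^ S -> s8 30 k = convn gx gy k.
    move=> kS; rewrite z8 // /convn -(kara_conv (s := S) (g := gx) (g' := gy)) //.
      by move=> i iS; apply: layout_out fit iS.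
    by move=> i iS; apply: layout_out fit iS.
  have zW k : k < 2 * 2 ^ S -> convn gx gy k <= 2 ^ S * (2 ^ S * beta) ^ 2.
    by move=> kS; rewrite -zc // z8 //; apply: zib.
  pose r := section_mul m p x (alternate y).
  have ex : spread m (entry beta L (source L id (s src))) =1 spread m x.
    by apply: spread_ext => e em; rewrite entry_source; case: (repx _ em).
  have ey : spread m (entry beta L (source L alt_entry (s aQ))) =1 spread m (alternate y).
    by apply: spread_ext => e em; rewrite entry_source; case: (repy _ (alt_entry_lt em)).
  have rlt e : e < 2 * (m %/ 2).+1 -> r e < beta ^ (2 * L).
    move=> em; apply: leq_ltn_trans (section_mul_le x (alternate y) pm em) _.
    by rewrite weight_alternate mul2n -addnn expnD ltn_mul.
  pose inv e (s' : state) := frame [:: 2; 5; 7; 8; 24; dst] s8 s' /\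
    forall e', e' < e -> (forall l, l < 2 * L -> s' dst (e' * (2 * L) + l) < beta) /\
      entry beta (2 * L) (s' dst) e' = r e'.
  have dstE' : [/\ dst \notin [:: 2; 7; 8; 13], dst != 24, dst != 30 & dst != 5] by move: dstE; rewrite !inE => /orP[] /eqP ->.
  have [d1 d24 d30 d5] := dstE'.
  have dJ : dst < arrays /\ dst != big_cell by move: dstE; rewrite !inE => /orP[] /eqP ->.
  have mL : 8 * m.+1 <= 2 ^ S by nia.
  loop inv (2 * (m %/ 2).+1) (fun e : nat => 1 + (1 + (2 * L * 5 + 2))).
  - by lia.
  - by split=> //; apply: frame_upd => //; rewrite !inE eqxx.
  - move=> e s' _ [fr' _] _ /=; rewrite fr' ?f8 ?dg; first by lia.
      by [].
    by move: dstE; rewrite !inE => /orP[] /eqP ->.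
  - move=> e s9 em [fr9 ent] re; apply: run_bounded => bs9.
    have fr9' j : j \notin [:: 2; 5; 7; 8; 24; 31; 32] -> s9 j =1 s8 j.
      move=> jn i; apply: fr9; move: jn dstE; rewrite !inE !negb_or.
      by move=> /and5P[-> -> -> -> /and3P[-> j1 j2]] /orP[] /eqP ->.
    have dg9 : s9 9 0 = m by rewrite fr9' // f8.
    have lb9 : s9 10 0 = L by rewrite fr9' // f8.
    have bt9 : s9 13 0 = beta by rewrite fr9' // f8.
    pose b := 4 * (2 * (e %/ 2) + p) + e %% 2.
    have bE : e + 6 * (e %/ 2) + 4 * p = b by rewrite /b; lia.
    have bm : b + 2 <= 4 * m + 3 by rewrite /b; lia.
    have bL : (b + 2) * (2 * L) + 2 * L <= 2 ^ S.
      apply: leq_trans fit; rewrite -mulSnr; apply: (@leq_trans ((4 * m.+1) * (2 * L))); last by lia.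
      by rewrite leq_mul2r; apply/orP; right; lia.
    have bL2 : (b + 2) * (2 * L) = b * (2 * L) + 4 * L by rewrite mulnDl; lia.
    apply: (run_assign_seq ok) => //=; rewrite ?re ?(hpar _ dg9) ?lb9 bE; first by lia.
    asg; first by lia.
    set s10 := upd _ _ _ _.
    have f10 j : j != 24 -> j != 7 -> s10 j =1 s9 j by move=> j1 j2 i; rewrite /s10 !upd_ne.
    pose t l := convn gx gy (b * (2 * L) + l) + convn gx gy ((b + 2) * (2 * L) + l).
    eapply run_le; [apply: (run_carry (K := 2 * L) (pos := fun l => e * (2 * L) + l) (t := t)
      (beta := beta) (c0 := 0) (T := 2 * (2 ^ S * (2 ^ S * beta) ^ 2)))|..] => //.
    + by case: dJ.
    + by case: dJ.
    + by move: dstE; rewrite !inE => /orP[] /eqP ->.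
    + move=> l lL; rewrite /t.
      have k1 : b * (2 * L) + l < 2 * 2 ^ S by lia.
      have k2 : (b + 2) * (2 * L) + l < 2 * 2 ^ S by lia.
      by have := zW _ k1; have := zW _ k2; lia.
    + by lia.
    + by lia.
    + by move=> j k _ _; apply: addnI.
    + by move=> k s' _ [fr' _ _] _ /=; rewrite fr' ?f10 ?lb9 //; move: d1 dstE; rewrite !inE => _ /orP[] /eqP ->.
    + move=> k s' kL [fr' _ _] rk /=; rewrite rk.
      have fr'' j : j \notin [:: 2; 7; 8; 31; 32] -> s' j =1 s10 j.
        move=> jn i; apply: fr'; move: jn dstE; rewrite !inE !negb_or.
        by move=> /and5P[-> -> -> j1 j2] /orP[] /eqP ->.
      rewrite !(fr'' 5 isT) !(fr'' 10 isT) !(fr'' 24 isT) !(fr'' 30 isT).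
      rewrite !(f10 5 isT isT) !(f10 10 isT isT) !(f10 30 isT isT) re lb9.
      have -> : s10 24 0 = b * (2 * L) by [].
      split=> //; rewrite /t bL2 !(fr9' 30 isT) !zc //; rewrite -?bL2; lia.
    + move=> s' _ [fr' hj hp].
      have f5 : s' 5 0 = e.
        rewrite fr' ?f10 ?re //; move: dstE; rewrite !inE => /orP[] /eqP -> //.
      split=> //; split.
        apply: frame_upd; last by rewrite !inE eqxx ?orbT.
        apply: (frame_trans fr9); apply: (@frame_trans _ _ s10).
          by do 2 (apply: frame_upd => //).
        apply: frame_sub fr'; rewrite /= !inE eqxx ?orbT //.
      move=> e' ee'; have ud : upd s' 5 0 e.+1 dst =1 s' dst by move=> i; rewrite upd_ne.
      have ud' : entry beta (2 * L) (upd s' 5 0 e.+1 dst) e' = entry beta (2 * L) (s' dst) e'.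
        by apply: limbs_ext => l _; rewrite ud.
      rewrite ud'; move: ee'; rewrite ltnS leq_eqVlt => /orP[/eqP ->|ee'].
        split=> [l lL|]; first by rewrite ud hj // digit_lt //; lia.
        rewrite /entry (@limbs_ext _ _ _ (digit beta t 0)); last by move=> l lL; rewrite hj.
        rewrite limbs_digit; last by lia.
        have -> : limbs beta (2 * L) t = r e.
          by rewrite /t limbsD !layout_conv !(convn_ext ex ey).
        by rewrite addn0 modn_small // rlt.
      have [h1 h2] := ent e' ee'.
      have same l : l < 2 * L -> s' dst (e' * (2 * L) + l) = s9 dst (e' * (2 * L) + l).
        move=> lL; rewrite hp ?f10 //; first by move: d1; rewrite !inE !negb_or => /and4P[].
        move=> j jL; have : e'.+1 * (2 * L) <= e * (2 * L) by rewrite leq_mul2r ee' orbT.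
        by rewrite mulSn; lia.
      split=> [l lL|]; first by rewrite ud same //; apply: h1.
      by rewrite -h2; apply: limbs_ext => l lL; rewrite same.
  - move=> s' _ [fr' h]; split; first exact: h.
    move=> j; rewrite !inE !negb_or => jn i.
    rewrite fr' ?f8 //; rewrite !inE !negb_or.
      by move: jn => /and5P[-> -> -> -> /and5P[-> -> _ _ /and5P[-> -> -> -> _]]].
    by move: jn => /and5P[_ _ -> _ /and5P[_ -> -> -> /and5P[-> _ _ _ ->]]].
  - exact: leqnn.
rewrite sum_nat_const card_ord; nia.
Qed.

End Programs.

Notation rDiv := 15 (only parsing).
Notation rStep := 16 (only parsing).
Notation rIdx := 17 (only parsing).
Notation rFac := 18 (only parsing).
Notation aC := 27 (only parsing).
Notation aS := 33 (only parsing).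
Notation aU := 34 (only parsing).

(** Size [16 * d] serves all steps: while [m = d / L] is positive,
    [8 * (m + 1) * L <= 16 * m * L <= 16 * d]. Once it is reached, the remaining rounds do
    nothing. *)
Definition size_prog : cmd :=
  rSize <- 1 ;; rLog <- 0 ;;
  for rPos << 16 * #rDiv do
    branch (16 * #rDiv - #rSize) (rSize <- 2 * #rSize ;; rLog <- #rLog + 1) Skip
  od.

(** At [rPos = 0] the index [rPos - 1] truncates to 0. In the numerator the value read is multiplied
    by 0; in the denominator it lands in entry 1, which is cleared afterwards. *)
Definition start_prog : cmd :=
  for rPos << #rDiv + 1 do assign aA (2 * #rPos) (#rPos * aC.@(#rPos - 1)) od ;;
  for rPos << #rDiv + 1 do assign aA (2 * #rPos + 1) 0 od ;;
  for rPos << #rDiv + 1 do assign aQ (2 * #rPos) 0 od ;;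
  for rPos << #rDiv + 1 do assign aQ (2 * #rPos + 1) aC.@(#rPos - 1) od ;;
  assign aQ 0 1 ;; assign aQ 1 0 ;;
  rDeg <- #rDiv ;; rLimb <- 1.

(** The numerator is updated first, as it needs the old denominator. *)
Definition graeffe_prog : cmd :=
  for rStep << #rLog do
    branch #rDeg
      (mul_prog aA aA (#rDeg - 2 * (#rDeg / 2)) ;; mul_prog aQ aQ 0 ;;
       rDeg <- #rDeg / 2 ;; rLimb <- 2 * #rLimb)
      Skip
  od.

(** * Extraction of one coefficient *)

Section Programs.

Variables (n sigma : nat) (ws : seq nat) (M : machine) (V : nat).
Hypothesis ok : ram_spec n sigma ws M V.

Notation run := (run n sigma ws M V).
Notation bounded := (bounded V).
Notation den := (den n sigma).

Lemma size_prog_run s d : s rDiv 0 = d -> 0 < d -> 32 * d <= V ->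
  run s size_prog (fun s' => frame [:: 2; 11; 12] s s' /\
    exists S, [/\ s' rSize 0 = 2 ^ S, s' rLog 0 = S, 16 * d <= 2 ^ S & 2 ^ S < 32 * d]) (100 * d).
Proof.
move=> sd d0 dV; apply: run_bounded => bs; have V64 := ram_min ok.
pose inv k (s' : state) := frame [:: 2; 11; 12] s s' /\
  exists S, [/\ s' 11 0 = 2 ^ S, s' 12 0 = S, 16 * d <= 2 ^ S \/ k <= S & 2 ^ S < 32 * d].
eapply run_leT; rewrite /size_prog.
  asg; first by lia.
  asg; first by lia.
  loop inv (16 * d) (fun _ : nat => 3).
  - by lia.
  - split; first by do 3 (apply: frame_upd => //).
    by exists 0; split=> //; [right|lia].
  - by move=> k s' _ [fr _] _ /=; rewrite fr // sd.
  - move=> k s' kd [fr [S [e1 e2 o le]]] rk.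
    have sd' : s' 15 0 = d by rewrite fr.
    apply: (run_branch ok) => //=; rewrite e1 sd' => h.
      have SV : S < 2 ^ S by apply: ltn_expl.
      eapply run_leT; first (asg; first by rewrite e1; lia).
        apply: (run_assign ok) => //=; rewrite ?upd_ne // e2; first by lia.
        split; first by rewrite ?upd_ne.
        split; first by do 3 (apply: frame_upd => //).
        exists S.+1; rewrite expnS; split.
        - by rewrite /upd /= e1.
        - by rewrite /upd /= addn1.
        - by right; lia.
        - by lia.
      by [].
    apply: run_leT (_ : run _ _ _ 1) _ => //; apply: run_skip; split=> //.
    split; first by apply: frame_upd.
    by exists S; rewrite ?upd_ne //; split=> //; left; lia.
  - move=> s' _ [fr [S [e1 e2 o le]]]; split=> //; exists S; split=> //.
    (* A doubling in each of the [16 * d] rounds also suffices, as then [16 * d <= S < 2 ^ S]. *)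
    case: o => // dS; have SV : S < 2 ^ S by apply: ltn_expl.
    by lia.
  - exact: leqnn.
rewrite sum_nat_const card_ord; lia.
Qed.

Variables (c : nat -> nat) (beta : nat).
Hypothesis c_le : forall i, c i <= beta.

Lemma start_prog_run s d : s rDiv 0 = d -> 0 < d -> d + 1 <= V -> d * beta <= V -> beta <= V ->
  (forall i, i < d -> s aC i = c i) ->
  run s start_prog (fun s' => [/\ frame [:: 2; 9; 10; aA; aQ] s s',
    s' rDeg 0 = d, s' rLimb 0 = 1,
    forall e, e < 2 * d.+1 -> s' aA e = num0 c e & forall e, e < 2 * d.+1 -> s' aQ e = den0 c e]) (40 * d).
Proof.
move=> sd d0 dV dbV bV cs; apply: run_bounded => bs; have V64 := ram_min ok.
have h2 e : e = 2 * (e %/ 2) \/ e = 2 * (e %/ 2) + 1 by lia.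
have o1 i : odd (2 * i + 1) by rewrite mul2n addn1 /= odd_double.
have o0 i : odd (2 * i) = false by rewrite mul2n odd_double.
have q1 i : (2 * i + 1) %/ 2 = i by lia.
have q0 i : 2 * i %/ 2 = i by lia.
eapply run_leT; rewrite /start_prog.
  apply: run_seq; eapply run_le; [apply: (run_fill ok (N := d + 1) (pos := fun i => 2 * i)
    (val := fun i => i * c i.-1))|..] => //.
  - by move=> j k _ _; lia.
  - by move=> k s' _ [fr _ _] _ /=; rewrite fr ?sd.
  - move=> k s' kd [fr _ _] rk _ /=; rewrite rk fr // subn1.
    have e : k * s 27 k.-1 = k * c k.-1 by case: k kd {rk} => // k kd; rewrite cs //; lia.
    split=> //; apply: leq_trans dbV; apply: leq_mul => //; lia.
  move=> s1 bs1 [fr1 a1 _].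
  apply: run_seq; eapply run_le; [apply: (run_fill ok (N := d + 1) (pos := fun i => 2 * i + 1)
    (val := fun i => 0))|..] => //.
  - by move=> j k _ _; lia.
  - by move=> k s' _ [fr _ _] _ /=; rewrite fr // fr1 ?sd.
  - by move=> k s' kd [fr _ _] rk _ /=; rewrite rk.
  move=> s2 bs2 [fr2 a2 n2].
  apply: run_seq; eapply run_le; [apply: (run_fill ok (N := d + 1) (pos := fun i => 2 * i)
    (val := fun i => 0))|..] => //.
  - by move=> j k _ _; lia.
  - by move=> k s' _ [fr _ _] _ /=; rewrite fr // fr2 // fr1 ?sd.
  - by move=> k s' kd [fr _ _] rk _ /=; rewrite rk.
  move=> s3 bs3 [fr3 a3 n3].
  apply: run_seq; eapply run_le; [apply: (run_fill ok (N := d + 1) (pos := fun i => 2 * i + 1)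
    (val := fun i => if i == 0 then s3 27 0 else c i.-1))|..] => //.
  - by move=> j k _ _; lia.
  - by move=> k s' _ [fr _ _] _ /=; rewrite fr // fr3 // fr2 // fr1 ?sd.
  - move=> k s' kd [fr _ _] rk _ /=; rewrite rk fr //; case: k kd {rk} => [|k] kd; split=> //=.
    + exact: bs3.
    + by rewrite subn1 /= fr3 // fr2 // fr1 // cs //; lia.
    + by apply: leq_trans (c_le _) bV.
  move=> s4 bs4 [fr4 a4 n4].
  have fr s' j : frame [:: 2; 32] s4 s' -> j \notin [:: 2; 31; 32] -> s' j =1 s j.
    move=> fr' jn i; have [j1 j2] : j \notin [:: 2; 31] /\ j \notin [:: 2; 32].
      by move: jn; rewrite !inE !negb_or => /and3P[-> -> ->].
    by rewrite fr' // fr4 // fr3 // fr2 // fr1.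
  asg; first by lia.
  asg; first by lia.
  asg; first by rewrite (fr s4 15 (@frame_refl _ _)) // sd; lia.
  apply: (run_assign ok) => //=; first by lia.
  split.
  - do 4 (apply: frame_upd => //).
    by move=> j jn i; apply: (fr s4 j (@frame_refl _ _)); move: jn; rewrite !inE !negb_or => /and5P[-> _ _ -> ->].
  - by rewrite /upd /= (fr s4 15 (@frame_refl _ _)).
  - by [].
  - move=> e ed; rewrite ?upd_ne // fr4 // fr3 // /num0.
    case: (h2 e) => ->; rewrite ?o0 ?o1 ?q0 ?q1.
      by rewrite n2 ?a1 //; [lia|move=> j _; lia].
    by rewrite a2 //; lia.
  - move=> e ed; rewrite /den0.
    have d0' : 0 < d + 1 by lia.
    case: (e =P 0) => [->|e0]; first by rewrite /upd.
    case: (e =P 1) => [->|e1]; first by rewrite /upd.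
    rewrite /upd /= (introF eqP e1) (introF eqP e0).
    case: (h2 e) => ->; rewrite ?o0 ?o1 ?q0 ?q1 /=.
      by rewrite n4 ?a3 //; [lia|move=> j _; lia].
    have -> : 2 < 2 * (e %/ 2) + 1 by lia.
    rewrite a4; last by lia.
    by have -> : (e %/ 2 == 0) = false by lia.
lia.
Qed.

Definition graeffe_frame : seq nat :=
  [:: 0; 1; 2; 3; 4; 5; 7; 8; 9; 10; 16; 24; aX; aY; aZ; aA; aQ].

Hypothesis (n0 : 0 < n).
Hypothesis c_out : forall i, n <= i -> c i = 0.

Lemma leq_weight m x e : e < 2 * m.+1 -> x e <= weight m x.
Proof. by move=> em; rewrite /weight (bigD1 (Ordinal em)) //= leq_addr. Qed.

Lemma represents1 f m x : (forall e, e < 2 * m.+1 -> f e = x e) -> weight m x < beta ->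
  represents beta f m 1 x.
Proof.
move=> fx wx e em; split=> [l|].
  rewrite ltnS leqn0 => /eqP ->; rewrite muln1 addn0 fx //.
  by apply: leq_ltn_trans wx; apply: leq_weight.
by rewrite /entry /limbs big_ord1 /= muln1 addn0 muln1 fx.
Qed.

Lemma graeffe_prog_run s d S : 0 < d -> 16 * d <= 2 ^ S -> 1 < beta ->
  s rSize 0 = 2 ^ S -> s rLog 0 = S -> s rBeta 0 = beta -> s rDeg 0 = d -> s rLimb 0 = 1 ->
  4 * 3 ^ S <= V -> 4 * (2 ^ S * (2 ^ S * beta) ^ 2) <= V ->
  (forall e, e < 2 * d.+1 -> s aA e = num0 c e) ->
  (forall e, e < 2 * d.+1 -> s aQ e = den0 c e) ->
  weight d (num0 c) < beta -> weight d (den0 c) < beta ->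
  run s graeffe_prog (fun s' => frame graeffe_frame s s' /\
    exists L, [/\ s' rLimb 0 = L, d < L, L <= 2 * d,
      forall l, l < L -> s' aA l < beta /\ s' aA (L + l) < beta
    & limbs beta L (s' aA) = limbs beta L (fun l => s' aA (L + l)) + cyclic n c d])
    (500 * (S * 3 ^ S) + 2).
Proof.
move=> d0 dS b1 sz lg bt dg lb SV HV ha hq wa wq; apply: run_bounded => bs.
have V64 := ram_min ok.
have SS : S < 2 ^ S by apply: ltn_expl.
have p23 : 2 ^ S <= 3 ^ S by rewrite -sum_levels leq_addl.
(* The degree is always [d %/ L], and [L] doubles until the degree is 0; the tracked coefficient is
   the last one of [g]. *)
pose inv k (s' : state) := frame graeffe_frame s s' /\ exists L a q g,
  [/\ s' rDeg 0 = d %/ L, s' rLimb 0 = L,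
   [/\ 0 < L, L <= 2 * d & d %/ L = 0 \/ L = 2 ^ k],
   [/\ represents beta (s' aA) (d %/ L) L a, represents beta (s' aQ) (d %/ L) L q,
       weight (d %/ L) a < beta ^ L & weight (d %/ L) q < beta ^ L]
  & solves (d %/ L) a q g /\ g (d %/ L) = Posz (cyclic n c d)].
rewrite /graeffe_prog; eapply run_leT.
  loop inv S (fun _ : nat => (200 * 3 ^ S + (200 * 3 ^ S + (1 + 1))).+1).
  - lia.
  - split; first by apply: frame_upd.
    exists 1, (num0 c), (den0 c), (fun k => Posz (cyclic n c k)); rewrite divn1 expn1.
    split; [by []|by []|by split=> //; [lia|right]| |].
      by split=> //; apply: represents1.
    by split=> //; apply: solves_initial.
  - by move=> k s' _ [fr _] _ /=; rewrite fr.
  - move=> k s1 kS [fr1 [L [a [q [g [e9 e10 [L0 Ld Lk] [ra rq wwa wwq] [sol gd]]]]]]] rk.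
    apply: run_bounded => bs1.
    have f1 j : j \notin graeffe_frame -> s1 j 0 = s j 0 by move=> jn; rewrite fr1.
    apply: (run_branch ok) => //=; rewrite e9 => m0; last first.
      apply: run_leT (_ : run _ _ _ 1) _; last by lia.
      apply: run_skip; split=> //; split; first by apply: frame_upd.
      exists L, a, q, g; split=> //; split=> //; by left.
    pose m := d %/ L.
    have mL : m * L <= d by rewrite leq_trunc_div.
    have Ldd : L <= d by move: m0; rewrite -/m => m0; nia.
    have fit : 8 * m.+1 * L <= 2 ^ S by nia.
    have mm : m = 2 * (m %/ 2) + (m - 2 * (m %/ 2)) by lia.
    have m2 : m %/ 2 = d %/ (2 * L) by rewrite /m mulnC divnMA.
    apply: run_seq; eapply run_le; [apply: (mul_prog_run ok (S := S) (m := m) (L := L)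
      (p := m - 2 * (m %/ 2)) (beta := beta) (x := a) (y := q))|..] => //; try by rewrite f1.
    + by move=> s' e9' /=; rewrite e9'.
    + by lia.
    move=> s2 bs2 [ra2 fr2].
    apply: run_seq; eapply run_le; [apply: (mul_prog_run ok (S := S) (m := m) (L := L)
      (p := 0) (beta := beta) (x := q) (y := q))|..] => //; try (by rewrite fr2 // f1); try (by rewrite fr2).
    + by lia.
    + by move=> e em; have [h1 h2] := rq e em; split=> [l lL|];
        [rewrite fr2 // h1|rewrite -h2; apply: limbs_ext => l lL; rewrite fr2].
    + by move=> e em; have [h1 h2] := rq e em; split=> [l lL|];
        [rewrite fr2 // h1|rewrite -h2; apply: limbs_ext => l lL; rewrite fr2].
    move=> s3 bs3 [rq3 fr3].
    have d9 : s3 9 0 = m by rewrite fr3 // fr2.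
    have d10 : s3 10 0 = L by rewrite fr3 // fr2.
    have dV : d <= V by lia.
    have mV : m <= V by apply: leq_trans (leq_div _ _) dV.
    asg; first by rewrite d9; apply: leq_trans (leq_div _ _) mV.
    apply: (run_assign ok) => //=; first by rewrite /upd /= d10; lia.
    split; first by rewrite /upd /= fr3 // fr2.
    split.
      do 3 (apply: frame_upd => //); apply: (frame_trans fr1).
      apply: (@frame_trans _ _ s2); first by apply: frame_sub fr2.
      by apply: frame_sub fr3.
    exists (2 * L), (section_mul m (m - 2 * (m %/ 2)) a (alternate q)),
      (section_mul m 0 q (alternate q)), (fun i => g (2 * i + (m - 2 * (m %/ 2)))).
    rewrite -m2; split.
    + by rewrite /upd /= d9.
    + by rewrite /upd /= d10.
    + split; [by lia|by lia|].
      case: Lk => [h|->]; first by case: m0.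
      by right; rewrite expnS.
    + rewrite !upd_other //; split=> //.
      * move=> e em; have [h1 h2] := ra2 e em; split=> [l lL|]; first by rewrite fr3 //; apply: h1.
        by rewrite -h2; apply: limbs_ext => l lL; rewrite fr3.
      * have h : 2 * (m %/ 2) + (m - 2 * (m %/ 2)) <= m by lia.
        apply: leq_ltn_trans (weight_section_mul a (alternate q) h) _.
        by rewrite weight_alternate mul2n -addnn expnD ltn_mul.
      * have h : 2 * (m %/ 2) + 0 <= m by lia.
        apply: leq_ltn_trans (weight_section_mul q (alternate q) h) _.
        by rewrite weight_alternate mul2n -addnn expnD ltn_mul.
    + split; last by rewrite -mm.
      by apply: graeffe_step sol => //; lia.
  - move=> s' _ [fr [L [a [q [g [e9 e10 [L0 Ld Lk] [ra rq wwa wwq] [sol gd]]]]]]].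
    have m0 : d %/ L = 0.
      by case: Lk => // ->; apply: divn_small; lia.
    rewrite m0 in ra sol gd; split=> //; exists L; split=> //.
    + by rewrite ltnNge -divn_gt0 // m0.
    + have [h0 _] := ra 0 isT; have [h1 _] := ra 1 isT => l lL; split.
        by have := h0 l lL; rewrite mul0n add0n.
      by have := h1 l lL; rewrite mul1n.
    + have [_ h0] := ra 0 isT; have [_ h1] := ra 1 isT.
      have e0 : limbs beta L (s' aA) = a 0.
        by rewrite -h0; apply: limbs_ext => l _; rewrite mul0n.
      have e1 : limbs beta L (fun l => s' aA (L + l)) = a 1.
        by rewrite -h1; apply: limbs_ext => l _; rewrite mul1n.
      have E : signed a 0 = (Posz (a 0) - Posz (a 1))%R by [].
      have := solves0 sol; rewrite gd E e0 e1.
      by move=> /eqP; rewrite GRing.subr_eq -PoszD eqz_nat addnC => /eqP.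
  - exact: leqnn.
rewrite sum_nat_const card_ord; nia.
Qed.

End Programs.

Lemma limbs_prefix beta N L f : 0 < beta -> L <= N ->
  limbs beta N f < beta ^ L -> limbs beta L f = limbs beta N f.
Proof.
move=> b0 /subnK <-; move: (N - L) => k; elim: k => // k IHk.
rewrite addSn limbsS => lt.
have bp : beta ^ L <= beta ^ (k + L) by rewrite leq_pexp2l // leq_addl.
have f0 : f (k + L) = 0.
  case: (posnP (f (k + L))) => // fp.
  have : 1 * beta ^ (k + L) <= f (k + L) * beta ^ (k + L) by rewrite leq_mul2r fp orbT.
  by lia.
by rewrite f0 mul0n addn0 in lt *; exact: IHk.
Qed.

Lemma limbs_sub_mod beta L X f : 0 < beta -> (forall l, l < L -> f l < beta) ->
  limbs beta L f <= X -> X < beta ^ L ->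
  (X + limbs beta L (fun l => beta - 1 - f l) + 1) %% beta ^ L = X - limbs beta L f.
Proof.
move=> b0 fb fX XL; have := limbs_compl b0 fb.
rewrite (@limbs_ext _ _ _ (fun l => beta - 1 - f l)); last by move=> l _; rewrite subn1.
move: (limbs beta L (fun l => beta - 1 - f l)) => Y E.
have -> : X + Y + 1 = beta ^ L + (X - limbs beta L f) by lia.
by rewrite modnDl modn_small //; lia.
Qed.

(** Turns the cost of [S] Karatsuba multiplications into the square of the size. The shift by 3
    closes the induction: [3 * (S + 4) <= 4 * (S + 3)]. *)
Lemma exp3_le S : (S + 3) * 3 ^ S <= 3 * (2 ^ S) ^ 2.
Proof.
have -> : (2 ^ S) ^ 2 = 4 ^ S by rewrite -expnM mulnC expnM.
have h34 k : 3 ^ k <= 4 ^ k by elim: k => // k IHk; rewrite !expnS; lia.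
elim: S => [//|S IHS]; rewrite !expnS; have := h34 S.
by move: (3 ^ S) (4 ^ S) IHS => a b; nia.
Qed.

(* Hides divisibility hypotheses from lia, which would otherwise introduce quotients. *)
Definition divides (d m : nat) : Prop := d %| m.

(* Adding beta - 1 - x in every limb x, with initial carry 1, subtracts the number
   with limbs x modulo a power of beta. *)
Definition out_prog : cmd :=
  rCy <- 1 ;;
  carry_loop #rLimb (aU.@(#rPos) + aA.@(#rLimb + #rPos) + (#rBeta - 1 - aA.@(#rPos)))
    aS (#rDiv * (2 * Len) + #rPos).

(** The test is the remainder of [rDiv] by [rFac]; stopping at [rDiv - 1] leaves the proper
    divisors. Blocks are subtracted by complements, as in [out_prog]. *)
Definition sieve_prog : cmd :=
  for rIdx << #rDiv - 1 do
    rFac <- #rIdx + 1 ;;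
    branch (#rDiv - #rFac * (#rDiv / #rFac)) Skip
      (rCy <- 1 ;;
       carry_loop #rLimb
         (aS.@(#rDiv * (2 * Len) + #rPos) + (#rBeta - 1 - aS.@(#rFac * (2 * Len) + #rPos)))
         aS (#rDiv * (2 * Len) + #rPos))
  od.

Definition div_prog : cmd :=
  size_prog ;; start_prog ;; graeffe_prog ;; out_prog ;; sieve_prog.

(** * Subtractions and the sieve on limbs *)

Section Programs.

Variables (n sigma : nat) (ws : seq nat) (M : machine) (V : nat).
Hypothesis ok : ram_spec n sigma ws M V.

Notation run := (run n sigma ws M V).
Notation bounded := (bounded V).
Notation den := (den n sigma).

Variables (c D : nat -> nat) (beta : nat).
Hypotheses (n0 : 0 < n) (c_le : forall i, c i <= beta) (c_out : forall i, n <= i -> c i = 0).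
Hypotheses (b1 : 1 < beta) (sb : sigma < beta) (HV : 4 * ((32 * n) ^ 3 * beta ^ 2) <= V).
Hypothesis weight_num : forall d, d <= n -> weight d (num0 c) < beta.
Hypothesis weight_den : forall d, d <= n -> weight d (den0 c) < beta.
Hypothesis D_sum : forall d, 0 < d -> divides d n ->
  \sum_(e < d.+1 | e %| d) D e + cyclic n c d = sigma ^ d.

(** The requirement on [V] stems from the columns of the convolution, at most [2^S * (2^S * beta)^2]
    with [2^S < 32 * n]. *)
Lemma cell_bounds d S : d <= n -> 2 ^ S < 32 * d ->
  [/\ 4 * 3 ^ S <= V, 4 * (2 ^ S * (2 ^ S * beta) ^ 2) <= V, 32 * d <= V, d * beta <= V & 8 * beta <= V].
Proof.
move=> dn lt; set P := 2 ^ S in lt *.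
have Pn : P <= 32 * n by lia.
have P0 : 0 < P by rewrite expn_gt0.
have h3 : 3 ^ S <= P ^ 2.
  have := exp3_le S; rewrite -/P; nia.
have e3 : (32 * n) ^ 3 = (32 * n) * (32 * n) * (32 * n) by rewrite !expnS expn0 muln1 mulnA.
have P3 : P * P * P <= (32 * n) ^ 3 by rewrite e3 !leq_mul.
have bb : beta <= beta ^ 2 by rewrite expnS expn1; nia.
have n3 : 32 * n <= (32 * n) ^ 3 by rewrite e3; nia.
have PP : P ^ 2 <= (32 * n) ^ 3 by rewrite e3 expnS expn1; nia.
have b2 : 1 <= beta ^ 2 by rewrite expn_gt0; lia.
have q1 : (32 * n) ^ 3 <= (32 * n) ^ 3 * beta ^ 2 by rewrite leq_pmulr.
have q2 : P * P * P * beta ^ 2 <= (32 * n) ^ 3 * beta ^ 2 by rewrite leq_mul2r P3 orbT.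
have q3 : d * beta <= (32 * n) ^ 3 * beta ^ 2 by apply: leq_mul => //; lia.
split; try lia.
have : 2 * beta <= (32 * n) ^ 3 * beta ^ 2 by apply: leq_mul => //; lia.
lia.
Qed.

(** Blocks of [2 * n] limbs are wide enough for every divisor, as [L <= 2 * d]. *)
Definition stored (s : state) (e : nat) : nat -> nat := fun l => s aS (e * (2 * n) + l).

(** The zeros from block [d] on become the leading limbs, from [L] to [2 * n], of the next block to
    be written. *)
Definition sieve_inv (d : nat) (s : state) : Prop :=
  (forall e, 0 < e -> e < d -> divides e n ->
     (forall l, l < 2 * n -> stored s e l < beta) /\ limbs beta (2 * n) (stored s e) = D e) /\
  forall k, d * (2 * n) <= k -> s aS k = 0.

Lemma D_lt e : 0 < e -> divides e n -> D e < beta ^ e.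
Proof.
move=> e0 en; have := D_sum e0 en; rewrite (bigD1 (Ordinal (ltnSn e))) //= => E.
have : sigma ^ e < beta ^ e by rewrite ltn_exp2r.
by lia.
Qed.

(** With [P] and [N] the positive and negative parts of the coefficient, the columns add up to
    [sigma^d + N + (beta^L - 1 - P) + 1], which is [sigma^d - (P - N)] modulo [beta^L]. *)
Lemma out_prog_run s d L : 0 < d -> divides d n -> s rDiv 0 = d -> s rBeta 0 = beta ->
  s rLimb 0 = L -> d < L -> L <= 2 * d ->
  (forall l, l < L -> s aA l < beta /\ s aA (L + l) < beta) ->
  limbs beta L (s aA) = limbs beta L (fun l => s aA (L + l)) + cyclic n c d ->
  (forall l, l < 2 * n -> s aU l < beta) -> limbs beta (2 * n) (s aU) = sigma ^ d ->
  sieve_inv d s ->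
  run s out_prog (fun s' => [/\ frame [:: 2; 7; 8; aS] s s',
      forall k, k < d * (2 * n) -> s' aS k = s aS k,
      forall k, d * (2 * n) + L <= k -> s' aS k = 0,
      forall l, l < L -> stored s' d l < beta
    & limbs beta L (stored s' d) = sigma ^ d - cyclic n c d]) (15 * d).
Proof.
move=> d0 dn sd sbt sl dL Ld hA eA hU eU [hS zS]; apply: run_bounded => bs.
have V64 := ram_min ok.
have dn' : d <= n by apply: dvdn_leq.
have lt1 : 2 ^ 0 < 32 * d by rewrite expn0; lia.
have [_ _ v3 v4 v5] := cell_bounds dn' lt1.
have cyc_le : cyclic n c d <= sigma ^ d by rewrite -(D_sum d0 dn) leq_addl.
have sL : sigma ^ d < beta ^ L.
  apply: (@leq_trans (beta ^ d)); first by rewrite ltn_exp2r.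
  by rewrite leq_pexp2l; lia.
pose t l := s aU l + s aA (L + l) + (beta - 1 - s aA l).
eapply run_leT; rewrite /out_prog.
  asg; first by lia.
  eapply run_le; [apply: (run_carry ok (K := L) (pos := fun l => d * (2 * n) + l) (t := t)
      (beta := beta) (c0 := 1) (T := 2 * beta + beta))|..] => //.
  - by lia.
  - move=> l lL; have [h1 h2] := hA l lL; have h3 := hU l (ltac:(lia)); rewrite /t; lia.
  - by lia.
  - by lia.
  - by move=> j k _ _; apply: addnI.
  - by move=> k s' _ [fr _ _] _ /=; rewrite fr.
  - by move=> k s' kL [fr _ _] rk /=; rewrite rk !fr //= /upd /= sd sl sbt.
  - move=> s' _ [fr hj hp]; split.
    + apply: (@frame_trans _ _ (upd s 7 0 1)); first by apply: frame_upd.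
      by apply: frame_sub fr.
    + by move=> k kd; rewrite hp // => j jL; lia.
    + move=> k kd; rewrite hp; last by move=> j jL; lia.
      by rewrite /upd /= zS //; lia.
    + by move=> l lL; rewrite /stored hj // digit_lt; lia.
    + have -> : limbs beta L (stored s' d) = limbs beta L (digit beta t 1).
        by apply: limbs_ext => l lL; rewrite /stored hj.
      rewrite limbs_digit; last by lia.
      rewrite /t !limbsD (@limbs_prefix beta (2 * n)) ?eU //; try lia.
      move: eA; set P := limbs beta L (s 31); set N := limbs beta L _ => eA.
      have PL : P < beta ^ L by apply: limbs_lt => l lL; have [] := hA l lL.
      have Cp := limbs_compl (ltnW b1) (fun l lL => (hA l lL).1).
      rewrite -/P in Cp.
      rewrite (@limbs_ext _ _ _ (fun l => beta.-1 - s 31 l)); last by move=> l _; rewrite subn1.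
      move: (limbs beta L (fun l => beta.-1 - s 31 l)) Cp => Y Cp.
      have -> : sigma ^ d + N + Y + 1 = beta ^ L + (sigma ^ d - cyclic n c d) by lia.
      by rewrite modnDl modn_small //; lia.
lia.
Qed.

Lemma sieve_prog_run s d L : 0 < d -> divides d n -> s rDiv 0 = d -> s rBeta 0 = beta ->
  s rLimb 0 = L -> d < L -> L <= 2 * d ->
  (forall e, 0 < e -> e < d -> divides e n ->
     (forall l, l < 2 * n -> stored s e l < beta) /\ limbs beta (2 * n) (stored s e) = D e) ->
  (forall l, l < L -> stored s d l < beta) ->
  limbs beta L (stored s d) = sigma ^ d - cyclic n c d ->
  run s sieve_prog (fun s' => [/\ frame [:: 2; 7; 8; 17; 18; aS] s s',
      forall k, (k < d * (2 * n)) || (d * (2 * n) + L <= k) -> s' aS k = s aS k,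
      forall l, l < L -> stored s' d l < beta & limbs beta L (stored s' d) = D d])
    (30 * (d * d)).
Proof.
move=> d0 dn sd sbt sl dL Ld hS hd vd; apply: run_bounded => bs.
have V64 := ram_min ok.
have dn' : d <= n by apply: dvdn_leq.
have lt1 : 2 ^ 0 < 32 * d by rewrite expn0; lia.
have [_ _ v3 v4 v5] := cell_bounds dn' lt1.
have sL : sigma ^ d < beta ^ L.
  apply: (@leq_trans (beta ^ d)); first by rewrite ltn_exp2r.
  by rewrite leq_pexp2l; lia.
(* After [k] rounds the block holds [W d - W k]; since [W] is monotone, no subtraction goes below
   0. *)
pose W k := \sum_(e < k.+1 | e %| d) D e.
have WS k : W k.+1 = W k + (if k.+1 %| d then D k.+1 else 0).
  rewrite /W [LHS]big_mkcond [X in _ = X + _]big_mkcond /=.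
  by rewrite big_ord_recr.
have W0 : W 0 = 0.
  by rewrite /W big_mkcond big_ord1 /= dvd0n (_ : (d == 0) = false) //; lia.
have Wd : W d + cyclic n c d = sigma ^ d := D_sum d0 dn.
have Wmono k m : W k <= W (m + k) by elim: m => // m IHm; rewrite addSn WS; lia.
have Wk k : k < d -> W k + D d <= W d.
  move=> kd; have := WS d.-1; rewrite prednK // dvdnn => ->.
  by rewrite leq_add2r -(@subnK k d.-1) ?Wmono //; lia.
pose inv k (s' : state) := [/\ frame [:: 2; 7; 8; 17; 18; aS] s s',
  forall i, (i < d * (2 * n)) || (d * (2 * n) + L <= i) -> s' aS i = s aS i,
  forall l, l < L -> stored s' d l < beta &
  limbs beta L (stored s' d) = W d - W k].
rewrite /sieve_prog; eapply run_leT.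
  loop inv (d - 1) (fun _ : nat => 1 + (1 + (L * 5 + 2)).+1).
  - by lia.
  - split.
    + by apply: frame_upd.
    + by move=> i _; rewrite upd_ne.
    + by move=> l lL; rewrite /stored upd_ne //; apply: hd.
    + by rewrite W0 subn0 /stored !upd_other // vd -Wd addnK.
  - by move=> k s' _ [fr _ _ _] _ /=; rewrite fr // sd.
  - move=> k s1 kd [fr1 h1 h2 h3] rk; apply: run_bounded => bs1.
    have f1 j : j \notin [:: 2; 7; 8; 17; 18; aS] -> s1 j 0 = s j 0 by move=> jn; rewrite fr1.
    have b1d : s1 15 0 = d by rewrite f1.
    have b1b : s1 13 0 = beta by rewrite f1.
    have b1l : s1 10 0 = L by rewrite f1.
    apply: (run_assign_seq ok) => //=; rewrite rk addn1; first by lia.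
    set s2 := upd _ _ _ _.
    have f2 j : j != 18 -> s2 j = s1 j by move=> jn; rewrite /s2 upd_other.
    have e2 : s2 18 0 = k.+1 by [].
    apply: (run_branch ok) => //=; rewrite e2 f2 // b1d => hdv.
      apply: run_leT (_ : run _ _ _ 1) _; last by [].
      apply: run_skip; split; first by rewrite f2.
      have ndv : (k.+1 %| d) = false.
        by apply/negP => dv; apply: hdv; rewrite [_ * (d %/ _)]mulnC divnK // subnn.
      split.
      + by do 2 (apply: frame_upd => //).
      + by move=> i hi; rewrite upd_ne // f2 // h1.
      + by move=> l lL; rewrite /stored upd_ne // f2 //; apply: h2.
      + by rewrite /stored upd_other // f2 // WS ndv addn0.
    have kd1 : k.+1 < d by lia.
    have kd2 : k.+1 * (2 * n) + 2 * n <= d * (2 * n).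
      by rewrite -mulSnr leq_mul2r kd1 orbT.
    have dv : divides k.+1 d.
      by apply/dvdnP; exists (d %/ k.+1); have := leq_trunc_div d k.+1; lia.
    clear hdv; have kn : divides k.+1 n by exact: dvdn_trans dv dn.
    have [hb hD] := hS k.+1 isT kd1 kn.
    have same l : l < 2 * n -> s1 33 (k.+1 * (2 * n) + l) = stored s k.+1 l.
      by move=> ln; rewrite h1 //; apply/orP; left; apply: leq_trans kd2; rewrite ltn_add2l.
    pose t l := stored s1 d l + (beta - 1 - stored s k.+1 l).
    asg; first by lia.
    set s3 := upd _ _ _ _.
    have f3 j : j != 18 -> j != 7 -> s3 j = s1 j by move=> j1 j2; rewrite /s3 upd_other // f2.
    eapply run_le; [apply: (run_carry ok (K := L) (pos := fun l => d * (2 * n) + l) (t := t)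
      (beta := beta) (c0 := 1) (T := 2 * beta))|..] => //; try by rewrite f3.
    + by lia.
    + by move=> l lL; have := h2 l lL; rewrite /t; lia.
    + by lia.
    + by lia.
    + by move=> j i _ _; apply: addnI.
    + by move=> i s' _ [fr _ _] _ /=; rewrite fr // f3.
    + move=> i s' iL [fr _ hp] ri /=.
      rewrite ri !(fr 15 isT) !(fr 18 isT) !(fr 13 isT) (f3 15 isT isT) (f3 13 isT isT) b1d b1b.
      have -> : s3 18 0 = k.+1 by [].
      split=> //; rewrite hp; last by move=> j ji; lia.
      rewrite hp; last first.
        move=> j ji; move: (k.+1 * (2 * n)) (d * (2 * n)) kd2 => A B AB; lia.
      by rewrite (f3 33 isT isT) same //; lia.
    + move=> s' _ [fr hj hp]; split; first by rewrite fr // f3.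
      have vk : limbs beta L (stored s k.+1) = D k.+1.
        rewrite (@limbs_prefix beta (2 * n)) ?hD //; [lia|lia|].
        apply: (@leq_trans (beta ^ k.+1)); first exact: D_lt.
        by rewrite leq_pexp2l; lia.
      split.
      * apply: frame_upd => //; apply: (frame_trans fr1); apply: (@frame_trans _ _ s3).
          by do 2 (apply: frame_upd => //).
        by apply: frame_sub fr.
      * move=> i hi; rewrite upd_ne // hp; first by rewrite f3 // h1.
        by move=> j jL; lia.
      * by move=> l lL; rewrite /stored upd_ne // hj // digit_lt; lia.
      * rewrite /stored upd_other //.
        rewrite (@limbs_ext _ _ _ (digit beta t 1)); last by move=> l lL; rewrite hj.
        rewrite limbs_digit; last by lia.
        rewrite /t limbsD h3 limbs_sub_mod ?vk ?WS ?(dv : k.+1 %| d).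
        -- by rewrite subnDA.
        -- by lia.
        -- by move=> l lL; apply: hb; lia.
        -- have := Wk k.+1 kd1; rewrite WS (dv : k.+1 %| d); lia.
        -- by apply: leq_ltn_trans sL; lia.
  - move=> s' _ [fr h1 h2 h3]; split=> //; rewrite h3.
    have := WS d.-1; rewrite prednK // dvdnn subn1 => ->; by rewrite addKn.
  - exact: leqnn.
rewrite sum_nat_const card_ord; nia.
Qed.

Lemma div_prog_run s d : 0 < d -> divides d n -> s rDiv 0 = d -> s rBeta 0 = beta ->
  (forall i, i < d -> s aC i = c i) ->
  (forall l, l < 2 * n -> s aU l < beta) -> limbs beta (2 * n) (s aU) = sigma ^ d ->
  sieve_inv d s ->
  run s div_prog (fun s' => sieve_inv d.+1 s' /\
      frame ([:: 11; 12; 17; 18; aS] ++ graeffe_frame) s s')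
    (500 * (3 * (32 * d) ^ 2) + 190 * (d * d)).
Proof.
move=> d0 dn sd sbt hc hU eU inv; apply: run_bounded => bs.
have V64 := ram_min ok.
have dn' : d <= n by apply: dvdn_leq.
have lt1 : 2 ^ 0 < 32 * d by rewrite expn0; lia.
have [_ _ v3 v4 v5] := cell_bounds dn' lt1.
have [iS iz] := inv.
have fsub (L : seq nat) s1 s2 : all (fun j => j \in [:: 11; 12; 17; 18; aS] ++ graeffe_frame) L ->
    frame L s1 s2 -> frame ([:: 11; 12; 17; 18; aS] ++ graeffe_frame) s1 s2.
  by move=> h; apply: frame_sub.
rewrite /div_prog; eapply run_leT.
  apply: run_seq; eapply run_le; [apply: (size_prog_run ok sd d0 v3)|..] => //.
  move=> s1 bs1 [fr1 [S [z1 z2 dS Sd]]].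
  have [w1 w2 _ _ _] := cell_bounds dn' Sd.
  apply: run_seq; eapply run_le; [apply: (start_prog_run ok c_le (d := d))|..] => //.
  - by rewrite fr1.
  - by lia.
  - by lia.
  - by move=> i id; rewrite fr1 // hc.
  move=> s2 bs2 [fr2 e9 e10 hA hQ].
  (* The summand [3 * 3 ^ S] of [exp3_le] absorbs the additive 2. *)
  have T : 500 * (S * 3 ^ S) + 2 <= 500 * (3 * (32 * d) ^ 2).
    have := exp3_le S; have : (2 ^ S) ^ 2 <= (32 * d) ^ 2 by rewrite leq_exp2r // ltnW.
    have : 0 < 3 ^ S by rewrite expn_gt0.
    by rewrite mulnDl; lia.
  apply: run_seq; eapply run_le; [apply: (graeffe_prog_run ok n0 c_out (beta := beta) (d := d) (S := S))|..] => //;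
    try (by rewrite fr2).
  - by rewrite fr2 // fr1.
  - exact: weight_num.
  - exact: weight_den.
  - move=> s3 bs3 [fr3 [L [e10' dL Ld hl eA]]].
    have f3 j : j \notin [:: 11; 12; 17; 18; aS] ++ graeffe_frame -> s3 j =1 s j.
      move=> jn; have F : frame ([:: 11; 12; 17; 18; aS] ++ graeffe_frame) s s3.
        apply: (@frame_trans _ _ s1); first exact: fsub fr1.
        by apply: (@frame_trans _ _ s2); [exact: fsub fr2|exact: fsub fr3].
      exact: F.
    have s33 : s3 33 = s 33 by apply/funext => i; rewrite fr3 // fr2 // fr1.
    apply: run_seq; eapply run_le; [apply: (out_prog_run (d := d) (L := L))|..] => //.
    + by rewrite f3.
    + by rewrite f3.
    + by move=> l lL; rewrite f3 //; apply: hU.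
    + by rewrite -eU; apply: limbs_ext => l _; rewrite f3.
    + by split; [move=> e e0 ed en; rewrite /stored s33; exact: iS|move=> k kd; rewrite s33 iz].
    move=> s4 bs4 [fr4 g1 g2 g3 g4].
    have keep e : e < d -> forall l, l < 2 * n -> stored s4 e l = stored s e l.
      move=> ed l ln; rewrite /stored g1 ?s33 //.
      apply: (@leq_trans (e.+1 * (2 * n))); first by rewrite (mulSnr e) ltn_add2l.
      by rewrite leq_mul2r ed orbT.
    eapply run_le; [apply: (sieve_prog_run (d := d) (L := L))|..] => //.
    + by rewrite fr4 // f3.
    + by rewrite fr4 // f3.
    + by rewrite fr4.
    + move=> e e0 ed en; have [h1 h2] := iS e e0 ed en; split.
        by move=> l ln; rewrite keep //; apply: h1.
      by rewrite -h2; apply: limbs_ext => l ln; rewrite keep.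
    move=> s5 bs5 [fr5 k1 k2 k3]; split.
      split=> [e e0|k kd]; last first.
        have kk : d * (2 * n) + L <= k by apply: leq_trans kd; rewrite (mulSnr d) leq_add2l; lia.
        by rewrite k1 ?kk ?orbT // g2.
      rewrite ltnS leq_eqVlt => /orP[/eqP ->|ed] en.
        have z l : L <= l -> l < 2 * n -> stored s5 d l = 0.
          by move=> h1 h2; rewrite /stored k1 ?g2 ?leq_add2l ?h1 ?orbT.
        have Ln : L <= 2 * n by lia.
        split=> [l ln|]; last by rewrite (limbs_pad beta Ln z) k3.
        by case: (ltnP l L) => lL; [exact: k2|rewrite z //; lia].
      have keep5 l : l < 2 * n -> stored s5 e l = stored s e l.
        move=> ln; rewrite -keep // /stored k1 //; apply/orP; left.
        apply: (@leq_trans (e.+1 * (2 * n))); first by rewrite (mulSnr e) ltn_add2l.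
        by rewrite leq_mul2r ed orbT.
      have [h1 h2] := iS e e0 ed en; split.
        by move=> l ln; rewrite keep5 //; apply: h1.
      by rewrite -h2; apply: limbs_ext => l ln; rewrite keep5.
    apply: (@frame_trans _ _ s3) => [j jn i|]; first exact: f3.
    by apply: (@frame_trans _ _ s4); [exact: fsub fr4|exact: fsub fr5].
  exact: T.
have dd : d <= d * d by rewrite leq_pmulr.
by move: (500 * (3 * (32 * d) ^ 2)) (d * d) dd => X Y; lia.
Qed.

End Programs.

Notation rBord := 19 (only parsing).
Notation rDrop := 20 (only parsing).
Notation rFail := 21 (only parsing).
Notation aW := 35 (only parsing).

Definition letters_prog : cmd := for rPos << Len do fetch aW #rPos od.

(** The first letter is treated before the loop, so the letter examined is at [rPos + 1];
    [1 - (1 - x)] is the indicator of [0 < x]. *)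
Definition duval_prog : cmd :=
  rBord <- 0 ;;
  rDrop <- 1 - (1 - aW.@(0)) ;;
  rFail <- 0 ;;
  for rPos << Len - 1 do
    branch #rFail Skip
      (branch (aW.@(#rPos + 1) - aW.@(#rBord))
        (rBord <- 0 ;; rDrop <- #rPos + 2)
        (branch (aW.@(#rBord) - aW.@(#rPos + 1)) (rFail <- 1) (rBord <- #rBord + 1)))
  od.

(* The flag rFail selects between the three cases of [lowered] without branching. *)
Definition gaps_prog : cmd :=
  for rPos << Len do
    assign aC #rPos
      ((1 - #rFail * (#rPos + 1 - #rDrop)) *
       (Sgm - 1 - (aW.@(#rPos) - #rFail * (1 - (#rDrop - (#rPos + 1))))))
  od.

(** Exceeds the weights of [num0] and [den0] up to degree [n], so that both start with one limb per
    entry; for positive [n] it also exceeds [sigma]. *)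
Definition base (n sigma : nat) : nat := 4 * n * n * sigma + 2.

Definition init_prog : cmd :=
  letters_prog ;; duval_prog ;; gaps_prog ;;
  rBeta <- 4 * Len * Len * Sgm + 2 ;; assign aU 0 1.

(** * Reading the word and computing the gaps *)

Section Programs.

Variables (n sigma : nat) (ws : seq nat) (M : machine) (V : nat).
Hypothesis ok : ram_spec n sigma ws M V.

Notation run := (run n sigma ws M V).
Notation bounded := (bounded V).
Notation den := (den n sigma).

Lemma run_fetch s j i (Q : state -> Prop) : wf i -> degree i + 2 <= max_degree ->
  j < arrays -> j != big_cell -> 2 * duration i + 20 <= unit_time -> den s i < n ->
  Q (upd s j (den s i) (nth 0 ws (den s i))) -> run s (fetch j i) Q 1.
Proof.
move=> wi di jlt jb le lin q bs.
have [ev dV] := eval_ok ok bs wi; have VD := V_le ok; have nV := ram_n ok.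
have V64 := ram_min ok.
have ev2 := eval_address ok jlt di ev dV; have [loc1 _ _] := wf_address ok di jlt dV.
have xV : nth 0 ws (den s i) <= V ^ max_degree := leq_trans (ram_letter ok _) VD.
have c2 : 2 <= V ^ max_degree by lia.
have ex3 : den s i + 2 <= V ^ max_degree.
  have /(leq_trans _) : location n j (den s i) <= V ^ max_degree := loc1.
  by apply; rewrite /location /arrays; lia.
have iD : den s i <= V ^ max_degree by lia.
have ev3 := eval_arith ok (o := Add) ev (eval_const ok _ c2) iD c2 ex3.
have ev4 := eval_read ok ev3 ex3.
rewrite [arith_op _ _ _]/= (mem_letter ok s lin) in ev4.
exists (upd s j (den s i) (nth 0 ws (den s i))), (duration i + 7 + (duration i + 1 + 1 + 1) + 1).
split=> //.
- rewrite -(mem_upd ok) //; apply: ExecWrite ev2 (ev4 xV) _ _; first exact: (ram_addressable ok).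
  exact: (ram_charge ok).
- by apply: bounded_upd => //; apply: (ram_letter ok).
- by move: le; rewrite /unit_time muln1; lia.
Qed.

Notation w := (nth 0 ws).

Lemma letters_prog_run s : run s letters_prog
  (fun s' => frame [:: 2; aW] s s' /\ forall i, i < n -> s' aW i = w i) (3 * n + 2).
Proof.
have nV := ram_n ok.
pose inv k (s' : state) := frame [:: 2; aW] s s' /\ forall i, i < k -> s' aW i = w i.
rewrite /letters_prog; eapply run_leT.
  loop_const inv n 1.
  - by [].
  - by split=> //; apply: frame_upd.
  - by [].
  - move=> k s1 kn [fr h] rk; apply: run_fetch => //=; rewrite rk //.
    split; first by rewrite upd_ne.
    split; first by do 2 (apply: frame_upd => //).
    move=> i; rewrite /upd /= ltnS; case: eqP => [-> //|ne] ik; apply: h; lia.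
  - by move=> s' _ [].
  - exact: leqnn.
by lia.
Qed.

Lemma duval_prog_run s : 0 < n -> (forall i, i < n -> s aW i = w i) ->
  run s duval_prog (fun s' => [/\ frame [:: 2; 19; 20; 21] s s', s' rFail 0 <= 1
    & duval_inv w n (s' rBord 0) (s' rDrop 0) (s' rFail 0)]) (10 * n).
Proof.
move=> n0 hw; have nV := ram_n ok; have V64 := ram_min ok.
pose inv k (s' : state) := [/\ frame [:: 2; 19; 20; 21] s s', s' rFail 0 <= 1, s' rBord 0 <= k
    & duval_inv w k.+1 (s' rBord 0) (s' rDrop 0) (s' rFail 0)].
rewrite /duval_prog; eapply run_leT.
  asg; first by lia.
  asg; first by lia.
  asg; first by lia.
  loop_const inv (n - 1) 4.
  - by lia.
  - split=> //.
    + by do 4 (apply: frame_upd => //).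
    + rewrite /upd /= hw //; have := duval_init w.
      by rewrite (_ : 1 - (1 - w 0) = (0 < w 0)) //; case: (w 0) => // x; lia.
  - by [].
  - move=> k s1 kn [fr f1 qk di] rk.
    have hw1 i : i < n -> s1 aW i = w i by move=> lin; rewrite fr // hw.
    have done s2 : frame [:: 2; 19; 20; 21] s s2 -> s2 rFail 0 <= 1 -> s2 rBord 0 <= k.+1 ->
        s2 2 0 = k ->
        (s2 rBord 0, s2 rDrop 0, s2 rFail 0) =
          duval_step w k.+1 (s1 rBord 0, s1 rDrop 0, s1 rFail 0) ->
        s2 2 0 = k /\ inv k.+1 (upd s2 2 0 k.+1).
      move=> fr2 f2 q2 r2 e2; split=> //; split=> //; first by apply: frame_upd.
      by rewrite !upd_ne //; have := duval_next (ltn0Sn k) di; rewrite -e2.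
    have k1n : k.+1 < n by lia.
    have qn : s1 19 0 < n by lia.
    apply: (run_branch ok) => //= h1.
      apply: run_leT (_ : run _ _ _ 1) _; last by [].
      apply: run_skip; apply: done => //; first by lia.
      by rewrite /duval_step; case: eqP h1.
    apply: (run_branch ok) => //=; rewrite rk addn1 !hw1 // => h2.
      eapply run_leT.
        asg; first by lia.
        apply: (run_assign ok) => //; first by rewrite /= upd_ne // rk; lia.
        apply: done => //=.
        + by do 2 (apply: frame_upd => //).
        + by rewrite /duval_step h1 /= (_ : w (s1 19 0) < w k.+1); [rewrite /upd /= rk h1 addn2|lia].
      by [].
    apply: (run_branch ok) => //=; rewrite rk addn1 !hw1 // => h3.
      apply: (run_assign ok) => //=; first by lia.
      apply: done => //; first by do 2 (apply: frame_upd => //).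
      + by rewrite upd_ne //; lia.
      + rewrite /duval_step h1 /= (_ : (w (s1 19 0) < w k.+1) = false); last by lia.
        by rewrite (_ : w k.+1 < w (s1 19 0)) //; lia.
    apply: (run_assign ok) => //=; first by lia.
    apply: done => //; first by do 2 (apply: frame_upd => //).
    + by rewrite /upd /=; lia.
    + rewrite /duval_step h1 /= (_ : (w (s1 19 0) < w k.+1) = false); last by lia.
      rewrite (_ : (w k.+1 < w (s1 19 0)) = false); last by lia.
      by rewrite /upd /= h1 addn1.
  - by move=> s' _ [fr f1 _ di]; split=> //; move: di; rewrite subn1 prednK.
  - exact: leqnn.
by lia.
Qed.

Lemma gaps_prog_run s q k fl : 0 < n -> (forall i, i < n -> s aW i = w i) ->
  (forall i, i < n -> w i < sigma) ->
  s rDrop 0 = k -> s rFail 0 = fl -> fl <= 1 -> duval_inv w n q k fl ->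
  run s gaps_prog (fun s' => frame [:: 2; aC] s s' /\
    forall i, i < n -> s' aC i = sigma.-1 - lowered w sigma k fl i) (3 * n + 2).
Proof.
move=> n0 hw wlt sk sfl fl1 di; have nV := ram_n ok; have V64 := ram_min ok.
have sV := ram_sigma ok.
eapply run_le; [apply: (run_fill ok (N := n) (pos := id)
  (val := fun i => sigma.-1 - lowered w sigma k fl i))|..] => //.
- move=> i s' lin [fr _ _] ri bs' /=; rewrite ri !fr // sk sfl hw //; split=> //; last by lia.
  have wi := wlt i lin; rewrite /lowered; move: di; rewrite /duval_inv.
  case: eqP => [-> _|f0 [k0 _]]; first by rewrite mul0n subn0 mul1n; lia.
  have -> : fl = 1 by lia.
  rewrite !mul1n; case: ltnP => h; first by nia.
  by case: eqP => h'; nia.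
- by move=> s' _ [fr h _]; split.
- by lia.
Qed.

Lemma init_prog_run : 0 < n -> (forall i, i < n -> w i < sigma) -> base n sigma <= V ->
  run (fun _ _ => 0) init_prog (fun s => exists q k fl, [/\ duval_inv w n q k fl,
    forall i, i < n -> s aC i = sigma.-1 - lowered w sigma k fl i,
    s rBeta 0 = base n sigma, s aU = (fun i => nat_of_bool (i == 0))
    & forall i, s aS i = 0 /\ s big_cell i = 0]) (25 * n).
Proof.
move=> n0 wlt bV; have nV := ram_n ok; have V64 := ram_min ok.
rewrite /init_prog; eapply run_leT.
  apply: run_seq; eapply run_le; [exact: letters_prog_run| |exact: leqnn].
  move=> s1 _ [fr1 hw1].
  apply: run_seq; eapply run_le; [exact: (duval_prog_run n0 hw1)| |exact: leqnn].
  move=> s2 _ [fr2 f2 di].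
  have hw2 i : i < n -> s2 aW i = w i by move=> lin; rewrite fr2 // hw1.
  apply: run_seq; eapply run_le.
  - by apply: (gaps_prog_run n0 hw2 wlt erefl erefl f2 di).
  - move=> s3 _ [fr3 hc].
    asg; first by rewrite -/(base n sigma).
    apply: (run_assign ok) => //=; first by lia.
    exists (s2 19 0), (s2 20 0), (s2 21 0); split=> //.
    + apply/funext => i; rewrite /upd /=; case: eqP => // _.
      by rewrite fr3 // fr2 // fr1.
    + by move=> i; rewrite !upd_ne // !fr3 // !fr2 // !fr1.
  - exact: leqnn.
by lia.
Qed.

End Programs.

Lemma weight_leq m x b : (forall e, e < 2 * m.+1 -> x e <= b) -> weight m x <= 2 * m.+1 * b.
Proof.
move=> h; have -> : 2 * m.+1 * b = \sum_(e < 2 * m.+1) b by rewrite sum_nat_const card_ord.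
by apply: leq_sum => -[e elt] _; apply: h.
Qed.

Section Weights.

Variables (n sigma : nat) (c : nat -> nat).
Hypotheses (n0 : 0 < n) (c_le : forall i, c i <= sigma).

Lemma weight_num0_lt d : d <= n -> weight d (num0 c) < base n sigma.
Proof.
move=> dn; apply: leq_ltn_trans (_ : 2 * d.+1 * (n * sigma) < _).
  apply: weight_leq => e elt; rewrite /num0; case: ifP => // _.
  by apply: leq_mul => //; lia.
rewrite /base; have : 2 * d.+1 * (n * sigma) <= 4 * n * (n * sigma) by rewrite leq_mul2r; lia.
by lia.
Qed.

Lemma weight_den0_lt d : d <= n -> weight d (den0 c) < base n sigma.
Proof.
move=> dn; apply: leq_ltn_trans (_ : 1 + 2 * d.+1 * sigma < _); last first.
  have : 2 * d.+1 * sigma <= 4 * n * n * sigma by rewrite leq_mul2r; nia.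
  by rewrite /base; lia.
rewrite /weight; have -> : 2 * d.+1 = (2 * d + 1).+1 by lia.
rewrite big_ord_recl leq_add //.
apply: leq_trans (_ : (2 * d + 1) * sigma <= _); last by rewrite leq_mul2r; lia.
rewrite -[X in _ <= X * _]card_ord -sum_nat_const; apply: leq_sum => i _.
by rewrite /den0 /=; case: ifP.
Qed.

End Weights.

Definition square_sum (n m : nat) : nat := \sum_(i < m) (if i.+1 %| n then i.+1 * i.+1 else 0).

(* If d = n / e, the next smaller divisor is at most n / (e + 1), so the gap
   below d pays for the square of d. *)
Lemma square_sum_le n m : 0 < n -> square_sum n m <= 2 * m * n.
Proof.
move=> n0; have step k : square_sum n k.+1 = square_sum n k + (if k.+1 %| n then k.+1 * k.+1 else 0).
  by rewrite /square_sum big_ord_recr.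
have [N] := ubnP m; elim: N m => // N IHN [|m] mN; first by rewrite /square_sum big_ord0.
have IH k : k <= m -> square_sum n k <= 2 * k * n by move=> km; apply: IHN; lia.
rewrite step; case: ifP => [/dvdnP[e nE]|_]; last by have := IH m (leqnn m); lia.
have e0 : 0 < e by lia.
set k := n %/ e.+1.
have ke : k * e.+1 <= e * m.+1 by rewrite /k -nE leq_trunc_div.
have km : k <= m by nia.
have -> : square_sum n m = square_sum n k.
  have gap i : k + i <= m -> square_sum n (k + i) = square_sum n k.
    elim: i => [|i IHi] im; first by rewrite addn0.
    rewrite addnS step ifF ?addn0 ?IHi //; first by lia.
    apply/negP => /dvdnP[f fE]; have kl : n < (k.+1) * e.+1.
      by rewrite /k -ltn_divLR.
    have ef : e < f by rewrite ltnNge; apply/negP => fe; nia.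
    nia.
  by rewrite -(gap (m - k)) subnKC.
have := IH k km; rewrite nE; nia.
Qed.

Notation rMain := 14 (only parsing).

(** [aU] holds [sigma ^ rDiv] in limbs; one multiplication by [sigma] per round keeps it ready for
    the divisors. *)
Definition main_prog : cmd :=
  for rMain << Len do
    rDiv <- #rMain + 1 ;;
    rCy <- 0 ;;
    carry_loop (2 * Len) (aU.@(#rPos) * Sgm) aU #rPos ;;
    branch (Len - #rDiv * (Len / #rDiv)) Skip div_prog
  od.

(** * The loop over divisors and its total cost *)

Section Programs.

Variables (n sigma : nat) (ws : seq nat) (M : machine) (V : nat).
Hypothesis ok : ram_spec n sigma ws M V.

Notation run := (run n sigma ws M V).

Variables (c D : nat -> nat) (beta : nat).
Hypotheses (n0 : 0 < n) (c_le : forall i, c i <= beta) (c_out : forall i, n <= i -> c i = 0).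
Hypotheses (b1 : 1 < beta) (sb : sigma < beta) (HV : 4 * ((32 * n) ^ 3 * beta ^ 2) <= V).
Hypothesis weight_num : forall d, d <= n -> weight d (num0 c) < beta.
Hypothesis weight_den : forall d, d <= n -> weight d (den0 c) < beta.
Hypothesis D_sum : forall d, 0 < d -> divides d n ->
  \sum_(e < d.+1 | e %| d) D e + cyclic n c d = sigma ^ d.

Let main_frame : seq nat := rMain :: rDiv :: aU :: [:: 11; 12; 17; 18; aS] ++ graeffe_frame.

Variable div_cost : nat.
Hypothesis div_time : forall d, 500 * (3 * (32 * d) ^ 2) + 190 * (d * d) <= div_cost * (d * d).

Lemma main_prog_run s : s rBeta 0 = beta -> (forall i, i < n -> s aC i = c i) ->
  s aU = (fun l => nat_of_bool (l == 0)) -> (forall i, s aS i = 0) ->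
  run s main_prog (fun s' => frame main_frame s s' /\ sieve_inv n D beta n.+1 s')
    ((2 * div_cost + 30) * (n * n)).
Proof.
move=> sbt hc hU hS; have V64 := ram_min ok; have nV := ram_n ok.
have [n2V bV] : 2 * n <= V /\ 2 * (beta * sigma + beta) <= V.
  have a1 : 32 * n <= (32 * n) ^ 3 by rewrite -{1}(expn1 (32 * n)) leq_exp2l //; lia.
  have a2 : 0 < beta ^ 2 by rewrite expn_gt0; lia.
  have a3 : (32 * n) <= (32 * n) ^ 3 * beta ^ 2 by apply: leq_trans a1 _; rewrite leq_pmulr.
  have a4 : beta ^ 2 <= (32 * n) ^ 3 * beta ^ 2 by rewrite leq_pmull // expn_gt0; lia.
  have a5 : beta * sigma + beta <= beta ^ 2 by rewrite -mulnSr expnS expn1 leq_mul2l sb orbT.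
  split; lia.
pose inv k (s' : state) := [/\ frame main_frame s s', forall l, l < 2 * n -> s' aU l < beta,
  limbs beta (2 * n) (s' aU) = sigma ^ k & sieve_inv n D beta k.+1 s'].
pose cost k := if k.+1 %| n then div_cost * (k.+1 * k.+1) else 0.
rewrite /main_prog; eapply run_leT.
  loop inv n (fun k => (2 * n * 5 + 2 + (3 + cost k).+1).+2).
  - by [].
  - split.
    + by apply: frame_upd.
    + by move=> l _; rewrite /upd /= hU; case: (l == 0); lia.
    + have n1 : 1 <= 2 * n by lia.
      rewrite upd_other // hU (limbs_pad beta n1) => [|[]//].
      by rewrite limbsS /limbs big_ord0.
    + split=> [e e0 e1|k _]; first by lia.
      by rewrite upd_ne.
  - by [].
  - move=> k s1 kn [fr hb hl [iS iz]] rk.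
    asg; first by rewrite rk; lia.
    asg; first by lia.
    set s2 := upd _ 7 0 0.
    have f2 j : j != 15 -> j != 7 -> s2 j = s1 j by move=> j1 j2; rewrite /s2 !upd_other.
    have b2 : s2 13 0 = beta by rewrite f2 // fr.
    have d2 : s2 15 0 = k.+1 by rewrite /s2 /upd /= rk addn1.
    apply: run_seq; eapply run_le; [apply: (run_carry ok (K := 2 * n) (pos := id)
      (t := fun l => s1 aU l * sigma) (beta := beta) (c0 := 0) (T := beta * sigma + beta))|..] => //.
    + by move=> l ln; have := leq_mul (ltnW (hb l ln)) (leqnn sigma); lia.
    + move=> l s' ln [fr' _ hp] rl /=; rewrite rl; split=> //.
      by rewrite hp ?f2 // => j jl; lia.
    + move=> s3 _ [fr3 hj _].
      have f3 j : j \notin [:: 2; 7; 8; 34] -> j != 15 -> s3 j =1 s1 j.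
        move=> j1 j2 i; rewrite fr3 // f2 //; apply: contra j1 => /eqP ->; by rewrite !inE.
      have F3 : frame main_frame s s3.
        move=> j jn i; rewrite f3 ?fr //; apply: contra jn.
          by rewrite !inE => /or4P[] /eqP ->.
        by move=> /eqP ->; rewrite !inE.
      have d3 : s3 15 0 = k.+1 by rewrite fr3.
      have m3 : s3 14 0 = k by rewrite f3.
      have s33 : s3 33 = s1 33 by apply/funext => i; rewrite f3.
      have U3 : limbs beta (2 * n) (s3 34) = sigma ^ k.+1.
        rewrite (@limbs_ext _ _ _ (digit beta (fun l => s1 34 l * sigma) 0)); last first.
          by move=> l ln; rewrite hj.
        rewrite limbs_digit; last by lia.
        have -> : limbs beta (2 * n) (fun l => s1 34 l * sigma) = sigma ^ k.+1.
          rewrite expnSr -hl /limbs big_distrl /=; apply: eq_bigr => l _; exact: mulnAC.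
        rewrite addn0 modn_small //; apply: (@leq_trans (beta ^ k.+1)); first by rewrite ltn_exp2r.
        by rewrite leq_pexp2l; lia.
      have B3 l : l < 2 * n -> s3 34 l < beta by move=> ln; rewrite hj // digit_lt; lia.
      have I3 : sieve_inv n D beta k.+1 s3.
        by split=> [e e0 ek en|i ik]; rewrite /stored s33; [exact: iS|exact: iz].
      apply: (run_branch ok (T := (3 + cost k))) => //=; rewrite d3 => hdv.
        apply: run_leT (_ : run _ _ _ 1) _; last by lia.
        apply: run_skip; split=> //; split.
        * by apply: frame_upd.
        * by move=> l ln; rewrite upd_ne //; apply: B3.
        * by rewrite upd_other.
        * split=> [e e0|i ik]; rewrite /stored upd_other //; last first.
            by rewrite s33 iz //; apply: leq_trans ik; rewrite leq_mul2r leqnSn orbT.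
          rewrite ltnS leq_eqVlt => /orP[/eqP -> dv|]; last by case: I3 => I3 _; apply: I3.
          by case: hdv; rewrite mulnC divnK // subnn.
      have dv : divides k.+1 n.
        by apply/dvdnP; exists (n %/ k.+1); have := leq_trunc_div n k.+1; lia.
      clear hdv.
      have costE : cost k = div_cost * (k.+1 * k.+1) by rewrite /cost (dv : k.+1 %| n).
      rewrite costE.
      eapply run_le; [apply: (div_prog_run ok n0 c_le c_out b1 sb HV weight_num weight_den
        D_sum (d := k.+1))|..] => //.
      * by rewrite f3 ?fr.
      * move=> i ik; rewrite f3 ?fr // hc //; lia.
      * move=> s4 _ [I4 fr4]; split; first by rewrite fr4.
        split.
        -- apply: frame_upd => //; apply: (frame_trans F3); apply: frame_sub fr4; by [].
        -- by move=> l ln; rewrite upd_ne // fr4 //; apply: B3.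
        -- by rewrite upd_other // -U3; apply: limbs_ext => l _; rewrite fr4.
        -- by case: I4 => I4 z4; split=> [e e0 ek en|i ik]; rewrite /stored upd_other //;
             [exact: I4|exact: z4].
      * by apply: leq_trans (div_time _) _; lia.
  - by move=> s' _ [fr _ _ I]; split.
  - exact: leqnn.
rewrite (eq_bigr (fun k : 'I_n => 10 * n + 10 + cost k)); last by move=> k _; lia.
rewrite big_split /= sum_nat_const card_ord.
have -> : \sum_(k < n) cost k = div_cost * square_sum n n.
  rewrite /square_sum big_distrr /=; apply: eq_bigr => k _; rewrite /cost.
  by case: ifP => _; rewrite ?muln0.
have := leq_mul (leqnn div_cost) (square_sum_le n n0).
have : n <= n * n by rewrite leq_pmulr.
have -> : (2 * div_cost + 30) * (n * n) = div_cost * (2 * n * n) + 30 * (n * n).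
  by rewrite mulnDl -!mulnA mulnCA.
move: (div_cost * _) (div_cost * _) => X Y nn XY; nia.
Qed.

End Programs.

Notation rRem := 25 (only parsing).

Definition big_address : expr := address big_cell (Const 0).

Definition append_limb : cmd :=
  Write big_address
    (Arith Add (Arith Mul (Read big_address) (compile #rBeta)) (compile (#rTmp / Len))).

(* Long division by n of the number stored in block n of [aS], top limb first. *)
Definition output_prog : cmd :=
  rRem <- 0 ;;
  for rPos << 2 * Len do
    rTmp <- #rRem * #rBeta + aS.@(Len * (2 * Len) + (2 * Len - 1 - #rPos)) ;;
    append_limb ;;
    rRem <- #rTmp - Len * (#rTmp / Len)
  od.

Definition lynd_prog : cmd :=
  (init_prog ;; main_prog ;; output_prog) ;; Write (Const 0) (Read big_address).

Definition affordable (M : machine) (n v : nat) : Prop := exists2 c, charge M v = Some c & c <= n.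

Definition top_limbs (beta N : nat) (f : nat -> nat) (p : nat) : nat :=
  limbs beta p (fun l => f (N - p + l)).

Lemma top_limbsS beta N f p : p < N ->
  top_limbs beta N f p.+1 = top_limbs beta N f p * beta + f (N - 1 - p).
Proof.
move=> pN; rewrite /top_limbs /limbs big_ord_recl /= expn0 muln1 addn0 addnC; congr addn.
  rewrite big_distrl; apply: eq_bigr => i _ /=; rewrite /bump /= expnS -mulnA (mulnC beta).
  by congr (f _ * _); lia.
by congr f; lia.
Qed.

Lemma top_limbs_le beta N f p : 0 < beta -> p <= N -> top_limbs beta N f p <= limbs beta N f.
Proof.
move=> b0 pN; have -> : limbs beta N f = top_limbs beta N f N.
  by rewrite /top_limbs subnn.
have step d : p + d <= N -> top_limbs beta N f p <= top_limbs beta N f (p + d).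
  elim: d => [|d IHd] le; first by rewrite addn0.
  rewrite addnS top_limbsS; last by lia.
  apply: leq_trans (IHd _) _; first by lia.
  by apply: leq_trans (leq_addr _ _); rewrite leq_pmulr.
by have := step (N - p); rewrite subnKC //; exact.
Qed.

(** * Assembling the result as a single large number *)

Section Programs.

Variables (n sigma : nat) (ws : seq nat) (M : machine) (V : nat).
Hypothesis ok : ram_spec n sigma ws M V.
Hypothesis n0 : 0 < n.
Hypothesis big : forall v, v <= sigma ^ n -> affordable M n v.

Notation run := (run n sigma ws M V).
Notation mem := (mem n sigma ws).

Lemma affordable_small v : v <= V ^ max_degree -> affordable M n v.
Proof. by move=> vV; exists 1 => //; apply: (ram_charge ok). Qed.

Lemma affordable_max u v : affordable M n u -> affordable M n v -> affordable M n (maxn u v).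
Proof. by rewrite /maxn; case: ifP. Qed.

Lemma eval_big_address s : eval M (mem s) big_address = Some (location n big_cell 0, 8).
Proof.
apply: (eval_address ok (e := Cst 0) (x := 0) (t := 1)) => //.
by apply: (eval_const ok).
Qed.

Lemma eval_big s : affordable M n (s big_cell 0) ->
  exists2 t, eval M (mem s) (Read big_address) = Some (s big_cell 0, t) & t <= 8 + n.
Proof.
move=> [c ec cn]; exists (8 + c); last by rewrite leq_add2l.
have [loc1 _ _] := wf_address ok (e := Cst 0) isT (j := big_cell) (x := 0) isT (leq0n _).
move: big_address (eval_big_address s) => a ea; rewrite /= ea (ram_addressable ok) //.
by rewrite (mem_location ok) // ec.
Qed.

(** The old value and its multiple by the base are bounded by the new value [b], so every operation
    is affordable as soon as [b <= sigma ^ n]. *)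
Lemma run_append_limb s (Q : state -> Prop) :
  let b := s big_cell 0 * s rBeta 0 + s rTmp 0 %/ n in
  0 < s rBeta 0 -> b <= sigma ^ n -> Q (upd s big_cell 0 b) -> run s append_limb Q n.
Proof.
move=> b beta0 bn q bs.
have V64 := ram_min ok.
have B1 : s big_cell 0 * s rBeta 0 <= sigma ^ n by apply: leq_trans bn; exact: leq_addr.
have B0 : s big_cell 0 <= sigma ^ n by apply: leq_trans B1; rewrite leq_pmulr.
have [t1 e1 l1] := eval_big (big B0).
have [e2 d2] : eval M (mem s) (compile #rBeta) = Some (s rBeta 0, 9) /\ s rBeta 0 <= V ^ 1.
  exact: (eval_ok ok bs (e := (#rBeta)%ram) isT).
have [e3 d3] : eval M (mem s) (compile (#rTmp / Len)) = Some (s rTmp 0 %/ n, 12) /\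
    s rTmp 0 %/ n <= V ^ 1.
  exact: (eval_ok ok bs (e := (#rTmp / Len)%ram) isT).
have small x e : wf e -> x <= V ^ degree e -> affordable M n x.
  move=> we h; apply: affordable_small; apply: leq_trans h _.
  by rewrite leq_pexp2l ?wf_degree //; lia.
have [c4 e4 l4] : affordable M n (maxn (maxn (s big_cell 0) (s rBeta 0)) (s big_cell 0 * s rBeta 0)).
  by do 2?apply: affordable_max; try exact: big; exact: (small _ (#rBeta)%ram).
have [c5 e5 l5] : affordable M n (maxn (maxn (s big_cell 0 * s rBeta 0) (s rTmp 0 %/ n)) b).
  by do 2?apply: affordable_max; try exact: big; exact: (small _ (#rTmp / Len)%ram).
have [c6 e6 l6] := big bn.
have [loc1 _ _] := wf_address ok (e := Cst 0) isT (j := big_cell) (x := 0) isT (leq0n _).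
exists (upd s big_cell 0 b), (8 + (t1 + 9 + c4 + 12 + c5) + c6); split=> //.
- rewrite -(mem_upd ok) //; apply: ExecWrite (eval_big_address s) _ _ e6; last first.
    exact: (ram_addressable ok).
  have E : eval M (mem s) (Arith Mul (Read big_address) (compile #rBeta)) =
      Some (s big_cell 0 * s rBeta 0, t1 + 9 + c4).
    by move: (Read _) (compile _) e1 e2 => x y e1 e2; rewrite /= e1 e2 /= e4.
  move: E e3; move: (Arith Mul _ _) (compile (#rTmp / Len)) => x y E e3.
  by rewrite /= E e3 /= e5.
- by move=> j i jlt jb; rewrite upd_ne //; exact: bs.
- by rewrite /unit_time; nia.
Qed.

Lemma output_prog_run s beta X : s rBeta 0 = beta -> 1 < beta -> 2 * n <= V -> n * beta + beta <= V ->
  s big_cell 0 = 0 -> (forall l, l < 2 * n -> stored n s n l < beta) ->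
  limbs beta (2 * n) (stored n s n) = X -> X <= sigma ^ n ->
  run s output_prog (fun s' => s' big_cell 0 = X %/ n) (20 * (n * n)).
Proof.
move=> sb b1 n2V nbV sz sl <-; set X' := limbs _ _ _ => Xn; have V64 := ram_min ok.
pose top := top_limbs beta (2 * n) (stored n s n).
pose inv k (s' : state) := [/\ frame [:: 2; 24; 25; big_cell] s s', s' rRem 0 = top k %% n
  & s' big_cell 0 = top k %/ n].
rewrite /output_prog; eapply run_leT.
  asg; first by lia.
  loop_const inv (2 * n) (1 + n).+1.
  - by [].
  - have t0 : top 0 = 0 by rewrite /top /top_limbs /limbs big_ord0.
    split; first by do 2 (apply: frame_upd => //).
      by rewrite t0 mod0n.
    by rewrite t0 div0n.
  - by [].
  - move=> k s1 kn [fr er eb] rk; apply: run_bounded => bs1.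
    have b2 : s1 13 0 = beta by rewrite fr.
    have limb : s1 33 (n * (2 * n) + (2 * n - 1 - k)) = stored n s n (2 * n - 1 - k) by rewrite fr.
    have lb : stored n s n (2 * n - 1 - k) < beta by apply: sl; lia.
    set acc := s1 25 0 * beta + stored n s n (2 * n - 1 - k).
    have accV : acc <= V.
      have : s1 25 0 * beta <= n * beta by rewrite leq_mul2r er ltnW ?orbT // ltn_mod.
      by rewrite /acc; lia.
    (* Hence the next quotient digit and the next remainder are those of [acc], which fits in a
       cell. *)
    have topS : top k.+1 = top k %/ n * beta * n + acc.
      rewrite /top top_limbsS // -/(top k) {1}(divn_eq (top k) n) -er /acc; lia.
    asg; first by rewrite b2 rk limb.
    rewrite b2 rk limb -/acc; set s2 := upd _ _ _ _.
    have bE : s2 big_cell 0 * s2 rBeta 0 + s2 rTmp 0 %/ n = top k.+1 %/ n.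
      by rewrite topS divnMDl // /s2 /upd /= eb b2.
    have bn : top k.+1 %/ n <= sigma ^ n.
      apply: leq_trans (leq_div _ _) _; apply: leq_trans Xn.
      by apply: top_limbs_le; [lia|].
    rewrite -[(1 + n)]addnC; apply: run_seq; apply: run_append_limb; rewrite ?bE //.
      by rewrite /s2 upd_ne // b2; lia.
    apply: (run_assign ok) => //; rewrite /= ?upd_ne //.
      by apply: leq_trans (leq_subr _ _) _.
    split; first by rewrite /s2 !upd_ne.
    split.
    + by do 4 (apply: frame_upd => //).
    + rewrite topS modnMDl.
      have E : acc - n * (acc %/ n) = acc %% n by rewrite {1}(divn_eq acc n) mulnC addKn.
      exact: E.
    + by rewrite /upd /=.
  - by move=> s' _ [_ _ ->]; rewrite /top /top_limbs subnn.
  - exact: leqnn.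
nia.
Qed.

End Programs.

(** Common to both models: the machine enters only through [ram_spec] and [affordable], and [C] is
    chosen before it. *)
Lemma lynd_prog_correct : exists C, forall (sigma n : nat) (w : n.-tuple 'I_sigma) (M : machine) (V : nat),
  0 < n -> ram_spec n sigma (map val w) M V ->
  4 * ((32 * n) ^ 3 * base n sigma ^ 2) <= V ->
  (forall v, v <= sigma ^ n -> affordable M n v) ->
  computes_within M lynd_prog (input w) (Lynd w) (C * n ^ 2).
Proof.
have [K K_time] : exists K, forall d, 500 * (3 * (32 * d) ^ 2) + 190 * (d * d) <= K * (d * d).
  by exists (500 * (3 * 32 ^ 2) + 190) => d; rewrite expnMn mulnDl -!mulnA mulnn.
exists (500 * (2 * K + 80)) => sigma n w M V n0 ok HV big.
set ws := map val w in ok; set beta := base n sigma in HV.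
have w_lt i : i < n -> nth 0 ws i < sigma.
  by move=> lin; rewrite (nth_map (tnth w (Ordinal lin))) ?size_tuple // ltn_ord.
have b1 : 1 < beta by rewrite /beta /base; lia.
have sb : sigma < beta.
  by rewrite /beta /base; have : 1 * sigma <= 4 * n * n * sigma; [rewrite leq_mul2r; nia|lia].
have e1 : 32 * n <= (32 * n) ^ 3 by rewrite -{1}(expn1 (32 * n)) leq_exp2l //; lia.
have e2 : beta <= beta ^ 2 by rewrite -{1}(expn1 beta) leq_exp2l.
have nbV : 32 * n * beta <= V.
  by have := leq_mul e1 e2; move: ((32 * n) ^ 3 * beta ^ 2) HV => X; lia.
have bV : beta <= V by apply: leq_trans nbV; rewrite leq_pmull //; lia.
have n2V : 2 * n <= V by apply: leq_trans nbV; nia.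
have nbV' : n * beta + beta <= V by apply: leq_trans nbV; nia.
have RUN : run n sigma ws M V (fun _ _ => 0) (init_prog ;; main_prog ;; output_prog)
    (fun s => s big_cell 0 = Lynd w) ((2 * K + 75) * (n * n)).
  eapply run_leT.
    apply: run_seq; eapply run_le; [exact: (init_prog_run ok n0 w_lt bV)| |exact: leqnn].
    move=> s1 _ [q [k [fl [di hc sbt hU h0]]]].
    pose v := lowered (nth 0 ws) sigma k fl.
    pose c i := if i < n then sigma.-1 - v i else 0.
    pose D e := #|low_words sigma v n0 e|.
    have c_sigma i : c i <= sigma by rewrite /c; case: ifP => // _; lia.
    have c_le i : c i <= beta by apply: leq_trans (c_sigma i) (ltnW sb).
    have c_out i : n <= i -> c i = 0 by rewrite /c ltnNge => ->.
    have cE i : i < n -> c i = sigma.-1 - v i by rewrite /c => ->.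
    have pv : prenecklace v n := lowered_prenecklace n0 w_lt di.
    have v_lt i : i < n -> v i < sigma by exact: lowered_lt.
    have D_sum d : 0 < d -> divides d n ->
        \sum_(e < d.+1 | e %| d) D e + cyclic n c d = sigma ^ d.
      by move=> d0 dn; apply: (sum_low_words n0 pv v_lt cE c_out d0 dn).
    have Dn : D n = n * Lynd w.
      apply: card_low_words => x nx.
      have cx i : i < n -> cyc x i < sigma.
        by move=> lin; rewrite letter_cyc ?letter_lt ?size_tuple.
      apply: iff_trans (lexgt_lowered n0 di cx (necklace_prenecklace nx)).
      have ew i : i < n -> cyc w i = nth 0 ws i by move=> lin; rewrite letter_cyc ?size_tuple.
      by split; apply: lexgt_ext => // i lin; rewrite ew.
    have Dle : D n <= sigma ^ n.
      rewrite -(D_sum n n0 (dvdnn n)) (bigD1 (Ordinal (ltnSn n))) ?dvdnn //= -addnA.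
      exact: leq_addr.
    apply: run_seq; eapply run_le.
    - apply: (main_prog_run ok n0 c_le c_out b1 sb HV _ _ D_sum K_time) => //.
      + by move=> d dn; apply: weight_num0_lt.
      + by move=> d dn; apply: weight_den0_lt.
      + by move=> i lin; rewrite hc // cE.
      + by move=> i; case: (h0 i).
    - move=> s2 _ [fr [iS _]]; have [hb hl] := iS n n0 (ltnSn n) (dvdnn n).
      eapply run_le.
      + apply: (output_prog_run ok n0 big (beta := beta) (X := D n)) => //.
        * by rewrite fr.
        * by rewrite fr //; case: (h0 0).
      + by move=> s3 _ ->; rewrite Dn mulKn.
      + exact: leqnn.
    - exact: leqnn.
  nia.
have bs : bounded V (fun _ _ => 0) by [].
have [s [t [ex bs' es tT]]] := RUN bs.
have Lb : Lynd w <= sigma ^ n.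
  by rewrite /Lynd; apply: leq_trans (max_card _) _; rewrite card_tuple card_ord.
have [t2 ev le2] := eval_big ok (s := s) (ltac:(by rewrite es; exact: big)).
have [t3 ch le3] := big _ Lb.
exists (update (mem n sigma ws s) 0 (Lynd w)), (t + (1 + t2 + t3)); split.
- apply: (ExecSeq (m1 := mem n sigma ws s)).
    by rewrite (_ : input w = mem n sigma ws (fun _ _ => 0)) //; apply/funext => a; rewrite (mem_init ok).
  apply: ExecWrite; [by apply: (eval_const ok)|by rewrite -es; exact: ev| |exact: ch].
  by apply: (ram_addressable ok).
- by [].
- have nn : n <= n * n by rewrite leq_pmulr.
  have -> : 500 * (2 * K + 80) * n ^ 2 = 500 * ((2 * K + 75) * (n * n)) + 2500 * (n * n).
    by rewrite -mulnn; lia.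
  by move: tT; rewrite /unit_time; lia.
Qed.

(** With [y = 2 * n * sigma], the bounds [4 <= y^2], [32 * n <= y^5] and [base n sigma <= y^3] give
    the exponent [2 + 3 * 5 + 2 * 3 = 23]. *)
Definition cell_bound (n sigma : nat) : nat := (2 * n * sigma) ^ 23.

Section CellBound.

Variables (n sigma : nat).
Hypotheses (n0 : 0 < n) (s0 : 0 < sigma).

Lemma cell_bound_ge e : e <= 23 -> (2 * n * sigma) ^ e <= cell_bound n sigma.
Proof. by move=> le; rewrite leq_pexp2l // !muln_gt0 n0 s0. Qed.

Lemma base_cell_bound : 4 * ((32 * n) ^ 3 * base n sigma ^ 2) <= cell_bound n sigma.
Proof.
rewrite /cell_bound; set y := 2 * n * sigma.
have y2 : 2 <= y by rewrite /y; nia.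
have y4 : 16 <= y ^ 4 by rewrite (@leq_exp2r 2 y 4).
have n5 : 32 * n <= y ^ 5 by rewrite expnS; have : 2 * n <= y; rewrite /y; nia.
have b3 : base n sigma <= y ^ 3.
  have : base n sigma <= y * y * 2; rewrite /base /y; first by nia.
  by rewrite -/y => h; apply: leq_trans h _; rewrite !expnS expn0 muln1 mulnA leq_mul2l y2 orbT.
have h1 : (32 * n) ^ 3 <= (y ^ 5) ^ 3 by rewrite leq_exp2r.
have h2 : base n sigma ^ 2 <= (y ^ 3) ^ 2 by rewrite leq_exp2r.
have h3 : 4 <= y ^ 2 by rewrite (@leq_exp2r 2 y 2).
have := leq_mul h3 (leq_mul h1 h2); rewrite -!expnM -!expnD => h.
by apply: leq_trans h _; rewrite leq_pexp2l //; lia.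
Qed.

End CellBound.

Section Letters.

Variables (sigma n : nat) (w : n.-tuple 'I_sigma).
Hypothesis n0 : 0 < n.

Lemma alphabet_gt0 : 0 < sigma.
Proof. exact: leq_ltn_trans (leq0n _) (ltn_ord (tnth w (Ordinal n0))). Qed.

Lemma ram_spec_input M :
  (forall v, v <= cell_bound n sigma ^ max_degree -> charge M v = Some 1 /\ addressable M v) ->
  ram_spec n sigma (map val w) M (cell_bound n sigma).
Proof.
move=> h; have s0 := alphabet_gt0.
have y2 : 2 <= 2 * n * sigma by nia.
have V1 : 2 * n * sigma <= cell_bound n sigma := @cell_bound_ge _ _ n0 s0 1 isT.
split=> [||||i|v /h[]|v /h[]] //.
- by rewrite size_map size_tuple.
- by apply: leq_trans (cell_bound_ge n0 s0 (e := 6) isT); rewrite (@leq_exp2r 2 _ 6).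
- by nia.
- by nia.
- case: (ltnP i n) => lin; last by rewrite nth_default // size_map size_tuple.
  by rewrite (nth_map (tnth w (Ordinal lin))) ?size_tuple //;
    apply: leq_trans (ltnW (ltn_ord _)) _; nia.
Qed.

End Letters.

(** [2 * n * sigma] is at most [2 ^ (3 * W)], so the largest small value is at most [2 ^ (828 * W)]
    with [828 = 3 * 23 * 12]; one more word makes the inequality strict. *)
Lemma cell_bound_word sigma n W : 0 < W -> 0 < sigma -> 0 < n ->
  maxn (up_log 2 sigma) (up_log 2 n) <= W ->
  cell_bound n sigma ^ max_degree < 2 ^ (829 * W).
Proof.
move=> W0 s0 n0; rewrite geq_max => /andP[hs hn].
have pw x : up_log 2 x <= W -> x <= 2 ^ W.
  by move=> h; apply: leq_trans (up_logP x (isT : 1 < 2)) _; rewrite leq_exp2l.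
have y3 : 2 * n * sigma <= 2 ^ (3 * W).
  have -> : 2 ^ (3 * W) = 2 ^ W * 2 ^ W * 2 ^ W by rewrite -!expnD; congr (2 ^ _); lia.
  apply: leq_mul; last exact: pw.
  by apply: leq_mul; [rewrite -{1}(expn1 2) leq_exp2l|exact: pw].
apply: leq_ltn_trans (_ : 2 ^ (828 * W) < _); last by rewrite ltn_exp2l //; lia.
rewrite /cell_bound -expnM (_ : 828 * W = 3 * W * (23 * max_degree)).
  by rewrite [in X in _ <= X]expnM leq_exp2r.
by rewrite /max_degree; lia.
Qed.

Theorem theorem1 :
  (exists (p : cmd) (k c : nat),
     forall (sigma n W : nat) (w : n.-tuple 'I_sigma),
       0 < n -> 0 < W -> maxn (up_log 2 sigma) (up_log 2 n) <= W ->
       computes_within (word_ram k W sigma n) p (input w) (Lynd w)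
         (c * (n ^ 2 * log_factor sigma)))
  /\
  (exists (p : cmd) (c : nat),
     forall (sigma n : nat) (w : n.-tuple 'I_sigma),
       0 < n ->
       computes_within unit_cost_ram p (input w) (Lynd w) (c * n ^ 2)).
Proof.
have [C correct] := lynd_prog_correct; split.
  exists lynd_prog, 829, C => sigma n W w n0 W0 hW.
  have s0 := alphabet_gt0 w n0; have lt := cell_bound_word W0 s0 n0 hW.
  have [] := correct sigma n w (word_ram 829 W sigma n) (cell_bound n sigma) n0.
  - by apply: ram_spec_input => // v h; rewrite /= (leq_ltn_trans h lt).
  - exact: base_cell_bound.
  (* Up to [sigma ^ n] the charge is 1 or [n], according to whether the number fits in 829 words. *)
  - move=> v vs; rewrite /affordable [charge _ _]/= vs; case: ifP => _.
      by exists 1.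
    by exists n.
  move=> m [t [ex res le]]; exists m, t; split=> //; apply: leq_trans le _.
  (* The time is [C * n ^ 2] on this machine too, and [log_factor] is at least 1. *)
  by rewrite leq_mul2l leq_pmulr ?orbT // /log_factor leq_max.
exists lynd_prog, C => sigma n w n0.
have s0 := alphabet_gt0 w n0.
apply: (correct sigma n w unit_cost_ram (cell_bound n sigma) n0).
- exact: ram_spec_input.
- exact: base_cell_bound.
- by move=> v _; exists 1.
Qed.
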